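(* Assume that $B$ is a basis of $L$ and that $P_{\mathcal N}=m(s)\cdot P_B$. Then $v$ is an exponent of $H_A(\beta)$ with respect to $w$, and the set $$\{(q(\partial_s)\bullet\widetilde F_{\mathcal N}(x,s))_{|s=0}: q(\partial_s)\in P_{\mathcal N}^\perp\}$$ spans the space of series solutions in the direction of $w$ to $M_A(\beta)$ with exponent $v$. In particular, for $q(\partial_s)\in P_{\mathcal N}^\perp$, the solution $(q(\partial_s)\bullet\widetilde F_{\mathcal N}(x,s))_{|s=0}$ has the starting term $x^v\,\Psi_B\bigl(m(\partial_z)\star q(\partial_s)\bigr)(\log x)$.
   Context: $\mathbb N=\{0,1,2,\dots\}$. $A=(a_{ij})$ is a $d\times n$ integer matrix of rank $d$ which is homogeneous: all its columns lie on one hyperplane of $\mathbb Q^d$ not passing through the origin. $L=\{u\in\mathbb Z^n: Au=0\}$. Each $u\in\mathbb Z^n$ is written uniquely as $u=u_+-u_-$ with $u_\pm\in\mathbb N^n$ of disjoint supports. $I_A=\langle\partial^u-\partial^{u'}: u,u'\in\mathbb N^n, Au=Au'\rangle\subset\mathbb C[\partial_1,\dots,\partial_n]$. For $\beta\in\mathbb C^d$, $H_A(\beta)$ is the left ideal of the Weyl algebra $D=\mathbb C\langle x,\partial\rangle$ generated by $I_A$ and $\sum_j a_{ij}\theta_j-\beta_i$ ($i=1,\dots,d$), $\theta_j=x_j\partial_j$, and $M_A(\beta)=D/H_A(\beta)$; solutions are series annihilated by $H_A(\beta)$. For $v\in\mathbb C^n$, $u\in\mathbb N^n$: $[v]_u=\prod_j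 v_j(v_j-1)\cdots(v_j-u_j+1)$ (same formula for entries polynomial in $s$); $\mathrm{nsupp}(v)=\{j: v_j\in\mathbb Z_{<0}\}$. Fix a generic weight $w$ and a fake exponent $v$ of $H_A(\beta)$ with respect to $w$: $Av=\beta$ and $[v]_{u_+}=0$ for all $u\in L$ with $u_+\cdot w>u_-\cdot w$. $v$ is an exponent if it is a zero of the indicial ideal $\mathrm{ind}_w(H_A(\beta))=\bigl(\mathbb C(x)\langle\partial\rangle\cdot\mathrm{in}_{(-w,w)}(H_A(\beta))\bigr)\cap\mathbb C[\theta_1,\dots,\theta_n]$. Write $I_u=\mathrm{nsupp}(v+u)$ for $u\in L$. $B=\{b^{(1)},\dots,b^{(h)}\}\subset L$ is also regarded as the $n\times h$ matrix with these columns; $\mathrm{supp}(B)$ is the set of indices of its nonzero rows. (When $B$ is a basis of $L$, $I_0\subset\mathrm{supp}(B)\cup I_u$ holds for all $u\in L$.) $s=(s_1,\dots,s_h)^T$ are indeterminates, $(Bs)_j=\sum_k b_j^{(k)}s_k$, $(Bs)^J=\prod_{j\in J}(Bs)_j$; $a_u(s)=[v+Bs]_{u_-}/[v+Bs+u]_{u_+}$ for $u\in L$. Let $\{\partial^{g_+^{(i)}}-\partial^{g_-^{(i)}}: i=1,\dots,M\}$ be the reduced Gröbner basis of $I_A$ with respect to $w$, $\partial^{g_+^{(i)}}\in\mathrm{in}_w(I_A)$; $C(w)=\sum_i\mathbb Ng^{(i)}$; $G^{(i)}=I_{-g^{(i)}}\setminus I_0$. Put $\mathrm{NS}_w(v)=\{I_u: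 u\in L,\text{ and every }u'\in L\text{ with }I_{u'}=I_u\text{ lies in }C(w)\}$, $\mathcal N=\{I\in\mathrm{NS}_w(v):\mathrm{supp}(B)\cup I=\mathrm{supp}(B)\cup I_0\}$, $\mathcal N^c=\{I_u:u\in L,\mathrm{supp}(B)\cup I_u=\mathrm{supp}(B)\cup I_0\}\setminus\mathcal N$, $L'=\{u\in L:I_u\in\mathcal N\}$, $K_{\mathcal N}=\bigcap_{I\in\mathcal N}I$, $m(s)=(Bs)^{I_0\setminus K_{\mathcal N}}$, $P_{\mathcal N}=\langle(Bs)^{(I\cup J)\setminus K_{\mathcal N}}:I\in\mathcal N,J\in\mathcal N^c\rangle$ and $P_B=\langle(Bs)^{G^{(i)}}:i=1,\dots,M\rangle$ in $\mathbb C[s]$. For a homogeneous ideal $P\subset\mathbb C[s]$, $P^\perp=\{q(\partial_s)\in\mathbb C[\partial_s]:(q(\partial_s)\bullet h(s))_{|s=0}=0\ \forall h\in P\}$, where $\mathbb C[\partial_s]=\mathbb C[\partial_{s_1},\dots,\partial_{s_h}]$. $\widetilde F_{\mathcal N}(x,s)=m(s)\sum_{u\in L'}a_u(s)x^{v+Bs+u}$, with $x^{v+Bs+u}=x^{v+u}\exp(\sum_{j,k}(\log x_j)b_j^{(k)}s_k)$, operators in $s$ and evaluation at $s=0$ being applied termwise. For $U(\partial_z)\in\mathbb C[\partial_{z_1},\dots,\partial_{z_h}]$ and $q(\partial_s)\in\mathbb C[\partial_s]$, $U(\partial_z)\star q(\partial_s):=(U(\partial_z)\bullet q(z))_{|z=\partial_s}$.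 $\Psi_B:\mathbb C[\partial_s]\to\mathbb C[x]$ is the ring homomorphism $\Psi_B(q(\partial_s))(x)=q\bigl(\sum_jb_j^{(1)}x_j,\dots,\sum_jb_j^{(h)}x_j\bigr)$; $\log x=(\log x_1,\dots,\log x_n)$. Terminology: homogeneity of $A$ makes $M_A(\beta)$ regular holonomic, so for the generic weight $w$ its solution space has a basis of canonical series (in the direction of $w$), each with a starting monomial $x^{v'}(\log x)^b$ for some exponent $v'$ and some $b\in\mathbb N^n$. Series solutions with exponent $v$ are those with starting monomial $x^v(\log x)^b$ for some $b$; the dimension of the space of series solutions with exponent $v$ equals the dimension of the solution space of the primary component at $v$ of $\mathrm{ind}_w(H_A(\beta))$. The starting term of $(q(\partial_s)\bullet\widetilde F_{\mathcal N}(x,s))_{|s=0}$ is its part coming from $u=0$.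
   Formalization: Solutions starting with x^v(log x)^b are not a linear space, as adding a solution with a later exponent gives another; so ''spans'' is read as: the set consists of solutions with no term of weight below x^v, and its span attains the x^v-part of every such solution. *)

(* Defs.v *)
From HB Require Import structures.
From mathcomp Require Import all_boot all_order all_algebra.
From mathcomp Require Import boolp reals complex mpoly.

Set Implicit Arguments.
Unset Strict Implicit.
Unset Printing Implicit Defensive.

Import Order.TTheory GRing.Theory Num.Theory.
Local Open Scope ring_scope.

(* The field of complex numbers is [R[i]] for [R : realType]. *)

Section Generalities.

Definition ideal_gen (T : comNzRingType) (G : T -> Prop) (p : T) : Prop :=
  exists k (c g : 'I_k -> T),
    (forall i, G (g i)) /\ p = \sum_(i < k) c i * g i.

Definition falling (T : comNzRingType) n (x : 'I_n -> T) (m : 'X_{1..n}) : T :=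
  \prod_(j < n) \prod_(i < m j) (x j - i%:R).

(* [iter_mon T m] is the monomial operator prod_j (T j)^(m j). *)
Definition iter_mon n (V : Type) (T : 'I_n -> V -> V) (m : 'X_{1..n}) (x : V)
    : V :=
  foldr (fun j => iter (m j) (T j)) x (enum 'I_n).

(* q(d/ds) . p *)
Definition diffop (T : comNzRingType) h (q p : {mpoly T[h]}) : {mpoly T[h]} :=
  \sum_(m <- msupp q) q@_m *: p^`M[m].

(* The extension of a derivation to the fraction field, by the quotient rule. *)
Definition frac_deriv (T : idomainType) (delta : T -> T) (f : {fraction T})
    : {fraction T} :=
  let r := repr f in
  FracField.tofrac (delta \n_r * \d_r - \n_r * delta \d_r)
    / FracField.tofrac (\d_r ^+ 2).

(* The value at 0 of a rational function; 0 if it is not regular there. *)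
Definition frac_eval0 (F : fieldType) h (f : {fraction {mpoly F[h]}}) : F :=
  match pselect (exists r : {mpoly F[h]} * {mpoly F[h]},
      r.2.@[fun=> 0] != 0 /\ f = FracField.tofrac r.1 / FracField.tofrac r.2)
  with
  | left e => let r := projT1 (cid e) in r.1.@[fun=> 0] / r.2.@[fun=> 0]
  | right _ => 0
  end.

End Generalities.

(* For a commutative ring S with commuting derivations delta_j, the ring
   S<d_1,...,d_n> of differential operators is the free left S-module on the
   monomials d^b; an operator in normal form sum_b c_b d^b is encoded as the
   element sum_b c_b 'X_[b] of {mpoly S[n]}. The product of operators is
   [op_mul], not the commutative product of {mpoly S[n]}. *)
Section Operators.
Context (n : nat) (S : comNzRingType) (delta : 'I_n -> S -> S).

(* d_j . (c d^b) = c d_j d^b + delta_j(c) d^b *)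
Definition op_partial (j : 'I_n) (Q : {mpoly S[n]}) : {mpoly S[n]} :=
  'X_j * Q + map_mpoly (delta j) Q.

Definition op_mul (P Q : {mpoly S[n]}) : {mpoly S[n]} :=
  \sum_(b <- msupp P) P@_b *: iter_mon op_partial b Q.

Definition left_ideal (G : {mpoly S[n]} -> Prop) (P : {mpoly S[n]}) : Prop :=
  exists k (c g : 'I_k -> {mpoly S[n]}),
    (forall i, G (g i)) /\ P = \sum_(i < k) op_mul (c i) (g i).

End Operators.

Section Weyl.
Context (R : realType) (n : nat).
Local Notation C := R[i].
Local Notation Cx := {mpoly C[n]}.

(* The Weyl algebra D = C<x, d> and the ring C(x)<d>. *)
Definition weyl : Type := {mpoly Cx[n]}.
Definition weyl_left_ideal : (weyl -> Prop) -> weyl -> Prop :=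
  left_ideal (@mderiv n C).

Definition ratweyl : Type := {mpoly {fraction Cx}[n]}.
Definition ratweyl_delta (j : 'I_n) : {fraction Cx} -> {fraction Cx} :=
  frac_deriv (@mderiv n C j).

(* The pairs (a, b) such that x^a d^b occurs in the normal form of P. *)
Definition weyl_terms (P : weyl) : seq ('X_{1..n} * 'X_{1..n}) :=
  [seq (a, b) | b <- msupp P, a <- msupp P@_b].

Definition mweight (w : 'cV[R]_n) (m : 'X_{1..n}) : R :=
  \sum_(j < n) w j 0 * (m j)%:R.

(* in_(-w,w): the terms of maximal weight, x^a d^b having weight -w.a + w.b. *)
Definition weyl_init (w : 'cV[R]_n) (P : weyl) : weyl :=
  let wt t := - mweight w t.1 + mweight w t.2 in
  \sum_(t <- weyl_terms P | all (fun t' => wt t' <= wt t) (weyl_terms P))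
    (P@_t.2@_t.1 *: 'X_[t.1] : Cx) *: 'X_[t.2].

Definition weyl_init_ideal (w : 'cV[R]_n) (H : weyl -> Prop) (Q : weyl)
    : Prop :=
  exists k (c : 'I_k -> C) (P : 'I_k -> weyl),
    (forall i, H (P i)) /\ Q = \sum_(i < k) (c i)%:MP *: weyl_init w (P i).

(* p(theta_1, ..., theta_n) as an element of C(x)<d>, theta_j = x_j d_j. *)
Definition theta_poly (p : Cx) : ratweyl :=
  \sum_(m <- msupp p) FracField.tofrac (p@_m)%:MP *:
    iter_mon (fun j => op_mul ratweyl_delta (FracField.tofrac 'X_j *: 'X_j))
      m 1.

Definition indicial_ideal (w : 'cV[R]_n) (H : weyl -> Prop) (p : Cx) : Prop :=
  left_ideal ratweyl_delta
    (fun Q => exists2 P : weyl, weyl_init_ideal w H P &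
       Q = map_mpoly (@FracField.tofrac Cx) P)
    (theta_poly p).

Definition poly_init (w : 'cV[R]_n) (p : Cx) : Cx :=
  \sum_(m <- msupp p | all (fun m' => mweight w m' <= mweight w m) (msupp p))
    p@_m *: 'X_[m].

Definition poly_init_ideal (w : 'cV[R]_n) (I : Cx -> Prop) : Cx -> Prop :=
  ideal_gen (fun p => exists2 p', I p' & p = poly_init w p').

Definition reduced_groebner_basis (w : 'cV[R]_n) (I : Cx -> Prop)
    (M : nat) (G : 'I_M -> Cx) : Prop :=
  [/\ forall i, I (G i),
      forall p, poly_init_ideal w I p <->
        ideal_gen (fun p' => exists i, p' = poly_init w (G i)) p,
      forall i, exists m, poly_init w (G i) = 'X_[m] &
      forall i j, i != j -> forall m m', m \in msupp (poly_init w (G i)) ->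
        m' \in msupp (G j) -> ~~ (m <= m')%MM].

End Weyl.

(* Formal series sum_a x^a f_a(log x), a in C^n, with f_a a polynomial, are
   encoded as functions a |-> f_a; the j-th variable of f_a is log x_j. *)
Section Series.
Context (R : realType) (n : nat).
Local Notation C := R[i].

Definition series : Type := 'cV[C]_n -> {mpoly C[n]}.

Definition ser_x (j : 'I_n) (f : series) : series :=
  fun a => f (a - delta_mx j 0).

(* d_j (x^a p(log x)) = x^(a - e_j) (a_j p + dp/dy_j)(log x) *)
Definition ser_partial (j : 'I_n) (f : series) : series :=
  fun a => let b := a + delta_mx j 0 in b j 0 *: f b + (f b)^`M(j).

Definition weyl_act (P : weyl R n) (f : series) : series :=
  fun a => \sum_(t <- weyl_terms P)
    P@_t.2@_t.1 *: iter_mon ser_x t.1 (iter_mon ser_partial t.2 f) a.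

Definition re_weight (w : 'cV[R]_n) (a : 'cV[C]_n) : R :=
  \sum_(j < n) w j 0 * complex.Re (a j 0).

Definition int_vec (u : 'cV[int]_n) : 'cV[C]_n := map_mx intr u.

(* The Nilsson series in the direction of w: the powers of the logarithms are
   bounded, and the exponents lie in finitely many translates of the set of
   integer points of a cone whose dual cone contains a neighbourhood of w. *)
Definition nilsson (w : 'cV[R]_n) (f : series) : Prop :=
  exists (E : seq 'cV[C]_n) (k : nat) (eps : R), 0 < eps /\
    forall a, f a != 0 -> (msize (f a) <= k)%N /\
      exists2 e, e \in E & exists2 u : 'cV[int]_n, a = e + int_vec u &
        forall w' : 'cV[R]_n, (forall j, `|w' j 0 - w j 0| < eps) ->
          0 <= \sum_(j < n) w' j 0 * (u j 0)%:~R.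

Definition series_span (S : series -> Prop) (f : series) : Prop :=
  exists k (c : 'I_k -> C) (g : 'I_k -> series),
    (forall i, S (g i)) /\ forall a, f a = \sum_(i < k) c i *: g i a.

(* No term of f has a smaller w-weight than x^v. *)
Definition weight_ge (w : 'cV[R]_n) (v : 'cV[C]_n) (f : series) : Prop :=
  forall a, f a != 0 -> re_weight w v <= re_weight w a.

(* The part of f with exponent v is x^v p(log x), and every other term of f has
   strictly larger w-weight. *)
Definition starting_term (w : 'cV[R]_n) (v : 'cV[C]_n) (f : series)
    (p : {mpoly C[n]}) : Prop :=
  f v = p /\
  forall a, a != v -> f a != 0 -> re_weight w v < re_weight w a.

End Series.

Section Hypergeometric.
Context (R : realType) (d n : nat) (A : 'M[int]_(d, n)).
Local Notation C := R[i].
Local Notation Cx := {mpoly C[n]}.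

(* All columns of A lie on the hyperplane c . y = k, with k <> 0. *)
Definition homogeneous_matrix : Prop :=
  exists2 c : 'rV[rat]_d, c != 0 & exists2 k : rat, k != 0 &
    forall j, (c *m map_mx intr A) 0 j = k.

Definition inL (u : 'cV[int]_n) : Prop := A *m u = 0.

Definition pos_part (u : 'cV[int]_n) : 'X_{1..n} :=
  [multinom absz (Num.max (u j 0) 0)%R | j < n].
Definition neg_part (u : 'cV[int]_n) : 'X_{1..n} := pos_part (- u).

Definition mnm_vec (m : 'X_{1..n}) : 'cV[int]_n := \col_j (m j)%:Z.

Definition toric_ideal : Cx -> Prop :=
  ideal_gen (fun p => exists u u' : 'X_{1..n},
    A *m mnm_vec u = A *m mnm_vec u' /\ p = 'X_[u] - 'X_[u']).

Definition hyp_generator (beta : 'cV[C]_d) (P : weyl R n) : Prop :=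
  (exists2 p, toric_ideal p & P = map_mpoly (@mpolyC n C) p) \/
  (exists i, P = \sum_(j < n) ((A i j)%:~R * 'X_j : Cx) *: 'X_j
                 - (beta i 0)%:MP%:MP).

Definition hyp_ideal (beta : 'cV[C]_d) : weyl R n -> Prop :=
  weyl_left_ideal (hyp_generator beta).

(* w lies in an open cone of the small Groebner fan of H_A(beta), and in_w(I_A)
   is a monomial ideal. *)
Definition generic_weight (beta : 'cV[C]_d) (w : 'cV[R]_n) : Prop :=
  (forall p, poly_init_ideal w toric_ideal p ->
     forall m, m \in msupp p -> poly_init_ideal w toric_ideal 'X_[m]) /\
  exists2 eps : R, 0 < eps &
    forall w' : 'cV[R]_n, (forall j, `|w' j 0 - w j 0| < eps) ->
      forall Q, weyl_init_ideal w' (hyp_ideal beta) Q <->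
                weyl_init_ideal w (hyp_ideal beta) Q.

Definition fake_exponent (beta : 'cV[C]_d) (w : 'cV[R]_n) (v : 'cV[C]_n)
    : Prop :=
  map_mx intr A *m v = beta /\
  forall u, inL u -> mweight w (neg_part u) < mweight w (pos_part u) ->
    falling (fun j => v j 0) (pos_part u) = 0.

Definition exponent (beta : 'cV[C]_d) (w : 'cV[R]_n) (v : 'cV[C]_n) : Prop :=
  forall p, indicial_ideal w (hyp_ideal beta) p -> p.@[fun j => v j 0] = 0.

Definition series_solution (beta : 'cV[C]_d) (w : 'cV[R]_n) (f : series R n)
    : Prop :=
  nilsson w f /\ forall P, hyp_ideal beta P -> forall a, weyl_act P f a = 0.

(* The series solutions whose starting monomial is of the form x^v (log x)^b are
   not closed under addition, and adding to one of them a solution that starts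
   at a later exponent gives another one. The space of series solutions with
   exponent v is therefore read as the space of the solutions that have no term
   of w-weight smaller than that of x^v, modulo those without x^v-term: two
   solutions f and f' are identified when f v = f' v. *)
Definition spans_solutions_with_exponent (beta : 'cV[C]_d) (w : 'cV[R]_n)
    (v : 'cV[C]_n) (S : series R n -> Prop) : Prop :=
  (forall f, S f -> series_solution beta w f /\ weight_ge w v f) /\
  (forall f, series_solution beta w f -> weight_ge w v f ->
     exists2 f', series_span S f' & f' v = f v).

Definition nsupp (v : 'cV[C]_n) : {set 'I_n} :=
  [set j | `[< exists k : nat, v j 0 = - k.+1%:R >]].

Definition Iset (v : 'cV[C]_n) (u : 'cV[int]_n) : {set 'I_n} :=
  nsupp (v + int_vec R u).

Definition binomial_of (g : 'cV[int]_n) : Cx :=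
  'X_[pos_part g] - 'X_[neg_part g].

(* The g_i parametrize the reduced Groebner basis of I_A with respect to w. *)
Definition toric_groebner_basis (w : 'cV[R]_n) M (g : 'I_M -> 'cV[int]_n)
    : Prop :=
  [/\ forall i, inL (g i),
      reduced_groebner_basis w toric_ideal (fun i => binomial_of (g i)) &
      forall i, poly_init_ideal w toric_ideal 'X_[pos_part (g i)]].

Definition lattice_basis h (B : 'M[int]_(n, h)) : Prop :=
  A *m B = 0 /\ forall u, inL u -> exists! c : 'cV[int]_h, u = B *m c.

Definition suppB h (B : 'M[int]_(n, h)) : {set 'I_n} :=
  [set j | row j B != 0].

Section Ftilde.
Context (v : 'cV[C]_n) (h M : nat).
Context (B : 'M[int]_(n, h)) (g : 'I_M -> 'cV[int]_n).
Local Notation Cs := {mpoly C[h]}.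
Local Notation "x %:F" := (FracField.tofrac x).

Definition Cw (u : 'cV[int]_n) : Prop :=
  exists c : 'I_M -> nat, u = \sum_(i < M) g i *+ c i.

Definition NSw : {set {set 'I_n}} :=
  [set I | `[< exists u, [/\ inL u, I = Iset v u &
                 forall u', inL u' -> Iset v u' = I -> Cw u'] >]].

Definition calN : {set {set 'I_n}} :=
  [set I in NSw | suppB B :|: I == suppB B :|: Iset v 0].

Definition calNc : {set {set 'I_n}} :=
  [set I | `[< exists2 u, inL u & I = Iset v u >] &
           suppB B :|: I == suppB B :|: Iset v 0] :\: calN.

Definition KN : {set 'I_n} := \bigcap_(I in calN) I.

Definition inL' (u : 'cV[int]_n) : Prop := inL u /\ Iset v u \in calN.

Definition Bs (j : 'I_n) : Cs := \sum_(k < h) (B j k)%:~R *: 'X_k.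

Definition Bspow (J : {set 'I_n}) : Cs := \prod_(j in J) Bs j.

Definition ms : Cs := Bspow (Iset v 0 :\: KN).

Definition PN : Cs -> Prop :=
  ideal_gen (fun p => exists I J, [/\ I \in calN, J \in calNc &
    p = Bspow ((I :|: J) :\: KN)]).

Definition PB : Cs -> Prop :=
  ideal_gen (fun p => exists i : 'I_M,
    p = Bspow (Iset v (- g i) :\: Iset v 0)).

(* q(d/ds) is encoded as the polynomial q. *)
Definition perp (P : Cs -> Prop) (q : Cs) : Prop :=
  forall p, P p -> (diffop q p).@[fun=> 0] = 0.

Definition a_u (u : 'cV[int]_n) : {fraction Cs} :=
  (falling (fun j => (v j 0)%:MP + Bs j) (neg_part u))%:F /
  (falling (fun j => (v j 0)%:MP + Bs j + (u j 0)%:~R) (pos_part u))%:F.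

(* An element F of {mpoly {fraction Cs}[n]} stands for the function
   F(s, log x) exp(sum_(j, k) (log x_j) b_j^(k) s_k) of s; [exp_partial k] is
   the derivative d/ds_k of such functions. *)
Definition exp_partial (k : 'I_h) (F : {mpoly {fraction Cs}[n]})
    : {mpoly {fraction Cs}[n]} :=
  map_mpoly (frac_deriv (@mderiv h C k)) F
    + (\sum_(j < n) (B j k)%:~R *: 'X_j) * F.

Definition exp_diffop (q : Cs) (F : {mpoly {fraction Cs}[n]})
    : {mpoly {fraction Cs}[n]} :=
  \sum_(m <- msupp q) ((q@_m)%:MP)%:F *: iter_mon exp_partial m F.

(* The polynomial in log x that is the coefficient of x^(v+u) in
   (q(d/ds) . Ftilde_N(x, s))_(s=0), for u in L'. *)
Definition Ftilde_coef (q : Cs) (u : 'cV[int]_n) : {mpoly C[n]} :=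
  map_mpoly (@frac_eval0 C h) (exp_diffop q ((ms)%:F * a_u u)%:MP).

(* (q(d/ds) . Ftilde_N(x, s))_(s=0) *)
Definition Ftilde (q : Cs) : series R n := fun a =>
  match pselect (exists u, inL' u /\ a = v + int_vec R u) with
  | left e => Ftilde_coef q (projT1 (cid e))
  | right _ => 0
  end.

Definition PsiB (q : Cs) : {mpoly C[n]} :=
  q \mPo [tuple \sum_(j < n) (B j k)%:~R *: 'X_j | k < h].

End Ftilde.
End Hypergeometric.

(* Main.v *)
(* For f regular at s = 0, the value at s = 0 of q(d_s) . (f(s) x^(Bs)) is
   Psi_B(f(d_z) * q)(log x): a quotient f = a/b acts through a(d_z) b(d_z)^-1,
   and b(d_z) is invertible on polynomials because it is a nonzero constant plus
   an operator lowering degrees. Up to a unit at s = 0, the function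
   m(s) a_u(s) [v+Bs+u]_p is (Bs)^(I_(u-p) - K_N) for u in L'. Hence the terms of
   (d^p - d^p') F_N(x, s) that do not cancel, those with u in L' and u-p+p' not in
   L', have their coefficients in P_N, and q in P_N^perp kills them: the series of
   the theorem are solutions. That 0 lies in L' is seen as follows: if I_u = I_0
   then d^(u_-) is a standard monomial, since [v]_(g_+) = 0 for each g in the
   Groebner basis, so that d^(u_+) reduces to d^(u_-), and u lies in C(w).

   No dimension count is needed for spanning. If f is a solution without terms of
   weight below x^v and with x^v-part p, the Euler operators force p = Psi_B(r),
   and the operators d^(g_+) - d^(g_-), read at the exponent v - g_+, force r to be
   in P_B^perp. Since m(d_z) is surjective on polynomials and P_N = m P_B, one has
   r = m * q for some q in P_N^perp, and the series of q has x^v-part p. For r = 1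
   this gives a solution with starting term x^v; the part of lowest weight of
   P f = 0 is in(P) x^v = 0, and therefore v is a zero of the indicial ideal. *)

(* Membership in P^perp is used in its apolar form. The pairing of q with p, the value at 0 of
   q(d_s) p, is symmetric and nondegenerate, and multiplication by a polynomial is adjoint to the
   operator which that polynomial defines; hence q is orthogonal to an ideal exactly when each
   generator, read as an operator, kills the polynomial q. Factors in s thus become operators on q,
   and the derivatives of a_u(s) need not be computed: only the order of a_u along each linear form
   (Bs)_j matters, and this is the order of a quotient of Gamma values. The forms that occur are
   nonzero, because an index of I_0 outside supp(B) lies in every I_u, hence in K_N. Weights are
   real numbers, so that their decrease alone does not make division by the Groebner basis
   terminate; homogeneity of A does, since it makes each fibre of monomials finite. The indicial
   ideal involves rational coefficients, while x^v is not in C(x); so C(x)<d> acts on C(x) by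
   derivations twisted by v, with 1 in the role of x^v. *)
Require Import Defs.
From HB Require Import structures.
From mathcomp Require Import all_boot all_order all_algebra ring zify.
From mathcomp Require Import functions boolp reals complex ssrcomplements mpoly.

Set Implicit Arguments.
Unset Strict Implicit.
Unset Printing Implicit Defensive.

Import Order.TTheory GRing.Theory Num.Theory.
Local Open Scope ring_scope.

(** * Constant coefficient operators on polynomials *)

Section MpolySums.
Context (n : nat) (T : nzRingType) (V : nmodType).

(** Different polynomials have different supports; the monomials of bounded degree are a common
    index set, on which additivity can be checked term by term. *)
Lemma msupp_sum_widen (G : 'X_{1..n} -> T -> V) (p : {mpoly T[n]}) k :
  (forall m, G m 0 = 0) -> (msize p <= k)%N ->
  \sum_(m <- msupp p) G m p@_m = \sum_(m : 'X_{1..n < k}) G m p@_m.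
Proof.
move=> G0 le_pk; rewrite (big_mksub 'X_{1..n < k}) ?msupp_uniq //=; last first.
  by move=> m /msize_mdeg_lt /leq_trans; apply.
by rewrite big_rmcond //= => m /memN_msupp_eq0 ->.
Qed.

Lemma msupp_sumD (G : 'X_{1..n} -> T -> V) (p q : {mpoly T[n]}) :
  (forall m, G m 0 = 0) ->
  (forall m, {morph G m : a b / a + b}) ->
  \sum_(m <- msupp (p + q)) G m (p + q)@_m
    = \sum_(m <- msupp p) G m p@_m + \sum_(m <- msupp q) G m q@_m.
Proof.
move=> G0 GD; pose k := maxn (msize p) (msize q).
rewrite !(@msupp_sum_widen _ _ k) ?leq_maxl ?leq_maxr ?msizeD_le //.
by rewrite -big_split /=; apply: eq_bigr => m _; rewrite mcoeffD GD.
Qed.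

Lemma msupp_sumX (G : 'X_{1..n} -> T -> V) m :
  \sum_(m' <- msupp ('X_[m] : {mpoly T[n]})) G m' ('X_[m] : {mpoly T[n]})@_m'
    = G m 1.
Proof. by rewrite msuppX big_seq1 mcoeffX eqxx. Qed.

Lemma msupp_sumZX (G : 'X_{1..n} -> T -> V) c m :
  (forall m, G m 0 = 0) ->
  \sum_(m' <- msupp (c *: 'X_[m] : {mpoly T[n]}))
     G m' (c *: 'X_[m] : {mpoly T[n]})@_m' = G m c.
Proof.
move=> G0; have [->|c0] := eqVneq c 0; last first.
  by rewrite msuppMCX // big_seq1 mcoeffZ mcoeffX eqxx mulr1.
by rewrite scale0r msupp0 big_nil G0.
Qed.

End MpolySums.

Section MpolyInduction.
Context (n : nat) (T : comNzRingType).

Lemma mpoly_ring_ind (P : {mpoly T[n]} -> Prop) :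
  (forall c, P c%:MP) -> (forall i, P 'X_i) ->
  (forall p q, P p -> P q -> P (p + q)) ->
  (forall p q, P p -> P q -> P (p * q)) -> forall p, P p.
Proof.
move=> PC PX PD PM; elim/mpolyind => [|c m p _ _ Pp]; first by rewrite -mpolyC0.
apply: (PD) => //; rewrite -mul_mpolyC; apply: (PM) => //.
rewrite mpolyXE_id; apply: big_ind => [||i _]; [by rewrite -mpolyC1 | exact: PM |].
by elim: (m i) => [|e IH]; rewrite ?expr0 ?exprS -?mpolyC1 //; apply: PM.
Qed.

Lemma meval0E (p : {mpoly T[n]}) : p.@[fun=> 0] = p@_0%MM.
Proof.
elim/mpoly_ring_ind: p => [c|i|p q|p q].
- by rewrite mevalC mcoeffC eqxx mulr1.
- by rewrite mevalXU mcoeffX mnm1_eq0.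
- by rewrite mevalD mcoeffD => -> ->.
- by rewrite mevalM rmorphM /= => -> ->.
Qed.

Lemma mderivXU (i j : 'I_n) : ('X_i : {mpoly T[n]})^`M(j) = (i == j)%:R.
Proof.
rewrite mderivX mnm1E; case: eqP => [->|_]; last by rewrite scale0r.
by rewrite scale1r -{1}[U_(j)%MM]add0m addmK mpolyX0.
Qed.

(** The chain rule for an arbitrary derivation of the target: it serves both for a partial
    derivative after the substitution [PsiB] and for the t-derivative along the flow in
    [PsiB_surj]. *)
Lemma mmap_chain (S : comNzRingType) (f : {rmorphism T -> S}) (x : 'I_n -> S)
    (D : S -> S) (p : {mpoly T[n]}) :
  {morph D : a b / a + b} -> (forall a b, D (a * b) = D a * b + a * D b) ->
  (forall c, D (f c) = 0) ->
  D (mmap f x p) = \sum_(j < n) mmap f x p^`M(j) * D (x j).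
Proof.
move=> DD DM Df; elim/mpoly_ring_ind: p => [c|i|p q IHp IHq|p q IHp IHq].
- by rewrite mmapC Df big1 // => j _; rewrite mderivC mmap0 mul0r.
- rewrite mmapX mmap1U (bigD1 i) //= big1 ?addr0 => [|j ne_ji].
    by rewrite mderivXU eqxx rmorph1 mul1r.
  by rewrite mderivXU eq_sym (negPf ne_ji) mmap0 mul0r.
- rewrite rmorphD DD IHp IHq -big_split; apply: eq_bigr => j _ /=.
  by rewrite mderivD rmorphD mulrDl.
- rewrite rmorphM DM IHp IHq mulr_suml mulr_sumr -big_split.
  apply: eq_bigr => j _ /=.
  rewrite mderivM rmorphD !rmorphM mulrDl; congr (_ + _); first exact: mulrAC.
  exact: mulrA.
Qed.

End MpolyInduction.

Section DiffopRing.
Context (T : comNzRingType) (h : nat).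
Implicit Types p q r : {mpoly T[h]}.

Lemma diffopE q p k : (msize q <= k)%N ->
  diffop q p = \sum_(m : 'X_{1..h < k}) q@_m *: p^`M[m].
Proof.
move=> ?; rewrite /diffop.
by apply: (@msupp_sum_widen _ _ _ (fun m c => c *: p^`M[m])) => // m; rewrite scale0r.
Qed.

Lemma diffop_is_linear q : linear (diffop q).
Proof.
move=> c p r; rewrite /diffop scaler_sumr -big_split; apply: eq_bigr => m _ /=.
by rewrite linearP scalerDr !scalerA mulrC.
Qed.

HB.instance Definition _ q := GRing.isLinear.Build T {mpoly T[h]} {mpoly T[h]}
  _ (diffop q) (diffop_is_linear q).

Lemma diffopDl q r p : diffop (q + r) p = diffop q p + diffop r p.
Proof.
rewrite /diffop (@msupp_sumD _ _ _ (fun m c => c *: p^`M[m])) // => m.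
  by rewrite scale0r.
by move=> a b; rewrite scalerDl.
Qed.

Lemma diffopXl m p : diffop 'X_[m] p = p^`M[m].
Proof. by rewrite /diffop (@msupp_sumX _ _ _ (fun m c => c *: p^`M[m])) scale1r. Qed.

Lemma diffopZXl c m p : diffop (c *: 'X_[m]) p = c *: p^`M[m].
Proof.
rewrite /diffop (@msupp_sumZX _ _ _ (fun m c => c *: p^`M[m])) // => m'.
by rewrite scale0r.
Qed.

Lemma diffop0l p : diffop 0 p = 0.
Proof. by rewrite /diffop msupp0 big_nil. Qed.

Lemma diffop1l p : diffop 1 p = p.
Proof. by rewrite -mpolyX0 diffopXl mderivm0m. Qed.

Lemma diffopZl c q p : diffop (c *: q) p = c *: diffop q p.
Proof.
elim/mpolyind: q => [|a m q _ _ IH]; first by rewrite scaler0 diffop0l scaler0.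
by rewrite scalerDr !diffopDl IH scalerDr scalerA !diffopZXl scalerA.
Qed.

Lemma diffopCl c p : diffop c%:MP p = c *: p.
Proof. by rewrite -[c%:MP]mulr1 mul_mpolyC diffopZl diffop1l. Qed.

Lemma diffopXUl i p : diffop 'X_i p = p^`M(i).
Proof. by rewrite diffopXl mderivmU1m. Qed.

Lemma diffopM q r p : diffop (q * r) p = diffop q (diffop r p).
Proof.
elim/mpolyind: q => [|c m q _ _ IH]; first by rewrite mul0r !diffop0l.
rewrite mulrDl !diffopDl IH; congr (_ + _).
elim/mpolyind: r {IH} => [|c' m' r _ _ IHr]; first by rewrite mulr0 diffop0l linear0.
rewrite mulrDr !diffopDl IHr linearD /=; congr (_ + _).
rewrite -scalerAl -scalerAr -mpolyXD scalerA !diffopZXl.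
by rewrite linearZ /= scalerA addmC mderivmDm.
Qed.

Lemma diffop_sumr (I : Type) (s : seq I) (P : pred I) (c : I -> {mpoly T[h]}) p :
  diffop (\sum_(i <- s | P i) c i) p = \sum_(i <- s | P i) diffop (c i) p.
Proof. by elim/big_rec2: _ => [|i a b _ <-]; rewrite ?diffop0l ?diffopDl. Qed.

(** Distinct monomials are orthogonal for this pairing and each has a product of factorials as its
    square. Symmetry is read off from this, and in characteristic 0 so is nondegeneracy. *)
Lemma diffop_pairE q p k : (msize q <= k)%N -> (diffop q p).@[fun=> 0]
  = \sum_(m : 'X_{1..h < k}) q@_m * (p@_m *+ \prod_(i < h) (m i)`!).
Proof.
move=> le_qk; rewrite meval0E (diffopE _ le_qk) raddf_sum; apply: eq_bigr => m _.
rewrite /= mcoeffZ mcoeff_mderivm addm0; congr (_ * (_ *+ _)).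
by apply: eq_bigr => i _; rewrite ffactnn.
Qed.

Lemma diffop_pair_sym q p : (diffop q p).@[fun=> 0] = (diffop p q).@[fun=> 0].
Proof.
pose k := maxn (msize q) (msize p).
rewrite !(@diffop_pairE _ _ k) ?leq_maxl ?leq_maxr //.
by apply: eq_bigr => m _; rewrite mulrnAr mulrC mulrnAr.
Qed.

Lemma msize_leP p k : reflect (forall m, p@_m != 0 -> (mdeg m < k)%N) (msize p <= k)%N.
Proof.
rewrite msizeE; apply: (iffP (bigmax_leqP_seq _ _ _ _)) => H m.
  by rewrite -mcoeff_msupp => m_p; apply: H.
by rewrite mcoeff_msupp => m_p _; apply: H.
Qed.

(** Every term of q differentiates at least once. As [msize] is the degree plus one, the case k = 0
    says that constants are killed. *)
Lemma msize_diffop q p k : q@_0%MM = 0 -> (msize p <= k.+1)%N ->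
  (msize (diffop q p) <= k)%N.
Proof.
move=> q0 /msize_leP p_k; apply: (leq_trans (msize_sum _ _ _)).
apply/bigmax_leqP_seq => m m_q _; apply: (leq_trans (msizeZ_le _ _)).
apply/msize_leP => m'; rewrite mcoeff_mderivm => nz.
have : p@_(m + m') != 0 by apply: contra_neq nz => ->; rewrite mul0rn.
move/p_k; rewrite mdegD ltnS; apply: leq_trans.
rewrite -addn1 addnC leq_add2r lt0n mdeg_eq0; apply: contraTneq m_q => ->.
by rewrite mcoeff_msupp q0 eqxx.
Qed.

Lemma msize_diffop_le q p : (msize (diffop q p) <= msize p)%N.
Proof.
rewrite -[q](subrK (q@_0%MM)%:MP) diffopDl diffopCl.
apply: (leq_trans (msizeD_le _ _)); rewrite geq_max msizeZ_le andbT.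
by apply: msize_diffop; rewrite ?leqnSn // mcoeffB mcoeffC eqxx mulr1 subrr.
Qed.

End DiffopRing.

Section DiffopField.
Context (F : numFieldType) (h : nat).
Implicit Types p q r : {mpoly F[h]}.

Lemma diffop_pair_eq0 p : (forall r, (diffop r p).@[fun=> 0] = 0) -> p = 0.
Proof.
move=> p0; apply/mpolyP => m; rewrite mcoeff0; apply/eqP.
have /eqP := p0 'X_[m]; rewrite diffopXl meval0E mcoeff_mderivm addm0 mulrn_eq0.
case/orP=> //; rewrite -leqn0 leqNgt prodn_gt0 // => i.
by rewrite ffactnn fact_gt0.
Qed.

(** Write p = c + N with c = p(0): N lowers degrees, so that the geometric series for the inverse of
    c + N is finite on each polynomial. The size bound later bounds the powers of the logarithms. *)
Lemma diffop_regular_surj p : p.@[fun=> 0] != 0 -> forall q, exists r,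
  diffop p r = q /\ (msize r <= msize q)%N.
Proof.
rewrite meval0E; set c := p@_0%MM => c0 q; pose N := p - c%:MP.
have N0 : N@_0%MM = 0 by rewrite mcoeffB mcoeffC eqxx mulr1 subrr.
have defp : p = N + c%:MP by rewrite subrK.
elim: {q}(msize q) {-2}q (leqnn (msize q)) => [|k IH] q.
  rewrite leqn0 msize_poly_eq0 => /eqP ->; exists 0.
  by rewrite linear0 msize0.
move=> q_k; pose q1 := diffop N (c^-1 *: q).
have q1k : (msize q1 <= k)%N.
  by apply: msize_diffop => //; apply: leq_trans (msizeZ_le _ _) q_k.
have [r [r_q1 r_k]] := IH q1 q1k.
(* The operator p maps c^-1 q to q + q1, and r, a preimage of the smaller q1, removes the error. *)
exists (c^-1 *: q - r); split.
  rewrite linearB /= r_q1 {1}defp diffopDl diffopCl scalerA divff // scale1r.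
  by rewrite addrAC subrr add0r.
apply: (leq_trans (msizeD_le _ _)); rewrite msizeN geq_max msizeZ_le /=.
apply: leq_trans r_k _.
rewrite /q1; have [->|q0] := eqVneq q 0; first by rewrite scaler0 linear0 msize0.
have := q0; rewrite -msize_poly_eq0 -lt0n => q_gt0.
apply: (@leq_trans (msize q).-1); last exact: leq_pred.
by apply: msize_diffop; rewrite // prednK // msizeZ_le.
Qed.

(** If p kills q, then N q = - c q, whereas N q is strictly smaller than q unless q = 0. *)
Lemma diffop_regular_inj p q : p.@[fun=> 0] != 0 -> diffop p q = 0 -> q = 0.
Proof.
rewrite meval0E; set c := p@_0%MM => c0; pose N := p - c%:MP.
have N0 : N@_0%MM = 0 by rewrite mcoeffB mcoeffC eqxx mulr1 subrr.
have -> : p = N + c%:MP by rewrite subrK.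
rewrite diffopDl diffopCl => /eqP; rewrite addr_eq0 => /eqP Nq.
apply/eqP; rewrite -msize_poly_eq0; case sz: (msize q) => [//|k].
have : (msize (diffop N q) <= k)%N by apply: msize_diffop; rewrite ?sz.
by rewrite Nq msizeN msizeZ // sz ltnn.
Qed.

Lemma diffop_linear_form_surj (b : 'I_h -> F) (k : 'I_h) : b k != 0 ->
  forall q, exists r, diffop (\sum_(i < h) b i *: 'X_i) r = q.
Proof.
move=> bk0 q; set ell : {mpoly F[h]} := \sum_(i < h) _.
have ellE p : diffop ell p = \sum_(i < h) b i *: p^`M(i).
  by rewrite diffop_sumr; apply: eq_bigr => i _; rewrite diffopZl diffopXUl.
have ellM p r : diffop ell (p * r) = diffop ell p * r + p * diffop ell r.
  rewrite !ellE mulr_suml mulr_sumr -big_split; apply: eq_bigr => i _ /=.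
  by rewrite mderivM scalerDr scalerAl scalerAr.
have ell0 : ell@_0%MM = 0.
  rewrite raddf_sum big1 // => i _ /=.
  by rewrite mcoeffZ mcoeffX mnm1_eq0 mulr0.
pose x : {mpoly F[h]} := (b k)^-1 *: 'X_k.
have ellx : diffop ell x = 1.
  rewrite ellE (bigD1 k) //= big1 ?addr0 => [|i ne_ik].
    by rewrite mderivZ mderivXU eqxx scalerA divff // scale1r.
  by rewrite mderivZ mderivXU eq_sym (negPf ne_ik) !scaler0.
have ellxn e : diffop ell (x ^+ e.+1) = e.+1%:R *: x ^+ e.
  elim: e => [|e IH]; first by rewrite expr1 ellx scale1r expr0.
  rewrite exprS ellM ellx mul1r IH -scalerAr -exprS -{1}(scale1r (x ^+ _)).
  by rewrite -scalerDl -[in RHS]natr1 addrC.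
(* Integration by parts against powers of a coordinate [x] with [ell x = 1]. *)
suff gen e : exists r, diffop ell r = x ^+ e * q.
  by have [r] := gen 0; rewrite expr0 mul1r; exists r.
(* Each integration by parts raises the exponent e and lowers the degree of q; hence the induction
   on the size of q, for all e at once. *)
elim: {q}(msize q) {-2}q (leqnn (msize q)) e => [|s IH] q.
  by rewrite leqn0 msize_poly_eq0 => /eqP -> e; exists 0; rewrite linear0 mulr0.
move=> q_s e; have q1_s := msize_diffop ell0 q_s.
have [r r_q1] := IH _ q1_s e.+1; have e0 : (e.+1%:R : F) != 0 by rewrite pnatr_eq0.
exists (e.+1%:R^-1 *: (x ^+ e.+1 * q - r)).
rewrite linearZ linearB /= ellM ellxn r_q1 addrK -scalerAl scalerA mulVf //.
by rewrite scale1r.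
Qed.

End DiffopField.

(** * The substitution Psi_B *)

Section LinearSubstitution.
Context (R : realType) (n h : nat) (B : 'M[int]_(n, h)).
Local Notation C := R[i].
Implicit Types (r : {mpoly C[h]}) (p P : {mpoly C[n]}).

Lemma mpoly_hom_ext m (T : comNzRingType) (S : nzRingType)
    (f g : {rmorphism {mpoly T[m]} -> S}) :
  (forall c, f c%:MP = g c%:MP) -> (forall i, f 'X_i = g 'X_i) -> f =1 g.
Proof.
move=> fC fX; elim/mpoly_ring_ind => [c|i|p q fp fq|p q fp fq] //.
  by rewrite !rmorphD fp fq.
by rewrite !rmorphM fp fq.
Qed.

Lemma PsiB_is_linear : linear (@PsiB R n h B).
Proof. by move=> c p q; rewrite /PsiB linearP. Qed.

HB.instance Definition _ := GRing.isLinear.Build C {mpoly C[h]} {mpoly C[n]}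
  _ (@PsiB R n h B) PsiB_is_linear.

Lemma PsiB0 : @PsiB R n h B 0 = 0.
Proof. exact: comp_mpoly0. Qed.

Lemma PsiBD r s : @PsiB R n h B (r + s) = PsiB B r + PsiB B s.
Proof. exact: comp_mpolyD. Qed.

Lemma PsiBZ c r : @PsiB R n h B (c *: r) = c *: PsiB B r.
Proof. exact: comp_mpolyZ. Qed.

Lemma PsiB1 : @PsiB R n h B 1 = 1.
Proof. exact: rmorph1. Qed.

Lemma PsiB_deriv j r : (PsiB B r)^`M(j) = PsiB B (diffop (Bs R B j) r).
Proof.
rewrite /PsiB {1}/comp_mpoly (@mmap_chain _ _ _ _ _ (mderiv j));
  [|exact: mderivD|exact: mderivM|exact: mderivC].
rewrite /Bs diffop_sumr raddf_sum; apply: eq_bigr => k _ /=.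
rewrite diffopZl diffopXUl comp_mpolyZ tnth_mktuple mulrC raddf_sum /=.
rewrite (bigD1 j) //= big1 ?addr0 => [|i ne_ij].
  by rewrite mderivZ mderivXU eqxx -mul_mpolyC mulr1 mul_mpolyC.
by rewrite mderivZ mderivXU (negPf ne_ij) scaler0.
Qed.

(** By the chain rule d/d(log x_j) corresponds under [PsiB] to the linear form [Bs j] acting as an
    operator. In this way derivatives of a series become polynomials in s acting on q. *)
Lemma diffop_PsiB P r : diffop P (PsiB B r)
  = PsiB B (diffop (P \mPo [tuple Bs R B j | j < n]) r).
Proof.
elim/mpoly_ring_ind: P r => [c|i|p q IHp IHq|p q IHp IHq] r.
- by rewrite diffopCl comp_mpolyC diffopCl linearZ.
- by rewrite diffopXUl comp_mpolyXU -tnth_nth tnth_mktuple PsiB_deriv.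
- by rewrite comp_mpolyD !diffopDl IHp IHq raddfD.
- by rewrite rmorphM !diffopM IHq IHp.
Qed.

Lemma PsiB_comp (E : 'M[C]_(h, n)) p :
  PsiB B (p \mPo [tuple \sum_(k < h) E k j *: 'X_k | j < n])
  = p \mPo [tuple \sum_(l < n) (map_mx intr B *m E) l j *: 'X_l | j < n].
Proof.
elim/mpoly_ring_ind: p => [c|j|p q IHp IHq|p q IHp IHq].
- by rewrite /PsiB !comp_mpolyC.
- rewrite /PsiB !comp_mpolyXU -!tnth_nth !tnth_mktuple raddf_sum /=.
  under eq_bigr do rewrite comp_mpolyZ comp_mpolyXU -tnth_nth tnth_mktuple scaler_sumr.
  rewrite exchange_big /=; apply: eq_bigr => l _.
  rewrite mxE scaler_suml; apply: eq_bigr => k _.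
  by rewrite mxE scalerA mulrC.
- by rewrite comp_mpolyD [RHS]comp_mpolyD -IHp -IHq /PsiB comp_mpolyD.
- by rewrite /PsiB !rmorphM /= [LHS](congr2 _ IHp IHq).
Qed.

Lemma msize_PsiB r : (msize (PsiB B r) <= msize r)%N.
Proof.
rewrite /PsiB comp_mpolyEX; apply: (leq_trans (msize_sum _ _ _)).
apply/bigmax_leqP_seq => m m_r _; apply: (leq_trans (msizeZ_le _ _)).
apply: leq_trans (msize_mdeg_lt m_r); rewrite comp_mpolyX mdegE.
elim/big_rec2: _ => [|k e p _ IH]; first by rewrite msize1.
have msize_mul a b (q s : {mpoly C[n]}) : (msize q <= a.+1)%N ->
    (msize s <= b.+1)%N -> (msize (q * s) <= (a + b).+1)%N.
  have [->|q0] := eqVneq q 0; first by rewrite mul0r msize0.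
  have [->|s0] := eqVneq s 0; first by rewrite mulr0 msize0.
  rewrite msizeM // => q_a s_b; rewrite -ltnS prednK ?addn_gt0 ?lt0n.
    by rewrite -addnS -addSn leq_add.
  by rewrite !msize_poly_eq0 q0.
apply: (msize_mul) IH; elim: (m k) => [|e' IHe]; first by rewrite expr0 msize1.
rewrite exprS; apply: (msize_mul 1%N e') IHe; rewrite tnth_mktuple.
apply: (leq_trans (msize_sum _ _ _)); apply/bigmax_leqP_seq => j _ _.
by apply: (leq_trans (msizeZ_le _ _)); rewrite msizeX mdeg1.
Qed.

End LinearSubstitution.

(** * Splitting of the kernel lattice, and the image of Psi_B *)

Section LatticeBasis.
Context (R : realType) (d n h : nat) (A : 'M[int]_(d, n)) (B : 'M[int]_(n, h)).
Hypothesis hB : lattice_basis A B.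
Local Notation C := R[i].

Lemma rat_mx_common_denom p q (K : 'M[rat]_(p, q)) :
  exists2 N : int, N != 0 & exists K' : 'M[int]_(p, q),
    N%:~R *: K = map_mx intr K'.
Proof.
pose N := \prod_(ij : 'I_p * 'I_q) denq (K ij.1 ij.2).
exists N; first by apply/prodf_neq0 => ij _; rewrite denq_neq0.
exists (\matrix_(i, j) ((\prod_(ij : 'I_p * 'I_q | ij != (i, j))
   denq (K ij.1 ij.2)) * numq (K i j))).
apply/matrixP => i j; rewrite !mxE /N (bigD1 (i, j)) //= !rmorphM /=.
rewrite numqE mulrAC [RHS]mulrC; congr (_ * _); exact: mulrC.
Qed.

Lemma map_intr_inj p q : injective (map_mx intr : 'M[int]_(p, q) -> 'M[rat]_(p, q)).
Proof.
move=> X Y /matrixP eqXY; apply/matrixP => i j; apply: (@intr_inj rat).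
by have := eqXY i j; rewrite !mxE.
Qed.

Lemma lattice_kernel q (K : 'M[rat]_(n, q)) : map_mx intr A *m K = 0 ->
  exists Y, K = map_mx intr B *m Y.
Proof.
move=> AK; have [N N0 [K' defK']] := rat_mx_common_denom K.
have AK' : A *m K' = 0.
  apply: map_intr_inj; rewrite map_mxM /= -defK' -scalemxAr AK scaler0.
  by rewrite map_mx0.
have /choice[f fP] j : exists c, col j K' = B *m c.
  have [|c [-> _]] := hB.2 (col j K'); last by exists c.
  by rewrite /inL colE mulmxA AK' mul0mx.
exists (N%:~R^-1 *: map_mx intr (\matrix_(k, j) f j k 0)).
rewrite -scalemxAr -map_mxM /=.
have -> : B *m (\matrix_(k, j) f j k 0) = K'.
  apply/matrixP => i j; have /matrixP/(_ i 0) := fP j; rewrite !mxE => ->.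
  by apply: eq_bigr => k _; rewrite mxE.
by rewrite -defK' scalerA mulVf ?scale1r // intr_eq0.
Qed.

(** A rational relation between the columns of B would, after clearing denominators, contradict
    uniqueness of coordinates in L; so B has a left inverse E. Then 1 - BE vanishes on the image of
    B, which is the rational kernel of A, and therefore factors through A. *)
Lemma lattice_splitting_rat : exists (E : 'M[rat]_(h, n)) (W : 'M[rat]_(n, d)),
  E *m map_mx intr B = 1%:M /\ 1%:M - map_mx intr B *m E = W *m map_mx intr A.
Proof.
have [Et BE] : exists Et, (map_mx intr B)^T *m Et = 1%:M :> 'M[rat]_h.
  apply/row_freeP; rewrite -kermx_eq0; apply/eqP.
  have: (kermx (map_mx intr B)^T : 'M[rat]_h)^T = 0; last first.
    by move/(congr1 trmx); rewrite trmxK trmx0.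
  set K := _^T; have BK : map_mx intr B *m K = 0.
    by rewrite -(trmxK (map_mx intr B)) -trmx_mul mulmx_ker trmx0.
  have [N N0 [K' defK']] := rat_mx_common_denom K.
  have BK' : B *m K' = 0.
    apply: map_intr_inj; rewrite map_mxM /= -defK' -scalemxAr BK scaler0.
    by rewrite map_mx0.
  suff K'0 : K' = 0.
    apply/eqP; have := congr1 (map_mx intr : _ -> 'M[rat]_h) K'0.
    rewrite /= -defK' map_mx0 => /eqP; rewrite scalemx_eq0 intr_eq0.
    by rewrite (negPf N0).
  apply/matrixP => k j; have [|c [_ c_uniq]] := hB.2 0; first exact: mulmx0.
  have cj : c = col j K' by apply: c_uniq; rewrite colE mulmxA BK' mul0mx.
  have c0 : c = 0 by apply: c_uniq; rewrite mulmx0.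
  by move: cj; rewrite c0 => /matrixP/(_ k 0); rewrite !mxE => <-.
have EB : Et^T *m map_mx intr B = 1%:M.
  by rewrite -[map_mx intr B]trmxK -trmx_mul BE trmx1.
exists Et^T; suff /submxP[W defW] : (1%:M - map_mx intr B *m Et^T
    <= (map_mx intr A : 'M[rat]_(d, n)))%MS by exists W.
rewrite submxE; have [Y ->] := lattice_kernel (mulmx_coker (map_mx intr A)).
by rewrite mulmxA mulmxBl mul1mx -mulmxA EB mulmx1 subrr mul0mx.
Qed.

Lemma map_ratr_intr p q (X : 'M[int]_(p, q)) :
  map_mx (ratr : rat -> C) (map_mx intr X) = map_mx intr X.
Proof. by apply/matrixP => i j; rewrite !mxE ratr_int. Qed.

Lemma lattice_splitting : exists (E : 'M[C]_(h, n)) (W : 'M[C]_(n, d)),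
  E *m map_mx intr B = 1%:M /\ 1%:M - map_mx intr B *m E = W *m map_mx intr A.
Proof.
have [E [W [EB BE]]] := lattice_splitting_rat.
exists (map_mx ratr E), (map_mx ratr W).
rewrite -!map_ratr_intr -!map_mxM -BE EB map_mx1; split => //.
by rewrite map_mxB map_mx1.
Qed.

(** As EB = 1, the linear substitution given by E is a left inverse of [PsiB]. *)
Lemma PsiB_inj : injective (@PsiB R n h B).
Proof.
have [E [_ [EB _]]] := lattice_splitting.
apply: (can_inj (g := comp_mpoly [tuple \sum_(k < h) E k j *: 'X_k | j < n])).
move=> r; rewrite /PsiB -[RHS]comp_mpoly_id.
apply: (mpoly_hom_ext (f := comp_mpoly [tuple _ | j < n] \o comp_mpoly _)
   (g := comp_mpoly [tuple 'X_i | i < h])) => [c|k] /=.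
  by rewrite !comp_mpolyC.
rewrite !comp_mpolyXU -!tnth_nth !tnth_mktuple raddf_sum /=.
transitivity (\sum_(l < h) (E *m map_mx intr B) l k *: 'X_l : {mpoly C[h]}).
  under [RHS]eq_bigr do rewrite mxE scaler_suml.
  rewrite exchange_big; apply: eq_bigr => j _ /=.
  rewrite comp_mpolyZ comp_mpolyXU -tnth_nth tnth_mktuple scaler_sumr.
  by apply: eq_bigr => l _; rewrite scalerA mxE mulrC.
rewrite EB (bigD1 k) //= big1 ?addr0 => [|l ne_lk].
  by rewrite mxE eqxx scale1r.
by rewrite mxE (negPf ne_lk) scale0r.
Qed.

Lemma poly_deriv_eq0 (q : {poly {mpoly C[n]}}) : q^`() = 0 -> q = (q`_0)%:P.
Proof.
move=> q0; apply/polyP => -[|i]; rewrite coefC //=.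
have := congr1 (fun p : {poly _} => p`_i) q0.
rewrite coef_deriv coef0 -mulr_natl => /eqP; rewrite mulf_eq0 => /orP[|/eqP//].
by rewrite -mpolyC_nat mpolyC_eq0 pnatr_eq0.
Qed.

(* The flow X_j - t sum_i a_ij Y_i joins the identity (t = 0) to a projection
   onto the linear forms in the columns of B (t = 1), and p is constant
   along it. *)
Lemma PsiB_surj (p : {mpoly C[n]}) :
  (forall i, \sum_(j < n) (A i j)%:~R *: p^`M(j) = 0) -> exists r, p = PsiB B r.
Proof.
move=> Ap; have [E [W [EB BE]]] := lattice_splitting.
exists (p \mPo [tuple \sum_(k < h) E k j *: 'X_k | j < n]); rewrite PsiB_comp.
(* With 1 - BE = WA, the form [Z j] is X_j minus its image under the projection BE. The
   factorization through A makes the velocity of the flow a combination of the rows of A, in whose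
   directions p has zero derivative. *)
pose Y i : {mpoly C[n]} := \sum_(l < n) W l i *: 'X_l.
pose Z j : {mpoly C[n]} := \sum_(i < d) (A i j)%:~R *: Y i.
pose x j : {poly {mpoly C[n]}} := ('X_j)%:P - (Z j)%:P * 'X.
pose f : {rmorphism C -> {poly {mpoly C[n]}}} := polyC \o @mpolyC n C.
pose F : {rmorphism {mpoly C[n]} -> {poly {mpoly C[n]}}} := mmap f x.
have FC c : F c%:MP = c%:MP%:P by exact: mmapC.
have FX j : F 'X_j = x j by rewrite /F /= mmapX mmap1U.
have dFE : (F p)^`() = \sum_(j < n) F p^`M(j) * (x j)^`().
  by apply: mmap_chain; [exact: derivD|exact: derivM|move=> c; exact: derivC].
have FZ c q : F (c *: q) = c%:MP%:P * F q by rewrite -mul_mpolyC rmorphM FC.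
clearbody F.
have dx j : (x j)^`() = - \sum_(i < d) ((A i j)%:~R)%:MP%:P * (Y i)%:P.
  rewrite /x derivB derivC derivM derivC derivX mul0r !add0r mulr1; congr (- _).
  by rewrite rmorph_sum; apply: eq_bigr => i _; rewrite -polyCM mul_mpolyC.
have dF : (F p)^`() = 0.
  transitivity (- \sum_(i < d) F (\sum_(j < n) (A i j)%:~R *: p^`M(j)) * (Y i)%:P).
    rewrite dFE -sumrN; under [RHS]eq_bigr do rewrite raddf_sum mulr_suml -sumrN.
    rewrite exchange_big; apply: eq_bigr => j _ /=; rewrite dx.
    rewrite mulrN mulr_sumr -sumrN; apply: eq_bigr => i _; congr (- _).
    by rewrite FZ mulrCA mulrA.
  by rewrite big1 ?oppr0 // => i _; rewrite Ap rmorph0 mul0r.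
have Fhorner t : horner_eval t (F p) = (F p)`_0.
  by rewrite (poly_deriv_eq0 dF) /horner_eval hornerC coefC.
have F0 : horner_eval 0 (F p) = p.
  apply: (mpoly_hom_ext (f := horner_eval 0 \o F) (g := idfun)) => [c|j] /=.
    by rewrite FC /horner_eval hornerC.
  by rewrite FX /horner_eval /x hornerD hornerN hornerM hornerX mulr0 subr0 hornerC.
have <- : horner_eval 1 (F p) =
  p \mPo [tuple \sum_(l < n) (map_mx intr B *m E) l j *: 'X_l | j < n].
  apply: (mpoly_hom_ext (f := horner_eval 1 \o F) (g := comp_mpoly _)) => [c|j] /=.
    by rewrite FC /horner_eval hornerC comp_mpolyC.
  rewrite FX /x /horner_eval comp_mpolyXU -tnth_nth tnth_mktuple.
  rewrite hornerD hornerN hornerM !hornerC hornerX mulr1.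
  have -> : map_mx intr B *m E = 1%:M - W *m map_mx intr A by rewrite -BE subKr.
  under [RHS]eq_bigr do rewrite mxE scalerDl.
  rewrite big_split /=; congr (_ + _).
    rewrite (bigD1 j) //= big1 ?addr0 => [|l ne_lj].
      by rewrite mxE eqxx scale1r.
    by rewrite mxE (negPf ne_lj) scale0r.
  rewrite /Z -sumrN; under [RHS]eq_bigr do rewrite !mxE -sumrN scaler_suml.
  rewrite exchange_big; apply: eq_bigr => i _ /=.
  rewrite /Y scaler_sumr -sumrN; apply: eq_bigr => l _.
  by rewrite mxE scalerA scaleNr mulrC.
by rewrite Fhorner -{1}F0 Fhorner.
Qed.

End LatticeBasis.

(** * Fractions regular at the origin *)

Section IterMon.
Context (n : nat).

Lemma iter_mon_ind (V : Type) (P : V -> Prop) (T : 'I_n -> V -> V) m x :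
  P x -> (forall j y, P y -> P (T j y)) -> P (iter_mon T m x).
Proof.
move=> Px PT; rewrite /iter_mon; elim: (enum _) => //= j s IH.
by elim: (m j) => //= e IHe; apply: PT.
Qed.

Lemma iter_mon_morph (V W : Type) (f : V -> W) (T : 'I_n -> V -> V)
    (T' : 'I_n -> W -> W) m x :
  (forall j y, f (T j y) = T' j (f y)) ->
  f (iter_mon T m x) = iter_mon T' m (f x).
Proof.
move=> fT; rewrite /iter_mon; elim: (enum _) => //= j s <-.
by elim: (m j) => //= e <-.
Qed.

Lemma iter_mon_mul (S : comPzRingType) (a : 'I_n -> S) m x :
  iter_mon (fun j => *%R (a j)) m x = (\prod_j a j ^+ m j) * x.
Proof.
have -> : \prod_j a j ^+ m j = \prod_(j <- enum 'I_n) a j ^+ m j.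
  by rewrite big_enum.
rewrite /iter_mon; elim: (enum _) => [|j s IH] /=.
  by rewrite big_nil mul1r.
rewrite big_cons -mulrA -IH; elim: (m j) => [|e IHe]; first by rewrite mul1r.
by rewrite iterS IHe exprS mulrA.
Qed.

Section Heisenberg.
Context (V : zmodType) (T : 'I_n -> {additive V -> V}) (X : {additive V -> V}).
Context (k : 'I_n).
Hypothesis TX : forall j v, T j (X v) = X (T j v) + v *+ (j == k).

(** The Heisenberg relation iterated: moving X through T^m costs the formal derivative of T^m in
    T_k. It is applied to the derivatives in s and multiplication by s_k. *)
Lemma iter_mon_commutator m v :
  iter_mon (fun j => T j) m (X v)
    = X (iter_mon (fun j => T j) m v)
      + iter_mon (fun j => T j) (m - U_(k))%MM v *+ m k.
Proof.
have iterTM j e w c : iter e (T j) (w *+ c) = iter e (T j) w *+ c.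
  by elim: e => //= e ->; rewrite raddfMn.
have iterTD j e w w' : iter e (T j) (w + w') = iter e (T j) w + iter e (T j) w'.
  by elim: e => //= e ->; rewrite raddfD.
rewrite /iter_mon; set F := fun m' => foldr (fun j => iter (m' j) (T j)).
(* On a sublist of the variables the commutator appears only once k has been met, which the factor
   [(k \in s)] records. *)
suff gen s : uniq s ->
    F m (X v) s = X (F m v s) + F (m - U_(k))%MM v s *+ ((k \in s) * m k)%N.
  have := gen _ (enum_uniq 'I_n); rewrite mem_enum inE mul1n; exact.
elim: s => [_|j s IH /= /andP[j_s us]]; first by rewrite mulr0n addr0.
rewrite {1}/F /= -/(F m _ s) (IH us) iterTD iterTM mnmBE mnm1E inE.
have [eq_jk|ne_jk] /= := eqVneq j k.
  rewrite eq_jk in j_s *; rewrite (negPf j_s) mulr0n addr0 mul1n.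
  have -> : F (m - U_(k))%MM v s = F m v s.
    elim: s j_s {IH us} => //= i s IH; rewrite inE negb_or => /andP[ne_ki ks].
    by rewrite /F /= -!/(F _ _ s) (IH ks) mnmBE mnm1E (negPf ne_ki) subn0.
  move: (F m v s) => w; elim: (m k) => [|e IHe]; first by rewrite mulr0n addr0.
  rewrite iterS IHe raddfD /= TX eqxx mulr1n raddfMn /= -addrA; congr (_ + _).
  rewrite subn1 /=; case: e {IHe} => [|e]; first by rewrite mulr0n addr0.
  by rewrite subn1 /= -iterS -mulrS.
rewrite subn0; congr (_ + _).
elim: (m j) => //= e ->.
by rewrite TX (negPf ne_jk) mulr0n addr0.
Qed.

End Heisenberg.
End IterMon.

Section QuotientRule.
Context (K : fieldType).
Implicit Types a b c e : K.

Lemma quotient_ruleM a a' b b' c c' e e' : b != 0 -> e != 0 ->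
  ((a' * c + a * c') * (b * e) - a * c * (b' * e + b * e')) / (b * e) ^+ 2
  = (a' * b - a * b') / b ^+ 2 * (c / e) + a / b * ((c' * e - c * e') / e ^+ 2).
Proof. by move=> b0 e0; field; rewrite b0 e0. Qed.

Lemma quotient_ruleD a a' b b' c c' e e' : b != 0 -> e != 0 ->
  ((a' * e + a * e' + (c' * b + c * b')) * (b * e)
     - (a * e + c * b) * (b' * e + b * e')) / (b * e) ^+ 2
  = (a' * b - a * b') / b ^+ 2 + (c' * e - c * e') / e ^+ 2.
Proof. by move=> b0 e0; field; rewrite b0 e0. Qed.

Lemma quotient_rule_comm (S : comNzRingType) (a ai aj aij b bi bj bij : S) :
  (aij * b + aj * bi - (ai * bj + a * bij)) * (b * b)
     - (aj * b - a * bj) * (bi * b + b * bi)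
  = (aij * b + ai * bj - (aj * bi + a * bij)) * (b * b)
     - (ai * b - a * bi) * (bj * b + b * bj).
Proof. by ring. Qed.

End QuotientRule.

Section FracDeriv.
Context (T : idomainType).
Local Notation "x %:F" := (FracField.tofrac x).

Lemma frac_repr (f : {fraction T}) : f = (\n_(repr f))%:F / (\d_(repr f))%:F.
Proof.
have d0 := denom_ratioP (repr f).
rewrite -{1}[f]reprK; unlock FracField.tofrac.
rewrite -[X in _ * X]FracField.pi_inv -[RHS]FracField.pi_mul.
rewrite /FracField.mulf /FracField.invf !numden_Ratio ?oner_eq0 ?d0 //.
by rewrite mulr1 mul1r Ratio_numden.
Qed.

Context (delta : T -> T).
Hypothesis deltaD : {morph delta : a b / a + b}.
Hypothesis deltaM : forall a b, delta (a * b) = delta a * b + a * delta b.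
Local Notation D := (frac_deriv delta).

(** [frac_deriv] is defined by one chosen representative c/e. Another one a/b satisfies ae = cb, and
    differentiating this relation shows that both give the same value. *)
Lemma frac_deriv_div a b : b != 0 ->
  D (a%:F / b%:F) = ((delta a)%:F * b%:F - a%:F * (delta b)%:F) / b%:F ^+ 2.
Proof.
move=> b0; rewrite /frac_deriv; set f := a%:F / b%:F.
have := frac_repr f; have := denom_ratioP (repr f).
move: (\n_(repr f)) (\d_(repr f)) => c e e0 fE.
have bF : b%:F != 0 by rewrite tofrac_eq0.
have eF : e%:F != 0 by rewrite tofrac_eq0.
have cross : a * e = c * b.
  apply/eqP; rewrite -tofrac_eq !rmorphM /= -eqr_div ?bF ?eF //; exact/eqP.
apply/eqP; rewrite tofracXn eqr_div ?expf_neq0 //.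
rewrite -!tofracM -!tofracB -!tofracXn -!tofracM tofrac_eq -subr_eq0.
have := congr1 delta cross; rewrite !deltaM => dcross.
(* The difference of the cross products is a combination of the relation ae = cb and its
   derivative. *)
have -> : (delta c * e - c * delta e) * b ^+ 2 - (delta a * b - a * delta b) * e ^+ 2
  = (c * b - a * e) * (- (delta e * b + e * delta b))
    + e * b * ((delta c * b + c * delta b) - (delta a * e + a * delta e)).
  ring.
by rewrite dcross cross !subrr mul0r mulr0 addr0.
Qed.

Lemma frac_deriv_tofrac a : D a%:F = (delta a)%:F.
Proof.
have d1 : delta 1 = 0.
  by apply/(addrI (delta 1)); rewrite addr0 -{3}[1](mulr1 1) deltaM mulr1 mul1r.
rewrite -[a%:F]divr1 -tofrac1 frac_deriv_div ?oner_eq0 // d1 tofrac0 mulr0 subr0.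
by rewrite tofrac1 expr1n !divr1 mulr1.
Qed.

Lemma fracP (f : {fraction T}) : exists a b, b != 0 /\ f = a%:F / b%:F.
Proof.
exists (\n_(repr f)), (\d_(repr f)); split; [exact: denom_ratioP | exact: frac_repr].
Qed.

Lemma frac_derivM f g : D (f * g) = D f * g + f * D g.
Proof.
have [a [b [b0 ->]]] := fracP f; have [c [e [e0 ->]]] := fracP g.
rewrite mulf_div -!tofracM !frac_deriv_div ?mulf_neq0 // !deltaM !tofracD !tofracM.
by rewrite quotient_ruleM // tofrac_eq0.
Qed.

Lemma frac_deriv_is_additive : {morph D : f g / f + g}.
Proof.
move=> f g; have [a [b [b0 ->]]] := fracP f; have [c [e [e0 ->]]] := fracP g.
rewrite addf_div ?tofrac_eq0 // -!tofracM -tofracD !frac_deriv_div ?mulf_neq0 //.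
rewrite !deltaD !deltaM !tofracD !tofracM.
by rewrite quotient_ruleD // tofrac_eq0.
Qed.

End FracDeriv.

Section FracDerivMpoly.
Context (F : fieldType) (h : nat).
Local Notation "x %:F" := (FracField.tofrac x).
Local Notation K := {fraction {mpoly F[h]}}.
Local Notation D k := (frac_deriv (@mderiv h F k)).

Lemma frac_mderiv_is_zmod_morphism k : zmod_morphism (D k).
Proof.
have DD := frac_deriv_is_additive (@mderivD h F k) (@mderivM h F k).
move=> f g; apply/(addIr (D k g)); rewrite -DD !subrK //.
Qed.

HB.instance Definition _ k :=
  GRing.isZmodMorphism.Build K K (D k) (frac_mderiv_is_zmod_morphism k).

Lemma frac_mderivM k f g : D k (f * g) = D k f * g + f * D k g.
Proof. exact: frac_derivM (@mderivM h F k) f g. Qed.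

Lemma frac_mderiv_tofrac k p : D k p%:F = (p^`M(k))%:F.
Proof. exact: frac_deriv_tofrac (@mderivM h F k) p. Qed.

Lemma frac_mderiv_div k a b : b != 0 ->
  D k (a%:F / b%:F) = (a^`M(k) * b - a * b^`M(k))%:F / (b ^+ 2)%:F.
Proof.
by move=> b0; rewrite (frac_deriv_div (@mderivM h F k)) // tofracXn tofracB !tofracM.
Qed.

Lemma frac_mderiv_comm i j f : D i (D j f) = D j (D i f).
Proof.
have [a [b [b0 ->]]] := fracP f; have bF : b%:F != 0 by rewrite tofrac_eq0.
rewrite !frac_mderiv_div ?expf_neq0 //; congr (_%:F / _).
rewrite !expr2 !mderivB !mderivM (mderiv_comm i j a) (mderiv_comm i j b).
exact: quotient_rule_comm.
Qed.

(** The local ring of the origin, as a boolean predicate so that it can carry the subring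
    structure. *)
Definition regular0 : {pred K} := [pred f : K | `[<
  exists r : {mpoly F[h]} * {mpoly F[h]},
    r.2.@[fun=> 0] != 0 /\ f = r.1%:F / r.2%:F >]].

Lemma regular0P f : reflect (exists a b, b.@[fun=> 0] != 0 /\ f = a%:F / b%:F)
  (f \in regular0).
Proof.
apply: (iffP (asboolP _)) => [[[a b]]|[a [b H]]]; first by exists a, b.
by exists (a, b).
Qed.

Lemma regular0_denom (b : {mpoly F[h]}) : b.@[fun=> 0] != 0 -> b%:F != 0.
Proof. by rewrite tofrac_eq0; apply: contra_neq => ->; rewrite meval0. Qed.

Lemma frac_eval0_div a b : b.@[fun=> 0] != 0 ->
  @frac_eval0 F h (a%:F / b%:F) = a.@[fun=> 0] / b.@[fun=> 0].
Proof.
move=> b0; rewrite /frac_eval0; case: pselect => [e|[]]; last by exists (a, b).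
case: cid => -[c e'] /= [e0 /eqP].
rewrite eqr_div ?regular0_denom // -!tofracM tofrac_eq => /eqP ae.
by apply/eqP; rewrite eqr_div // -!mevalM -ae eq_sym.
Qed.

Lemma frac_eval0_tofrac a : @frac_eval0 F h a%:F = a.@[fun=> 0].
Proof.
by rewrite -[a%:F]divr1 -tofrac1 frac_eval0_div ?meval1 ?oner_eq0 // divr1.
Qed.

Lemma regular0_tofrac p : p%:F \in regular0.
Proof.
by apply/regular0P; exists p, 1; rewrite meval1 oner_eq0 tofrac1 divr1.
Qed.

Lemma regular0_subring : subring_closed regular0.
Proof.
split=> [|f g|f g].
- by rewrite -tofrac1 regular0_tofrac.
- move=> /regular0P[a [b [b0 ->]]] /regular0P[c [e [e0 ->]]]; apply/regular0P.
  exists (a * e - c * b), (b * e); split; first by rewrite mevalM mulf_neq0.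
  rewrite -mulNr addf_div ?regular0_denom // tofracB !tofracM.
  by rewrite mulNr.
- move=> /regular0P[a [b [b0 ->]]] /regular0P[c [e [e0 ->]]]; apply/regular0P.
  exists (a * c), (b * e); split; first by rewrite mevalM mulf_neq0.
  by rewrite mulf_div !tofracM.
Qed.

HB.instance Definition _ := GRing.isSubringClosed.Build K regular0 regular0_subring.

Lemma frac_eval0D : {in regular0 &, {morph @frac_eval0 F h : f g / f + g}}.
Proof.
move=> _ _ /regular0P[a [b [b0 ->]]] /regular0P[c [e [e0 ->]]].
rewrite addf_div ?regular0_denom // -!tofracM -tofracD !frac_eval0_div //.
  by rewrite mevalD !mevalM addf_div.
by rewrite mevalM mulf_neq0.
Qed.

Lemma frac_eval0M : {in regular0 &, {morph @frac_eval0 F h : f g / f * g}}.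
Proof.
move=> _ _ /regular0P[a [b [b0 ->]]] /regular0P[c [e [e0 ->]]].
rewrite mulf_div -!tofracM !frac_eval0_div //.
  by rewrite !mevalM mulf_div.
by rewrite mevalM mulf_neq0.
Qed.

Lemma frac_mderiv_regular k f : f \in regular0 -> D k f \in regular0.
Proof.
move=> /regular0P[a [b [b0 ->]]]; rewrite frac_mderiv_div; last first.
  by rewrite -tofrac_eq0 regular0_denom.
apply/regular0P; do 2!eexists; split; last reflexivity.
by rewrite rmorphXn expf_neq0.
Qed.

End FracDerivMpoly.

(** * Derivatives of f(s) x^(Bs) at s = 0 *)

Section MapMpoly.
Context (n : nat) (S T : nzRingType).

(** [frac_eval0] is additive only on fractions regular at 0, so coefficients under [map_mpoly] are
    computed for any map that fixes 0. *)
Lemma mcoeff_map_mpoly0 (f : S -> T) (p : {mpoly S[n]}) m : f 0 = 0 ->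
  (map_mpoly f p)@_m = f p@_m.
Proof.
move=> f0; rewrite /map_mpoly /mmap raddf_sum /=.
have monE m' : mmap1 (fun i => 'X_i) m' = 'X_[m'] :> {mpoly T[n]}.
  by rewrite [RHS]mpolyXE_id.
have [m_p|m_p] := boolP (m \in msupp p).
  rewrite (bigD1_seq m) ?msupp_uniq //= big1 ?addr0 => [|m' ne_m'm].
    by rewrite monE mul_mpolyC mcoeffZ mcoeffX eqxx mulr1.
  by rewrite monE mul_mpolyC mcoeffZ mcoeffX (negPf ne_m'm) mulr0.
rewrite (memN_msupp_eq0 m_p) f0 big_seq big1 // => m' m'_p.
rewrite monE mul_mpolyC mcoeffZ mcoeffX; case: eqP m'_p m_p => [->->//|_ _ _].
by rewrite mulr0.
Qed.

Lemma map_mpolyD_in (P : addrClosed S) (f : S -> T) : f 0 = 0 ->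
  {in P &, {morph f : a b / a + b}} ->
  {in mpolyOver n P &, {morph map_mpoly f : F G / F + G}}.
Proof.
move=> f0 fD F G /(mpolyOverP P) PF /(mpolyOverP P) PG; apply/mpolyP => m.
by rewrite mcoeffD !(mcoeff_map_mpoly0 _ _ f0) mcoeffD fD.
Qed.

Lemma map_mpolyZ_in (P : addrClosed S) (f : S -> T) a F : f 0 = 0 ->
  {in P &, {morph f : a b / a * b}} -> a \in P -> F \is a mpolyOver n P ->
  map_mpoly f (a *: F) = f a *: map_mpoly f F.
Proof.
move=> f0 fM Pa /(mpolyOverP P) PF; apply/mpolyP => m.
by rewrite mcoeffZ !(mcoeff_map_mpoly0 _ _ f0) mcoeffZ fM.
Qed.

Lemma map_mpolyK_in (f : S -> T) (g : {additive T -> S}) p : f 0 = 0 ->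
  cancel g f -> map_mpoly f (map_mpoly g p) = p :> {mpoly T[n]}.
Proof.
move=> f0 gK; apply/mpolyP => m.
by rewrite (mcoeff_map_mpoly0 _ _ f0) mcoeff_map_mpoly gK.
Qed.

Lemma map_mpoly_eq0 (f : {additive S -> S}) (g : {additive T -> S}) p :
  (forall c, f (g c) = 0) -> map_mpoly f (map_mpoly g p) = 0 :> {mpoly S[n]}.
Proof.
by move=> fg0; apply/mpolyP => m; rewrite !mcoeff_map_mpoly fg0 mcoeff0.
Qed.

Lemma map_mpoly_derivZ (f : {additive S -> S}) a (F : {mpoly S[n]}) :
  (forall b c, f (b * c) = f b * c + b * f c) ->
  map_mpoly f (a *: F) = f a *: F + a *: map_mpoly f F.
Proof.
move=> fM; apply/mpolyP => m.
by rewrite mcoeffD !mcoeffZ !mcoeff_map_mpoly mcoeffZ fM.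
Qed.

Lemma map_mpoly_over (P : addrClosed S) (f : {additive S -> S}) (F : {mpoly S[n]}) :
  (forall a, a \in P -> f a \in P) -> F \is a mpolyOver n P ->
  map_mpoly f F \is a mpolyOver n P.
Proof.
move=> Pf /(mpolyOverP P) PF; apply/(mpolyOverP P) => m.
by rewrite mcoeff_map_mpoly Pf.
Qed.

End MapMpoly.

Section ExpDiffop.
Context (R : realType) (n h : nat) (B : 'M[int]_(n, h)).
Local Notation C := R[i].
Local Notation Cs := {mpoly C[h]}.
Local Notation K := {fraction Cs}.
Local Notation "x %:F" := (FracField.tofrac x).
Local Notation D k := (frac_deriv (@mderiv h C k)).
Implicit Types (F G : {mpoly K[n]}) (q p : Cs) (f : K).

Let y k : {mpoly K[n]} := \sum_(j < n) (B j k)%:~R *: 'X_j.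

Let cst : {rmorphism C -> K} := @FracField.tofrac Cs \o @mpolyC h C.

Lemma exp_partial_is_zmod_morphism k : zmod_morphism (@exp_partial R n h B k).
Proof.
by move=> F G; rewrite /exp_partial mulrBr raddfB addrACA -opprD.
Qed.

HB.instance Definition _ k := GRing.isZmodMorphism.Build
  {mpoly K[n]} {mpoly K[n]} (@exp_partial R n h B k)
  (exp_partial_is_zmod_morphism k).

Lemma exp_partialZ k f F :
  exp_partial B k (f *: F) = f *: exp_partial B k F + D k f *: F.
Proof.
rewrite /exp_partial (map_mpoly_derivZ (f := D k)); last exact: frac_mderivM.
by rewrite scalerDr -scalerAr -addrA addrC.
Qed.

Lemma exp_diffopE q F :
  exp_diffop B q F = \sum_(m <- msupp q) cst q@_m *: iter_mon (exp_partial B) m F.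
Proof. by []. Qed.

Let expG F (m : 'X_{1..h}) (c : C) := cst c *: iter_mon (exp_partial B) m F.

Let expG0 F m : expG F m 0 = 0.
Proof. by rewrite /expG rmorph0 scale0r. Qed.

Let expGD F m : {morph expG F m : a b / a + b}.
Proof. by move=> a b; rewrite /expG rmorphD scalerDl. Qed.

Lemma exp_diffopDl q p F :
  exp_diffop B (q + p) F = exp_diffop B q F + exp_diffop B p F.
Proof. exact: (msupp_sumD (G := expG F)). Qed.

Lemma exp_diffop0l F : exp_diffop B 0 F = 0.
Proof. by rewrite exp_diffopE msupp0 big_nil. Qed.

Lemma exp_diffopZX c m F :
  exp_diffop B (c *: 'X_[m]) F = cst c *: iter_mon (exp_partial B) m F.
Proof. exact: (msupp_sumZX (G := expG F)). Qed.

Lemma exp_diffopZl c q F : exp_diffop B (c *: q) F = cst c *: exp_diffop B q F.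
Proof.
elim/mpolyind: q => [|a m q _ _ IH]; first by rewrite scaler0 exp_diffop0l scaler0.
by rewrite scalerDr !exp_diffopDl IH scalerDr scalerA !exp_diffopZX rmorphM scalerA.
Qed.

Lemma exp_diffop_is_additive q : {morph exp_diffop B q : F G / F + G}.
Proof.
move=> F G; rewrite !exp_diffopE -big_split; apply: eq_bigr => m _ /=.
rewrite -scalerDr; congr (_ *: _); rewrite /iter_mon.
elim: (enum _) => //= k s ->; elim: (m k) => //= e ->.
exact: raddfD.
Qed.

Lemma exp_diffop_const q c F : exp_diffop B q (cst c *: F) = cst c *: exp_diffop B q F.
Proof.
rewrite !exp_diffopE scaler_sumr; apply: eq_bigr => m _.
rewrite -(iter_mon_morph (f := fun G => cst c *: G) (T := exp_partial B)).
  by rewrite !scalerA mulrC.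
by move=> k G; rewrite exp_partialZ frac_mderiv_tofrac mderivC tofrac0 scale0r addr0.
Qed.

(** The commutator of q(d_s) with multiplication by s_k is (dq/dz_k)(d_s). At s = 0 only this
    commutator survives. *)
Lemma exp_diffop_var q k F :
  exp_diffop B q (('X_k)%:F *: F)
  = ('X_k)%:F *: exp_diffop B q F + exp_diffop B q^`M(k) F.
Proof.
elim/mpolyind: q => [|c m q _ _ IH].
  by rewrite mderiv0 !exp_diffop0l scaler0 addr0.
rewrite mderivD !exp_diffopDl IH scalerDr addrACA; congr (_ + _).
rewrite mderivZ mderivX scalerA !exp_diffopZX.
rewrite (iter_mon_commutator (T := fun k => @exp_partial R n h B k) (k := k)
  (X := *:%R ('X_k)%:F)).
  rewrite scalerDr !scalerA mulrC; congr (_ + _).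
  by rewrite rmorphM rmorph_nat mulr_natr -scalerMnl scalerMnr.
move=> j G; rewrite [LHS]exp_partialZ frac_mderiv_tofrac mderivXU eq_sym; congr (_ + _).
case: eqP => _; first by rewrite tofrac1 scale1r mulr1n.
by rewrite tofrac0 scale0r mulr0n.
Qed.

Lemma exp_partial_const k (p : {mpoly C[n]}) :
  exp_partial B k (map_mpoly cst p)
  = map_mpoly cst ((\sum_(j < n) (B j k)%:~R *: 'X_j) * p).
Proof.
rewrite /exp_partial rmorphM /=.
have -> : map_mpoly (D k) (map_mpoly cst p) = 0.
  apply: (map_mpoly_eq0 (f := D k) (g := cst)) => c.
  by rewrite [LHS]frac_mderiv_tofrac mderivC tofrac0.
rewrite add0r rmorph_sum; congr (_ * _); apply: eq_bigr => j _ /=.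
by rewrite map_mpolyZ map_mpolyX rmorph_int.
Qed.

Lemma exp_diffop1 q : exp_diffop B q 1 = map_mpoly cst (PsiB B q).
Proof.
elim/mpolyind: q => [|c m q _ _ IH].
  by rewrite exp_diffop0l PsiB0 (raddf0 (map_mpoly cst)).
rewrite exp_diffopDl IH exp_diffopZX PsiBD PsiBZ [RHS](rmorphD (map_mpoly cst)).
congr (_ + _); rewrite [RHS](map_mpolyZ cst); congr (_ *: _).
rewrite -(rmorph1 (map_mpoly cst)).
rewrite -(iter_mon_morph (T := fun k => *%R (\sum_(j < n) (B j k)%:~R *: 'X_j))).
  rewrite iter_mon_mul mulr1 /PsiB comp_mpolyX; congr map_mpoly.
  by apply: eq_bigr => k _; rewrite tnth_mktuple.
by move=> k p; apply: esym; apply: exp_partial_const.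
Qed.

Lemma exp_diffop_regular q F : F \is a mpolyOver n (@regular0 C h) ->
  exp_diffop B q F \is a mpolyOver n (@regular0 C h).
Proof.
move=> regF; rewrite exp_diffopE; apply: rpred_sum => m _.
apply: mpolyOverZ; first exact: regular0_tofrac.
apply: (iter_mon_ind (P := fun G => G \is a mpolyOver n (@regular0 C h))) => //.
move=> k G regG; rewrite /exp_partial; apply: rpredD.
  by apply: (map_mpoly_over (f := D k)) => //; apply: frac_mderiv_regular.
apply: rpredM => //.
apply: rpred_sum => j _; apply: mpolyOverZ; first exact: rpred_int.
exact: mpolyOverX.
Qed.

Local Notation ev0 := (map_mpoly (@frac_eval0 C h)).

Lemma frac_eval0_0 : @frac_eval0 C h 0 = 0.
Proof. by rewrite -tofrac0 frac_eval0_tofrac meval0. Qed.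

Lemma ev0D : {in mpolyOver n (@regular0 C h) &, {morph ev0 : F G / F + G}}.
Proof.
exact: map_mpolyD_in frac_eval0_0 (@frac_eval0D C h).
Qed.

Lemma ev0Z f F : f \in @regular0 C h -> F \is a mpolyOver n (@regular0 C h) ->
  ev0 (f *: F) = frac_eval0 f *: ev0 F.
Proof.
exact: map_mpolyZ_in frac_eval0_0 (@frac_eval0M C h).
Qed.

Lemma ev0_const (p : {mpoly C[n]}) : ev0 (map_mpoly cst p) = p.
Proof.
apply: (map_mpolyK_in (g := cst)); first exact: frac_eval0_0.
by move=> c; rewrite [LHS]frac_eval0_tofrac mevalC.
Qed.

(** The value at s = 0 of q(d_s) . (f(s) x^(Bs)), a polynomial in log x; the factor x^(Bs) is
    implicit, as in [exp_partial]. *)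
Definition log_coef q f : {mpoly C[n]} := ev0 (exp_diffop B q f%:MP).

Lemma exp_diffop_regularC q f : f \in @regular0 C h ->
  exp_diffop B q f%:MP \is a mpolyOver n (@regular0 C h).
Proof. by move=> regf; apply: exp_diffop_regular; rewrite mpolyOverC. Qed.

Lemma log_coefDr q f g : f \in @regular0 C h -> g \in @regular0 C h ->
  log_coef q (f + g) = log_coef q f + log_coef q g.
Proof.
move=> regf regg; rewrite /log_coef mpolyCD exp_diffop_is_additive.
by apply: ev0D; apply: exp_diffop_regularC.
Qed.

Lemma log_coefDl q p f : f \in @regular0 C h ->
  log_coef (q + p) f = log_coef q f + log_coef p f.
Proof.
move=> regf; rewrite /log_coef exp_diffopDl.
by apply: ev0D; apply: exp_diffop_regularC.
Qed.

Lemma regular0_mul p f : f \in @regular0 C h -> p%:F * f \in @regular0 C h.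
Proof. by move=> regf; apply: rpredM => //; apply: regular0_tofrac. Qed.

(** Adjointness of multiplication and differentiation: the case of a variable is [exp_diffop_var] at
    s = 0, and sums and products follow by applying the result repeatedly. *)
Lemma log_coef_mul p q f : f \in @regular0 C h ->
  log_coef q (p%:F * f) = log_coef (diffop p q) f.
Proof.
elim/mpoly_ring_ind: p q f => [c|k|p1 p2 IH1 IH2|p1 p2 IH1 IH2] q f regf.
- rewrite diffopCl /log_coef mpolyCM mul_mpolyC exp_diffopZl.
  exact: congr1 (exp_diffop_const _ _ _).
- rewrite diffopXUl /log_coef mpolyCM mul_mpolyC exp_diffop_var.
  have regE r := exp_diffop_regularC r regf; have regX := regular0_tofrac ('X_k : Cs).
  rewrite ev0D; [|exact: mpolyOverZ (regE q)|exact: regE].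
  rewrite ev0Z; [|exact: regX|exact: regE].
  by rewrite frac_eval0_tofrac mevalXU scale0r add0r.
- rewrite tofracD mulrDl diffopDl log_coefDr; try exact: regular0_mul.
  by rewrite (log_coefDl _ _ regf) (IH1 _ _ regf) (IH2 _ _ regf).
- rewrite tofracM -mulrA (IH1 _ _ (regular0_mul p2 regf)) (IH2 _ _ regf).
  by rewrite -diffopM mulrC.
Qed.

Lemma log_coef1 q : log_coef q 1 = PsiB B q.
Proof. by rewrite /log_coef mpolyC1 exp_diffop1 ev0_const. Qed.

Lemma log_coef_tofrac q p : log_coef q p%:F = PsiB B (diffop p q).
Proof. by rewrite -[p%:F]mulr1 log_coef_mul ?rpred1 // log_coef1. Qed.

(* A function a/b regular at 0 acts as the constant coefficient operator
   a(d) b(d)^-1, where b(d) is invertible since b(0) <> 0. *)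
Lemma log_coef_PsiB q f : f \in @regular0 C h -> exists r,
  (msize r <= msize q)%N /\
  forall p, log_coef q (p%:F * f) = PsiB B (diffop p r).
Proof.
case/regular0P=> a [b [b0 ->]]; have [s [<- s_q]] := diffop_regular_surj b0 q.
exists (diffop a s); split.
  exact: leq_trans (msize_diffop_le _ _) s_q.
move=> p; have regab : p%:F * (a%:F / b%:F) \in @regular0 C h.
  by apply: regular0_mul; apply/regular0P; exists a, b.
rewrite -(log_coef_mul _ _ regab) mulrCA [b%:F * _]mulrCA.
rewrite (mulfV (regular0_denom b0)) mulr1.
by rewrite -tofracM log_coef_tofrac diffopM.
Qed.

End ExpDiffop.

(** * Differential operators acting on series *)

Section MultinomInduction.
Context (n : nat).

Lemma mnm_ind (P : 'X_{1..n} -> Prop) :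
  P 0%MM -> (forall m j, P m -> P (m + U_(j))%MM) -> forall m, P m.
Proof.
move=> P0 PU m; have [k] := ubnP (mdeg m); elim: k m => // k IH m.
rewrite ltnS => m_k; have [->//|m0] := eqVneq m 0%MM.
have [j mj] : exists j, m j != 0%N.
  apply/existsP; apply: contraNT m0; rewrite negb_exists => /forallP m0.
  by apply/eqP/mnmP => j; rewrite mnm0E; apply/eqP; rewrite -[_ == _]negbK.
have Uj : (U_(j) <= m)%MM by rewrite lep1mP.
rewrite -(submK Uj); apply/PU/IH.
by move: m_k; rewrite -{1}(submK Uj) mdegD mdeg1 addn1.
Qed.

Lemma falling0 (T : comNzRingType) (x : 'I_n -> T) : falling x 0%MM = 1.
Proof. by rewrite /falling big1 // => j _; rewrite mnm0E big_ord0. Qed.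

Lemma fallingDU (T : comNzRingType) (x : 'I_n -> T) m j :
  falling x (m + U_(j))%MM = (x j - (m j)%:R) * falling x m.
Proof.
rewrite /falling (bigD1 j) //= [\prod_(j0 < n) _ in RHS](bigD1 j) //= mulrA.
congr (_ * _).
  by rewrite mnmDE mnm1E eqxx addn1 big_ord_recr mulrC.
apply: eq_bigr => i ne_ij.
by rewrite mnmDE mnm1E eq_sym (negPf ne_ij) addn0.
Qed.

Lemma iter_mon0 (V : Type) (T : 'I_n -> V -> V) x : iter_mon T 0%MM x = x.
Proof. by rewrite /iter_mon; elim: (enum _) => //= j s ->; rewrite mnm0E. Qed.

Lemma iter_monDU (V : Type) (T : 'I_n -> V -> V) m j x :
  (forall i k y, T i (T k y) = T k (T i y)) ->
  iter_mon T (m + U_(j))%MM x = T j (iter_mon T m x).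
Proof.
move=> TC; have iterC i k e y : iter e (T i) (T k y) = T k (iter e (T i) y).
  by elim: e => //= e ->.
rewrite /iter_mon; set F := fun m' => foldr (fun i => iter (m' i) (T i)) x.
have FN s : j \notin s -> F (m + U_(j))%MM s = F m s.
  elim: s => //= i s IH; rewrite inE negb_or => /andP[ne_ji js].
  by rewrite IH // mnmDE mnm1E (negPf ne_ji) addn0.
suff gen s : uniq s -> j \in s -> F (m + U_(j))%MM s = T j (F m s).
  by apply: gen; rewrite ?enum_uniq ?mem_enum.
elim: s => //= i s IH /andP[i_s us]; rewrite inE mnmDE mnm1E -!/(F _ s).
have [eq_ji|ne_ji] /= := eqVneq j i.
  by rewrite -eq_ji in i_s *; rewrite (FN s i_s) addn1.
by move=> js; rewrite IH // addn0 iterC.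
Qed.

End MultinomInduction.

(** * Modules over rings of differential operators *)

Section OpAction.
Context (n : nat) (S : comNzRingType) (delta : 'I_n -> S -> S) (V : zmodType).
Context (sc : S -> V -> V) (D : 'I_n -> V -> V).
Hypothesis delta0 : forall j, delta j 0 = 0.
Hypothesis scDl : forall v, {morph sc^~ v : a b / a + b}.
Hypothesis scDr : forall a, {morph sc a : v w / v + w}.
Hypothesis scA : forall a b v, sc (a * b) v = sc a (sc b v).
Hypothesis sc1 : forall v, sc 1 v = v.
Hypothesis DD : forall j, {morph D j : v w / v + w}.
Hypothesis DL : forall j a v, D j (sc a v) = sc (delta j a) v + sc a (D j v).
Hypothesis DC : forall i j v, D i (D j v) = D j (D i v).
Implicit Types (P Q : {mpoly S[n]}) (v w : V).

(** The hypotheses above are what makes the product [op_mul] act by composition. They are met twice: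
    by the Weyl algebra on series, and by C(x)<d> on C(x) x^v. *)
Definition op_act Q v := \sum_(b <- msupp Q) sc Q@_b (iter_mon D b v).

Let G v (b : 'X_{1..n}) c := sc c (iter_mon D b v).

Let sc0 v : sc 0 v = 0.
Proof. by apply: (addrI (sc 0 v)); rewrite -scDl !addr0. Qed.

Let scr0 a : sc a 0 = 0.
Proof. by apply: (addrI (sc a 0)); rewrite -scDr !addr0. Qed.

Let D0 j : D j 0 = 0.
Proof. by apply: (addrI (D j 0)); rewrite -DD !addr0. Qed.

Lemma op_actD P Q v : op_act (P + Q) v = op_act P v + op_act Q v.
Proof.
by apply: (msupp_sumD (G := G v)) => m; [exact: sc0 | exact: scDl].
Qed.

Lemma op_act0 v : op_act 0 v = 0.
Proof. by rewrite /op_act msupp0 big_nil. Qed.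

Lemma op_actZX c m v : op_act (c *: 'X_[m]) v = sc c (iter_mon D m v).
Proof. by apply: (msupp_sumZX (G := G v)) => m'; exact: sc0. Qed.

Lemma op_actX m v : op_act 'X_[m] v = iter_mon D m v.
Proof. by rewrite -[X in op_act X]scale1r op_actZX sc1. Qed.

Lemma op_act_sum (I : Type) (r : seq I) (P : pred I) (F : I -> {mpoly S[n]}) v :
  op_act (\sum_(i <- r | P i) F i) v = \sum_(i <- r | P i) op_act (F i) v.
Proof. by elim/big_rec2: _ => [|i a b _ <-]; rewrite ?op_act0 ?op_actD. Qed.

Lemma op_actZ c Q v : op_act (c *: Q) v = sc c (op_act Q v).
Proof.
elim/mpolyind: Q => [|a m Q _ _ IH]; first by rewrite scaler0 op_act0 scr0.
by rewrite scalerDr !op_actD IH scDr scalerA !op_actZX scA.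
Qed.

Lemma op_act_partial j Q v : op_act (op_partial delta j Q) v = D j (op_act Q v).
Proof.
rewrite /op_partial; elim/mpolyind: Q => [|a m Q m_Q a0 IH].
  have -> : map_mpoly (delta j) 0 = 0 :> {mpoly S[n]}.
    by apply/mpolyP => m; rewrite mcoeff_map_mpoly0 // !mcoeff0.
  by rewrite mulr0 addr0 op_act0 D0.
have -> : map_mpoly (delta j) (a *: 'X_[m] + Q)
  = delta j a *: 'X_[m] + map_mpoly (delta j) Q.
  apply/mpolyP => m'; rewrite mcoeffD !mcoeff_map_mpoly0 // mcoeffD !mcoeffZ !mcoeffX.
  have [<-|_] := eqVneq m m'; last by rewrite !mulr0 !add0r.
  by rewrite !mulr1 (memN_msupp_eq0 m_Q) delta0 !addr0.
rewrite mulrDr addrACA op_actD IH (op_actD (a *: _)) DD; congr (_ + _).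
rewrite -scalerAr -mpolyXD addmC op_actD !op_actZX iter_monDU //.
by rewrite DL addrC.
Qed.

Lemma op_act_mul P Q v : op_act (op_mul delta P Q) v = op_act P (op_act Q v).
Proof.
rewrite /op_mul op_act_sum; apply: eq_bigr => b _; rewrite op_actZ; congr (sc _ _).
rewrite -(iter_mon_morph (f := op_act^~ v) (T := op_partial delta)) //.
by move=> j Q'; rewrite op_act_partial.
Qed.

End OpAction.

Lemma op_mul1 n (S : comNzRingType) (delta : 'I_n -> S -> S) Q : op_mul delta 1 Q = Q.
Proof.
by rewrite /op_mul msupp1 big_seq1 mcoeff1 eqxx scale1r iter_mon0.
Qed.

Section SeriesAction.
Context (R : realType) (n : nat).
Local Notation C := R[i].
Local Notation Cx := {mpoly C[n]}.
Local Notation ser := ('cV[C]_n -> {mpoly C[n]}).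
Implicit Types (f g : ser) (a : 'cV[C]_n).

Definition mnmC (m : 'X_{1..n}) : 'cV[C]_n := \col_j (m j)%:R.

Lemma mnmCD m m' : mnmC (m + m')%MM = mnmC m + mnmC m'.
Proof. by apply/colP => j; rewrite !mxE mnmDE natrD. Qed.

Lemma mnmC0 : mnmC 0%MM = 0.
Proof. by apply/colP => j; rewrite !mxE mnm0E. Qed.

Lemma mnmCU j : mnmC U_(j)%MM = delta_mx j 0.
Proof. by apply/colP => i; rewrite !mxE mnm1E eqxx andbT eq_sym. Qed.

Lemma int_vec_mnm m : int_vec R (mnm_vec m) = mnmC m.
Proof. by apply/colP => j; rewrite !mxE. Qed.

Definition ser_scale (c : Cx) f : ser :=
  fun a => \sum_(m <- msupp c) c@_m *: f (a - mnmC m).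

Lemma iter_ser_x m f a : iter_mon (@ser_x R n) m f a = f (a - mnmC m).
Proof.
have xC i j (g : series R n) : ser_x i (ser_x j g) = ser_x j (ser_x i g).
  by apply/funext => b; rewrite /ser_x addrAC.
elim/mnm_ind: m a => [|m j IH] a.
  by rewrite mnmC0 subr0 iter_mon0.
by rewrite iter_monDU // /ser_x IH mnmCD mnmCU opprD addrA addrAC.
Qed.

Lemma weyl_actE P f : weyl_act P f = op_act ser_scale (@ser_partial R n) P f.
Proof.
apply/funext => a; rewrite /weyl_act /weyl_terms /op_act big_allpairs_dep.
rewrite fct_sumE; apply: eq_bigr => b _.
by rewrite /ser_scale; apply: eq_bigr => m _; rewrite iter_ser_x.
Qed.

Let G f a (m : 'X_{1..n}) (c : C) := c *: f (a - mnmC m).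

Lemma ser_scaleDl f : {morph ser_scale^~ f : c e / c + e}.
Proof.
move=> c e; apply/funext => a; apply: (msupp_sumD (G := G f a)) => m.
  by rewrite /G scale0r.
by move=> x y; rewrite /G scalerDl.
Qed.

Lemma ser_scaleDr c : {morph ser_scale c : f g / f + g}.
Proof.
move=> f g; apply/funext => a.
transitivity (ser_scale c f a + ser_scale c g a); last by [].
rewrite /ser_scale -big_split /=.
by apply: eq_bigr => m _; rewrite -scalerDr.
Qed.

Lemma ser_scaleZX c m f : ser_scale (c *: 'X_[m]) f = fun a => c *: f (a - mnmC m).
Proof.
apply/funext => a; apply: (msupp_sumZX (G := G f a)) => m'.
by rewrite /G scale0r.
Qed.

Lemma ser_scale0 f : ser_scale 0 f = 0.
Proof. by apply/funext => a; rewrite /ser_scale msupp0 big_nil. Qed.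

Lemma ser_scaler0 c : ser_scale c 0 = 0.
Proof. by apply/funext => a; rewrite /ser_scale big1 // => m _; rewrite scaler0. Qed.

Lemma ser_scaleA c e f : ser_scale (c * e) f = ser_scale c (ser_scale e f).
Proof.
elim/mpolyind: c => [|x m c _ _ IH]; first by rewrite mul0r !ser_scale0.
rewrite mulrDl !ser_scaleDl IH; congr (_ + _).
elim/mpolyind: e {IH} => [|y m' e _ _ IH].
  by rewrite mulr0 !ser_scale0 ser_scaler0.
rewrite mulrDr !ser_scaleDl IH ser_scaleDr; congr (_ + _).
rewrite -scalerAl -scalerAr -mpolyXD scalerA !ser_scaleZX.
by apply/funext => a; rewrite scalerA mnmCD opprD addrA.
Qed.

Lemma ser_partialE j f a : ser_partial j f a
  = diffop (((a + delta_mx j 0) j 0)%:MP + 'X_j) (f (a + delta_mx j 0)).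
Proof. by rewrite /ser_partial diffopDl diffopCl diffopXUl. Qed.

Lemma ser_partialD j : {morph @ser_partial R n j : f g / (f : ser) + g >-> (f : ser) + g}.
Proof.
move=> f g; apply/funext => a; rewrite [LHS]ser_partialE linearD /=.
by rewrite -!ser_partialE.
Qed.

Lemma ser_partial_scale j c f : ser_partial j (ser_scale c f)
  = ser_scale c^`M(j) f + ser_scale c (ser_partial j f).
Proof.
elim/mpolyind: c => [|x m c _ _ IH].
  rewrite mderiv0 !ser_scale0 addr0; apply/funext => a.
  by rewrite ser_partialE linear0.
rewrite mderivD !ser_scaleDl [LHS]ser_partialD IH [RHS]addrACA; congr (_ + _).
rewrite mderivZ mderivX scalerA !ser_scaleZX; apply/funext => a.
transitivity ((x * (m j)%:R) *: f (a - mnmC (m - U_(j))%MM)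
  + x *: ser_partial j f (a - mnmC m)); last by [].
rewrite !ser_partialE.
have -> : a - mnmC m + delta_mx j 0 = a + delta_mx j 0 - mnmC m by rewrite addrAC.
set b := a + _; have -> : (b - mnmC m) j 0 = b j 0 - (m j)%:R by rewrite !mxE.
rewrite linearZ /= -scalerA -scalerDr; congr (_ *: _).
have -> : (b j 0)%:MP + 'X_j
    = ((m j)%:R)%:MP + ((b j 0 - (m j)%:R)%:MP + 'X_j) :> {mpoly C[n]}.
  by rewrite addrA -mpolyCD [_ + (b j 0 - _)]addrC subrK.
rewrite diffopDl diffopCl; congr (_ + _).
(* For m_j = 0 the truncated difference [m - U_(j)] gives a wrong shift, but it comes with the
   coefficient m_j = 0. *)
have [->|mj] := eqVneq (m j) 0%N; first by rewrite !scale0r.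
congr (_ *: f _); rewrite /b -mnmCU -addrA; congr (_ + _).
have Uj : (U_(j) <= m)%MM by rewrite lep1mP.
by rewrite -{1}(submK Uj) mnmCD opprD addrCA subrr addr0.
Qed.

Lemma ser_partialC i j f : ser_partial i (ser_partial j f) = ser_partial j (ser_partial i f).
Proof.
have [->//|ne_ij] := eqVneq i j; apply/funext => a.
rewrite !ser_partialE -!diffopM mulrC addrAC; congr (diffop ((_%:MP + _) * (_%:MP + _)) _).
  by rewrite !mxE eq_sym (negPf ne_ij) addr0.
by rewrite !mxE (negPf ne_ij) addr0.
Qed.

(** On x^b p(log x) the operator d_j acts on p as b_j + d/dy_j and lowers b_j by one, so that
    successive factors build a falling factorial of operators. *)
Lemma iter_ser_partial m f a : iter_mon (@ser_partial R n) m f a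
  = diffop (falling (fun j => ((a + mnmC m) j 0)%:MP + 'X_j) m) (f (a + mnmC m)).
Proof.
elim/mnm_ind: m a => [|m j IH] a.
  by rewrite mnmC0 addr0 falling0 diffop1l iter_mon0.
rewrite iter_monDU; last exact: ser_partialC.
rewrite ser_partialE IH fallingDU diffopM mnmCD mnmCU (addrAC a) addrA.
congr (diffop _ _); rewrite !mxE -mpolyC_nat [RHS]addrAC -mpolyCB; congr (_%:MP + _).
ring.
Qed.

Lemma weyl_actM P Q f : weyl_act (op_mul (@mderiv n C) P Q) f
  = weyl_act P (weyl_act Q f).
Proof.
rewrite !weyl_actE; apply: op_act_mul.
- exact: mderiv0.
- exact: ser_scaleDl.
- exact: ser_scaleDr.
- exact: ser_scaleA.
- exact: ser_partialD.
- exact: ser_partial_scale.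
- exact: ser_partialC.
Qed.

Lemma weyl_act_left_ideal (H : weyl R n -> Prop) f :
  (forall Q, H Q -> weyl_act Q f = 0 :> ser) ->
  forall P, weyl_left_ideal H P -> weyl_act P f = 0 :> ser.
Proof.
move=> H0 P [k [c [g [gH ->]]]]; rewrite weyl_actE op_act_sum; last exact: ser_scaleDl.
rewrite big1 // => i _; rewrite -weyl_actE weyl_actM (H0 _ (gH i)).
rewrite weyl_actE /op_act big1 // => b _; apply/funext => a.
rewrite /ser_scale big1 // => m _; rewrite iter_ser_partial.
by rewrite linear0 scaler0.
Qed.

End SeriesAction.

Lemma left_ideal_gen m (S : comNzRingType) (delta : 'I_m -> S -> S)
  (G : {mpoly S[m]} -> Prop) Q : G Q -> left_ideal delta G Q.
Proof.
move=> GQ; exists 1%N, (fun=> 1), (fun=> Q); split => //.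
by rewrite big_ord1 op_mul1.
Qed.

(** * Toric Groebner bases *)

Section ToricGroebner.
Context (R : realType) (d n : nat) (A : 'M[int]_(d, n)) (w : 'cV[R]_n).
Local Notation C := R[i].
Local Notation Cx := {mpoly C[n]}.
Hypothesis hhom : homogeneous_matrix A.

Lemma mweightD m m' : Defs.mweight w (m + m')%MM = Defs.mweight w m + Defs.mweight w m'.
Proof.
rewrite /Defs.mweight -big_split; apply: eq_bigr => j _ /=.
by rewrite mnmDE natrD mulrDr.
Qed.

Definition int_weight (u : 'cV[int]_n) : R := \sum_(j < n) w j 0 * (u j 0)%:~R.

Lemma int_weight_mnm m : int_weight (mnm_vec m) = Defs.mweight w m.
Proof. by apply: eq_bigr => j _; rewrite mxE. Qed.

Lemma int_weightB u u' : int_weight (u - u') = int_weight u - int_weight u'.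
Proof.
rewrite /int_weight -sumrB; apply: eq_bigr => j _.
by rewrite !mxE rmorphB mulrBr.
Qed.

Lemma mnm_vecD m m' : @mnm_vec n (m + m')%MM = mnm_vec m + mnm_vec m'.
Proof. by apply/colP => j; rewrite !mxE mnmDE PoszD. Qed.

Lemma pos_partE (u : 'cV[int]_n) j : (pos_part u j)%:Z = Num.max (u j 0) 0.
Proof. by rewrite mnmE gez0_abs // le_max lexx orbT. Qed.

Lemma neg_partE (u : 'cV[int]_n) j : (neg_part u j)%:Z = Num.max (- u j 0) 0.
Proof. by rewrite pos_partE mxE. Qed.

Lemma pos_neg_part (u : 'cV[int]_n) : u = mnm_vec (pos_part u) - mnm_vec (neg_part u).
Proof.
apply/colP => j; rewrite !mxE pos_partE neg_partE.
by case: (lerP (u j 0) 0) => uj; rewrite ?maxr_absE; case: lerP; lia.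
Qed.

(* Homogeneity makes the total degree constant on the fibers of A, which are
   therefore finite. *)
Lemma mdeg_fiber (m m' : 'X_{1..n}) :
  A *m mnm_vec m = A *m mnm_vec m' -> mdeg m = mdeg m'.
Proof.
have [c c0 [k k0 cA]] := hhom; move=> eqA.
have degE (e : 'X_{1..n}) :
    (c *m map_mx intr (A *m mnm_vec e)) 0 0 = k * (mdeg e)%:R.
  rewrite map_mxM mulmxA mxE mdegE natr_sum mulr_sumr.
  by apply: eq_bigr => j _; rewrite cA !mxE.
have := degE m; rewrite eqA degE => /(mulfI k0)/eqP.
by rewrite eqr_nat => /eqP.
Qed.

Context (M : nat) (g : 'I_M -> 'cV[int]_n).
Hypothesis hg : toric_groebner_basis A w g.

Lemma groebner_inL i : inL A (g i).
Proof. by have [gL _ _] := hg. Qed.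

Lemma poly_init_binomial (m m' : 'X_{1..n}) (p := 'X_[m] - 'X_[m'] : Cx) :
  m != m' ->
  poly_init w p = (if Defs.mweight w m' <= Defs.mweight w m then 'X_[m] else 0)
                - (if Defs.mweight w m <= Defs.mweight w m' then 'X_[m'] else 0).
Proof.
move=> ne_mm'.
have p_m : p@_m = 1 by rewrite mcoeffB !mcoeffX eqxx eq_sym (negPf ne_mm') subr0.
have p_m' : p@_m' = -1 by rewrite mcoeffB !mcoeffX eqxx (negPf ne_mm') sub0r.
have suppP : perm_eq (msupp p) [:: m; m'].
  apply: uniq_perm; rewrite ?msupp_uniq //=; first by rewrite inE ne_mm'.
  move=> e; rewrite mcoeff_msupp mcoeffB !mcoeffX !inE [e == m]eq_sym [e == m']eq_sym.
  have [<-|_] := eqVneq m e.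
    by rewrite [m' == m]eq_sym (negPf ne_mm') subr0 oner_eq0.
  have [_|_] := eqVneq m' e; first by rewrite sub0r oppr_eq0 oner_eq0.
  by rewrite subr0 eqxx.
rewrite /poly_init (perm_big _ suppP) /= !big_cons big_nil !(perm_all _ suppP) /=.
rewrite !lexx !andbT /= p_m p_m' scale1r scaleN1r.
by do 2?case: ifP => _; rewrite ?oppr0 ?addr0 ?add0r.
Qed.

(** The initial form of a basis element is a monomial with coefficient 1. If g_- were heavier than
    g_+, or of equal weight and different from it, the coefficient at g_- would be -1; if g_+ = g_-,
    the initial form would be 0. *)
Lemma groebner_weight_gt0 i : Defs.mweight w (neg_part (g i)) < Defs.mweight w (pos_part (g i)).
Proof.
have [_ [_ _ inX _] _] := hg; have [m] := inX i.
have [eq_g|ne_g] := eqVneq (pos_part (g i)) (neg_part (g i)).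
  rewrite /binomial_of eq_g subrr /poly_init msupp0 big_nil => /eqP.
  by rewrite eq_sym -msize_poly_eq0 msizeX.
rewrite /binomial_of poly_init_binomial //; case: ltgtP => // [lt_w|eq_w].
  rewrite sub0r => /(congr1 (mcoeff (neg_part (g i)))).
  rewrite mcoeffN !mcoeffX eqxx => /eqP; rewrite eq_sym -subr_eq0 opprK.
  by rewrite -(natrD _ _ 1) pnatr_eq0 addn1.
move/(congr1 (mcoeff (neg_part (g i)))).
rewrite mcoeffB !mcoeffX eqxx (negPf ne_g) sub0r => /eqP; rewrite eq_sym -subr_eq0 opprK.
by rewrite -(natrD _ _ 1) pnatr_eq0 addn1.
Qed.

Lemma groebner_init i : poly_init w (binomial_of R (g i)) = 'X_[pos_part (g i)].
Proof.
have lt_w := groebner_weight_gt0 i.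
rewrite /binomial_of poly_init_binomial.
  by rewrite (ltW lt_w) leNgt lt_w subr0.
by apply: contraTneq lt_w => ->; rewrite ltxx.
Qed.

Lemma groebner_int_weight_gt0 i : 0 < int_weight (g i).
Proof.
by rewrite (pos_neg_part (g i)) int_weightB !int_weight_mnm subr_gt0 groebner_weight_gt0.
Qed.

Definition standard m := forall i, ~~ (pos_part (g i) <= m)%MM.

Lemma poly_init_toric_nonstandard p m : toric_ideal A p ->
  m \in msupp (poly_init w p) -> exists i, (pos_part (g i) <= m)%MM.
Proof.
move=> Ip m_p; have [_ [_ /(_ (poly_init w p)) initE _ _] _] := hg.
have [|k [c [G [gG defp]]]] := initE.1.
  exists 1%N, (fun=> 1), (fun=> poly_init w p); rewrite big_ord1 mul1r.
  by split=> // _; exists p.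
have : [exists i : 'I_k, m \in msupp (c i * G i)].
  apply: contraLR m_p; rewrite negb_exists => /forallP m_c.
  rewrite mcoeff_msupp negbK defp raddf_sum /= big1 // => i _.
  exact: memN_msupp_eq0.
case/existsP=> i; have [i' ->] := gG i.
rewrite groebner_init (perm_mem (msuppMX _ _)) => /mapP[e _ ->].
by exists i'; apply: lem_addr.
Qed.

Lemma toric_binomial m m' : A *m mnm_vec m = A *m mnm_vec m' ->
  @toric_ideal R d n A ('X_[m] - 'X_[m']).
Proof.
move=> eqA; exists 1%N, (fun=> 1), (fun=> 'X_[m] - 'X_[m']).
by rewrite big_ord1 mul1r; split => // _; exists m, m'.
Qed.

(** Otherwise the initial form of the toric binomial would contain one of the two monomials, which
    some leading monomial of the basis would then divide. *)
Lemma standard_uniq m m' : standard m -> standard m' ->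
  A *m mnm_vec m = A *m mnm_vec m' -> m = m'.
Proof.
move=> st st' eqA; apply/eqP; apply: contraT => ne_mm'.
have init_nonstd := poly_init_toric_nonstandard (toric_binomial eqA).
rewrite (poly_init_binomial ne_mm') in init_nonstd.
have [le_w|lt_w] := leP (Defs.mweight w m') (Defs.mweight w m).
  have [|i] := init_nonstd m; last by rewrite (negPf (st i)).
  rewrite le_w mcoeff_msupp mcoeffB mcoeffX eqxx.
  case: ifP => _; last by rewrite mcoeff0 subr0 oner_eq0.
  by rewrite mcoeffX [m' == m]eq_sym (negPf ne_mm') subr0 oner_eq0.
have [|i] := init_nonstd m'; last by rewrite (negPf (st' i)).
rewrite leNgt lt_w /= (ltW lt_w) sub0r mcoeff_msupp mcoeffN mcoeffX eqxx.
by rewrite oppr_eq0 oner_eq0.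
Qed.

Lemma Cw0 : Cw g 0.
Proof. by exists (fun=> 0%N); rewrite big1. Qed.

Lemma CwD u i : Cw g u -> Cw g (u + g i).
Proof.
case=> c ->; exists (fun j => c j + (j == i))%N.
under [RHS]eq_bigr do rewrite mulrnDr.
rewrite big_split /=; congr (_ + _).
rewrite (bigD1 i) //= eqxx mulr1n big1 ?addr0 // => j ne_ji.
by rewrite (negPf ne_ji) mulr0n.
Qed.

Lemma mnm_vecB m m' : (m' <= m)%MM ->
  @mnm_vec n (m - m')%MM = mnm_vec m - mnm_vec m'.
Proof. by move=> le_m; apply/eqP; rewrite eq_sym subr_eq -mnm_vecD submK. Qed.

(** Each division step subtracts some g_i and lowers the weight. The degree stays constant, so the
    number of lighter monomials of degree at most N is finite and decreases. *)
Lemma reduce_to_standard m : exists m', [/\ standard m',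
  A *m mnm_vec m = A *m mnm_vec m' & Cw g (mnm_vec m - mnm_vec m')].
Proof.
pose N := mdeg m; pose below (e : 'X_{1..n}) :=
  [set b : 'X_{1..n < N.+1} | Defs.mweight w (bmnm b) < Defs.mweight w e].
suff gen k e : mdeg e = N -> (#|below e| < k)%N -> exists m', [/\ standard m',
    A *m mnm_vec e = A *m mnm_vec m' & Cw g (mnm_vec e - mnm_vec m')].
  exact: gen (erefl _) (ltnSn _).
elim: k e => // k IH e deg_e e_k.
have [[i le_ie]|st] := pselect (exists i, (pos_part (g i) <= e)%MM); last first.
  exists e; rewrite subrr; split => // [i|]; last exact: Cw0.
  by apply/negP => le_ie; apply: st; exists i.
pose e' := (e - pos_part (g i) + neg_part (g i))%MM.
have e'E : mnm_vec e' = mnm_vec e - g i.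
  by rewrite mnm_vecD mnm_vecB // [in RHS](pos_neg_part (g i)) opprB addrA addrAC.
have Ae' : A *m mnm_vec e = A *m mnm_vec e'.
  by rewrite e'E mulmxBr [A *m g i]groebner_inL subr0.
have deg_e' : mdeg e' = N by rewrite -(mdeg_fiber Ae').
have lt_w : Defs.mweight w e' < Defs.mweight w e.
  by rewrite -!int_weight_mnm e'E int_weightB gtrBl groebner_int_weight_gt0.
have [|m' [st Am' Cm']] := IH e' deg_e'.
  rewrite -ltnS; apply: leq_trans e_k; rewrite ltnS; apply: proper_card.
  apply/properP; split.
    by apply/subsetP => b; rewrite !inE => /lt_trans; apply.
  have e'_lt : (mdeg e' < N.+1)%N by rewrite deg_e'.
  by exists (BMultinom e'_lt); rewrite !inE //= ltxx.
exists m'; split => //; first by rewrite Ae'.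
by have := CwD i Cm'; rewrite e'E addrAC subrK.
Qed.

Lemma standard_neg_part_Cw u : inL A u -> standard (neg_part u) -> Cw g u.
Proof.
move=> Lu st; have [m [st_m Am Cm]] := reduce_to_standard (pos_part u).
suff eq_m : m = neg_part u by move: Cm; rewrite eq_m -pos_neg_part.
apply: standard_uniq => //; rewrite -Am.
by apply/eqP; rewrite -subr_eq0 -mulmxBr -pos_neg_part; apply/eqP.
Qed.

Lemma weight_sum (w' : 'cV[R]_n) (c : 'I_M -> nat) :
  \sum_(j < n) w' j 0 * ((\sum_(i < M) g i *+ c i) j 0)%:~R
  = \sum_(i < M) (\sum_(j < n) w' j 0 * (g i j 0)%:~R) *+ c i.
Proof.
under eq_bigr do rewrite summxE rmorph_sum mulr_sumr /=.
rewrite exchange_big; apply: eq_bigr => i _ /=.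
rewrite -sumrMnl; apply: eq_bigr => j _.
by rewrite mulmxnE rmorphMn mulrnAr.
Qed.

Lemma Cw_weight_ge0 (w' : 'cV[R]_n) u :
  (forall i, 0 <= \sum_(j < n) w' j 0 * (g i j 0)%:~R) -> Cw g u ->
  0 <= \sum_(j < n) w' j 0 * (u j 0)%:~R.
Proof.
move=> g_ge0 [c ->]; rewrite weight_sum.
by apply: sumr_ge0 => i _; rewrite mulrn_wge0.
Qed.

Lemma Cw_weight_gt0 u : Cw g u -> u != 0 -> 0 < int_weight u.
Proof.
move=> [c ->] u0.
have [i ci] : exists i, c i != 0%N.
  apply/existsP; apply: contraNT u0; rewrite negb_exists => /forallP c0.
  by rewrite big1 // => i _; have := c0 i; rewrite negbK => /eqP ->.
rewrite /int_weight weight_sum (bigD1 i) //=; apply: ltr_pwDl.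
  by rewrite pmulrn_lgt0 ?lt0n // groebner_int_weight_gt0.
by apply: sumr_ge0 => j _; rewrite mulrn_wge0 // ltW // groebner_int_weight_gt0.
Qed.

Lemma Cw_cone : exists2 eps : R, 0 < eps & forall u, Cw g u ->
  forall w' : 'cV[R]_n, (forall j, `|w' j 0 - w j 0| < eps) ->
    0 <= \sum_(j < n) w' j 0 * (u j 0)%:~R.
Proof.
(* A perturbation of w by less than 1/s in each coordinate changes the weight of g_i by at most N_i
   / s, and s is at least N_i divided by that weight for every i. The sum over i stands for a
   maximum, and the leading 1 keeps s positive when M = 0. *)
pose N i : R := 1 + \sum_(j < n) `|(g i j 0)%:~R|.
have N0 i : 0 < N i by rewrite ltr_pwDl // sumr_ge0.
pose s : R := 1 + \sum_(i < M) N i / int_weight (g i).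
have ratio_ge0 i : 0 <= N i / int_weight (g i).
  by rewrite divr_ge0 ?ltW // groebner_int_weight_gt0.
have s0 : 0 < s by rewrite ltr_pwDl // sumr_ge0.
exists s^-1 => [|u Cu w' ww']; first by rewrite invr_gt0.
apply: Cw_weight_ge0 Cu => i.
have eps_i : s^-1 * N i <= int_weight (g i).
  rewrite mulrC ler_pdivrMr // mulrC -ler_pdivrMr ?groebner_int_weight_gt0 //.
  by rewrite /s (bigD1 i) //= addrCA ler_wpDr // addr_ge0 ?sumr_ge0.
have le_diff : `|\sum_(j < n) (w' j 0 - w j 0) * (g i j 0)%:~R| <= s^-1 * N i.
  apply: le_trans (ler_norm_sum _ _ _) _; rewrite /N mulrDr mulr1.
  rewrite -[X in X <= _]add0r lerD ?invr_ge0 ?(ltW s0) // mulr_sumr ler_sum // => j _.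
  by rewrite normrM ler_wpM2r // ltW.
have -> : \sum_(j < n) w' j 0 * (g i j 0)%:~R
  = int_weight (g i) + \sum_(j < n) (w' j 0 - w j 0) * (g i j 0)%:~R.
  rewrite /int_weight -big_split; apply: eq_bigr => j _ /=.
  by rewrite -mulrDl addrC subrK.
rewrite -lerBlDl sub0r lerNl; apply: le_trans (le_trans le_diff eps_i).
by rewrite -normrN ler_norm.
Qed.

End ToricGroebner.

(** * The coefficients of the series *)

Definition falling1 (T : comNzRingType) (x : T) k : T := \prod_(i < k) (x - i%:R).

Section Ratio.
Context (K : fieldType).
Implicit Types (x : K) (z : int) (k : nat).

(* Gamma(x + 1) / Gamma(x + z + 1) *)
Definition gamma_ratio x z : K :=
  falling1 x (absz (Num.max (- z) 0)) / falling1 (x + z%:~R) (absz (Num.max z 0)).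

Lemma falling1S x k : falling1 x k.+1 = falling1 x k * (x - k%:R).
Proof. by rewrite /falling1 big_ord_recr. Qed.

Lemma falling1Sl x k : falling1 x k.+1 = x * falling1 (x - 1) k.
Proof.
rewrite /falling1 big_ord_recl subr0; congr (_ * _); apply: eq_bigr => i _.
by rewrite lift0 -natr1 opprD addrA addrAC.
Qed.

Lemma falling1_0 x : falling1 x 0 = 1.
Proof. by rewrite /falling1 big_ord0. Qed.

Lemma gamma_ratio_nat x k : gamma_ratio x k = (falling1 (x + k%:R) k)^-1.
Proof.
rewrite /gamma_ratio max_r ?oppr_le0 // max_l //=.
by rewrite falling1_0 mul1r.
Qed.

Lemma gamma_ratio_negnat x k : gamma_ratio x (- k%:Z) = falling1 x k.
Proof.
rewrite /gamma_ratio opprK max_l // max_r ?oppr_le0 //=.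
by rewrite falling1_0 divr1.
Qed.

Lemma gamma_ratio0 x : gamma_ratio x 0 = 1.
Proof. by rewrite gamma_ratio_nat falling1_0 invr1. Qed.

Context (x : K).
Hypothesis x_nint : forall z, x + z%:~R != 0.

Lemma gamma_ratio_pred z : gamma_ratio x (z - 1) = (x + z%:~R) * gamma_ratio x z.
Proof.
case: z / intP => [|k|k].
- by rewrite sub0r (gamma_ratio_negnat _ 1) gamma_ratio0 falling1S falling1_0
     subr0 mul1r mulr1 addr0.
- have -> : k.+1%:Z - 1 = k by lia.
  rewrite !gamma_ratio_nat falling1Sl invfM mulrA divff ?mul1r; last exact: (x_nint k.+1).
  by rewrite -natr1 addrA addrK.
- have -> : - k.+1%:Z - 1 = - k.+2%:Z by lia.
  by rewrite !gamma_ratio_negnat falling1S mulrC rmorphN.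
Qed.

Lemma gamma_ratio_falling z k :
  falling1 (x + z%:~R) k * gamma_ratio x z = gamma_ratio x (z - k%:Z).
Proof.
elim: k => [|k IH]; first by rewrite falling1_0 mul1r subr0.
have -> : z - k.+1%:Z = (z - k%:Z) - 1 by lia.
by rewrite gamma_ratio_pred -IH falling1S mulrAC mulrC rmorphB addrA.
Qed.

End Ratio.

Section RatioAtOrigin.
Context (F : numFieldType) (h : nat).
Local Notation "x %:F" := (FracField.tofrac x).
Local Notation K := {fraction {mpoly F[h]}}.
Implicit Types (f : K) (z : int).

Definition neg_int (c : F) : bool := `[< exists k : nat, c = - k.+1%:R >].

Definition local_unit f := f \in @regular0 F h /\ f^-1 \in @regular0 F h.

Lemma local_unit_tofrac p : p.@[fun=> 0] != 0 -> local_unit p%:F.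
Proof.
move=> p0; split; first exact: regular0_tofrac.
by apply/regular0P; exists 1, p; rewrite tofrac1 div1r.
Qed.

Lemma local_unit1 : local_unit 1.
Proof. by split; rewrite ?invr1 rpred1. Qed.

Lemma local_unitM f g : local_unit f -> local_unit g -> local_unit (f * g).
Proof. by move=> [f1 f2] [g1 g2]; split; rewrite ?invfM rpredM. Qed.

Lemma local_unitV f : local_unit f -> local_unit f^-1.
Proof. by case=> f1 f2; split; rewrite ?invrK. Qed.

Lemma neg_int_pred c : neg_int (c - 1) = neg_int c || (c == 0).
Proof.
apply/asboolP/orP => [[[|k] ck]|[/asboolP[k ->]|/eqP->]].
- by right; rewrite -(subrK 1 c) ck addNr.
- by left; apply/asboolP; exists k; rewrite -(subrK 1 c) ck -natr1 opprD subrK.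
- by exists k.+1; rewrite -[in RHS]natr1 opprD.
- by exists 0%N; rewrite sub0r.
Qed.

Lemma neg_int0 : neg_int 0 = false.
Proof.
by apply/asboolP => -[k /eqP]; rewrite eq_sym oppr_eq0 pnatr_eq0.
Qed.

Context (c : F) (l : {mpoly F[h]}).
Hypotheses (l0 : l.@[fun=> 0] = 0) (l_neq0 : l != 0).
Local Notation x := ((c%:MP + l)%:F : K).
Local Notation ng z := (neg_int (c + z%:~R)).

Lemma shift_tofrac z : x + z%:~R = ((c + z%:~R)%:MP + l)%:F.
Proof.
by rewrite -(rmorph_int (@FracField.tofrac _)) -tofracD mpolyCD addrAC rmorph_int.
Qed.

(** The value of x + z at s = 0 may vanish, but x + z itself does not, as l is nonzero without
    constant term. So the Gamma recurrences hold in the fraction field even at integral c. *)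
Lemma shift_neq0 z : x + z%:~R != 0.
Proof.
rewrite shift_tofrac tofrac_eq0; apply: contra_neq l_neq0 => xz0.
have := congr1 (meval (fun=> 0)) xz0; rewrite mevalD mevalC l0 addr0 meval0 => cz0.
by move: xz0; rewrite cz0 mpolyC0 add0r.
Qed.

(** The factor x + z vanishes at 0 exactly when c + z = 0, which is also the only case in which
    passing from c + z to c + z - 1 enters the negative integers. *)
Lemma shift_local_unit z : exists2 e, local_unit e &
  (x + z%:~R) * l%:F ^+ ng z = e * l%:F ^+ ng (z - 1).
Proof.
have -> : c + (z - 1)%:~R = c + z%:~R - 1 by rewrite rmorphB addrA.
rewrite neg_int_pred shift_tofrac.
have [cz0|cz0] := eqVneq (c + z%:~R) 0.
  exists 1; first exact: local_unit1.
  by rewrite cz0 neg_int0 mpolyC0 add0r expr0 mulr1 mul1r expr1.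
exists ((c + z%:~R)%:MP + l)%:F; last by rewrite orbF.
by apply: local_unit_tofrac; rewrite mevalD mevalC l0 addr0.
Qed.

(** Gamma(x + 1) has a simple pole at the origin when c is a negative integer, and likewise Gamma(x
    + z + 1) for c + z. The order of the quotient along l is the difference of the two indicators,
    written multiplicatively to avoid negative powers. *)
Lemma gamma_ratio_local_unit z : exists2 e, local_unit e &
  gamma_ratio x z * l%:F ^+ ng 0 = e * l%:F ^+ ng z.
Proof.
elim/int_rect: z => [|k [e e1 IH]|k [e e1 IH]].
- by exists 1; [exact: local_unit1 | rewrite gamma_ratio0].
- have [e' e'1 IH'] := shift_local_unit k.+1.
  have kE : k.+1%:Z - 1 = k by lia.
  exists (e * e'^-1); first exact: local_unitM e1 (local_unitV e'1).
  have e'0 : e' != 0.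
    apply: contra_neq (shift_neq0 k.+1) => e'0; move: IH'; rewrite e'0 mul0r => /eqP.
    rewrite mulf_eq0 expf_eq0 tofrac_eq0 (negPf l_neq0) andbF orbF => /eqP ->.
    by [].
  apply: (mulfI (shift_neq0 k.+1)).
  rewrite mulrA -(gamma_ratio_pred shift_neq0) kE IH mulrCA IH' kE mulrA mulfVK //.
- have [e' e'1 IH'] := shift_local_unit (- k%:Z).
  have kE : - k%:Z - 1 = - k.+1%:Z by lia.
  exists (e * e'); first exact: local_unitM.
  rewrite -kE (gamma_ratio_pred shift_neq0).
  have {}IH : gamma_ratio x (- k%:Z) * l%:F ^+ ng 0 = e * l%:F ^+ ng (- k%:Z) by [].
  by rewrite -[LHS]mulrA IH mulrCA IH' mulrA.
Qed.

End RatioAtOrigin.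

Section Coefficients.
Context (R : realType) (d n : nat) (A : 'M[int]_(d, n)).
Local Notation C := R[i].
Context (beta : 'cV[C]_d) (w : 'cV[R]_n) (v : 'cV[C]_n).
Context (M : nat) (g : 'I_M -> 'cV[int]_n) (h : nat) (B : 'M[int]_(n, h)).
Hypothesis hhom : homogeneous_matrix A.
Hypothesis hv : fake_exponent A beta w v.
Hypothesis hg : toric_groebner_basis A w g.
Hypothesis hB : lattice_basis A B.
Local Notation Cs := {mpoly C[h]}.
Local Notation K := {fraction Cs}.
Local Notation "x %:F" := (FracField.tofrac x).
Local Notation calN := (calN A v B g).
Local Notation calNc := (calNc A v B g).
Local Notation KN := (KN A v B g).
Local Notation ms := (ms A v B g).
Local Notation inL' := (inL' A v B g).
Local Notation Bs := (@Bs R n h B).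
Local Notation Bspow := (@Bspow R n h B).
Local Notation a_u := (a_u v B).

Lemma inL0 : inL A 0. Proof. exact: mulmx0. Qed.

Lemma mem_Iset u j : (j \in Iset v u) = neg_int (v j 0 + (u j 0)%:~R).
Proof. by rewrite inE !mxE. Qed.

Lemma mem_Iset0 j : (j \in Iset v 0) = neg_int (v j 0).
Proof. by rewrite mem_Iset mxE addr0. Qed.

Lemma inL_supp u j : inL A u -> j \notin suppB B -> u j 0 = 0.
Proof.
move=> Lu; rewrite inE negbK => /eqP/rowP Bj; have [c [-> _]] := hB.2 u Lu.
by rewrite mxE big1 // => k _; have := Bj k; rewrite !mxE => ->; rewrite mul0r.
Qed.

Lemma falling_eq0 (x : 'I_n -> C) m : falling x m = 0 ->
  exists j, exists2 i, (i < m j)%N & x j = i%:R.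
Proof.
move=> /eqP/prodf_eq0[j _ /prodf_eq0[i _]]; rewrite subr_eq0 => /eqP xj.
by exists j, (i : nat).
Qed.

Lemma neg_int_natB (i k : nat) : neg_int (i%:R - k%:R : C) = (i < k)%N.
Proof.
apply/asboolP/idP => [[e /eqP]|lt_ik].
  rewrite subr_eq addrC -subr_eq opprK -natrD eqr_nat => /eqP <-.
  by rewrite addnS ltnS leq_addr.
exists (k - i).-1; rewrite prednK ?subn_gt0 // natrB ?opprB //.
exact: ltnW.
Qed.

Lemma neg_int_nat (i : nat) : neg_int (i%:R : C) = false.
Proof. by rewrite -[i%:R]subr0 (neg_int_natB i 0). Qed.

(** The fake exponent condition for g_i supplies a coordinate at which v_j is not a negative integer
    but v_j - g_j is; in particular G^(i) is nonempty. *)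
Lemma groebner_gap i : exists j, exists2 k, (k < pos_part (g i) j)%N & v j 0 = k%:R.
Proof.
apply: falling_eq0; apply: hv.2; first exact: groebner_inL hg i.
exact: groebner_weight_gt0 hg i.
Qed.

Lemma Iset0_NSw : Iset v 0 \in NSw A v g.
Proof.
rewrite inE; apply/asboolP; exists 0; split=> [||u Lu eqI]; [exact: inL0|by []|].
apply: (standard_neg_part_Cw hhom hg Lu) => i; apply/negP => /mnm_lepP le_iu.
(* If g_+ divided u_-, then at this j the number v_j + u_j would be a negative integer although v_j
   is not, against I_u = I_0. *)
have [j [k lt_k vj]] := groebner_gap i.
have := mem_Iset0 j; rewrite -eqI mem_Iset vj neg_int_nat.
have lt_kj := leq_trans lt_k (le_iu j).
have -> : u j 0 = - (neg_part u j)%:Z.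
  by have := neg_partE u j; case: lerP => _ uj; lia.
by rewrite rmorphN neg_int_natB lt_kj.
Qed.

Lemma Iset0_calN : Iset v 0 \in calN.
Proof. by rewrite inE Iset0_NSw eqxx. Qed.

Lemma inL'0 : inL' 0.
Proof. by split; [exact: inL0 | exact: Iset0_calN]. Qed.

Lemma inL'_Cw u : inL' u -> Cw g u.
Proof.
case=> Lu; rewrite inE => /andP[+ _]; rewrite inE => /asboolP[u' [_ eqI Cu]].
by apply: Cu Lu _.
Qed.

Lemma Iset_suppBC u j : inL A u -> j \notin suppB B ->
  (j \in Iset v u) = (j \in Iset v 0).
Proof. by move=> Lu jB; rewrite mem_Iset mem_Iset0 (inL_supp Lu jB) addr0. Qed.

Lemma mem_KN_Iset u j : inL' u -> j \in KN -> j \in Iset v u.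
Proof. by case=> _ Nu /bigcapP; apply. Qed.

(** Elements of L vanish outside supp(B), so all the sets I_u agree there. After removal of K_N only
    indices with a nonzero form [Bs j] remain. *)
Lemma mem_KN_suppBC u j : inL A u -> j \notin suppB B -> j \in Iset v u -> j \in KN.
Proof.
move=> Lu jB; rewrite (Iset_suppBC Lu jB) => j0; apply/bigcapP => I.
rewrite inE => /andP[+ _]; rewrite inE => /asboolP[u' [Lu' -> _]].
by rewrite (Iset_suppBC Lu' jB).
Qed.

Lemma Iset_calNc u : inL A u -> ~ inL' u -> Iset v u \in calNc.
Proof.
move=> Lu nLu; rewrite in_setD; apply/andP; split.
  by apply/negP => Nu; apply: nLu.
rewrite inE; apply/andP; split; first by apply/asboolP; exists u.
apply/eqP/setP => j; rewrite !in_setU; have [//|jB] := boolP (j \in suppB B).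
exact: Iset_suppBC.
Qed.

Lemma Bs_meval0 j : (Bs j).@[fun=> 0] = 0.
Proof.
rewrite raddf_sum big1 // => k _ /=; rewrite mevalZ mevalXU mulr0 //.
Qed.

Lemma Bs_coef j k : (Bs j)@_U_(k) = (B j k)%:~R.
Proof.
rewrite raddf_sum (bigD1 k) //= big1 => [|l ne_lk].
  by rewrite mcoeffZ mcoeffXU eqxx mulr1 addr0.
by rewrite mcoeffZ mcoeffXU (negPf ne_lk) mulr0.
Qed.

Lemma suppB_entry j : j \in suppB B -> exists k, B j k != 0.
Proof.
rewrite inE => jB; apply/existsP; apply: contraNT jB; rewrite negb_exists => /forallP B0.
by apply/eqP/rowP => k; rewrite !mxE; apply/eqP; have := B0 k; rewrite negbK.
Qed.

Lemma Bs_neq0 j : j \in suppB B -> Bs j != 0.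
Proof.
case/suppB_entry=> k; apply: contra_neq => /(congr1 (mcoeff U_(k))).
by rewrite Bs_coef mcoeff0 => /eqP; rewrite intr_eq0 => /eqP.
Qed.

Definition shifted_form j : Cs := (v j 0)%:MP + Bs j.
Local Notation xi := shifted_form.

Lemma tofrac_falling1 (p : Cs) k : (falling1 p k)%:F = falling1 p%:F k.
Proof.
rewrite /falling1 (rmorph_prod (@FracField.tofrac Cs)); apply: eq_bigr => i _.
by rewrite [LHS]tofracB; congr (_ - _); exact: rmorph_nat.
Qed.

Lemma tofrac_shift (p : Cs) (z : int) : (p + z%:~R)%:F = p%:F + z%:~R.
Proof. by rewrite tofracD; congr (_ + _); exact: rmorph_int. Qed.

Lemma a_uE u : a_u u = \prod_(j < n) gamma_ratio (xi j)%:F (u j 0).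
Proof.
rewrite /Defs.a_u /falling.
rewrite (rmorph_prod (@FracField.tofrac Cs)) (rmorph_prod (@FracField.tofrac Cs)).
rewrite -prodf_div; apply: eq_bigr => j _; rewrite /gamma_ratio.
congr (_ / _).
  by rewrite [LHS]tofrac_falling1 mnmE mxE.
by rewrite [LHS]tofrac_falling1 mnmE tofrac_shift.
Qed.

Lemma falling_shiftE (u : 'cV[int]_n) p :
  (falling (fun j => xi j + (u j 0)%:~R) p)%:F
  = \prod_(j < n) falling1 ((xi j)%:F + (u j 0)%:~R) (p j).
Proof.
rewrite /falling (rmorph_prod (@FracField.tofrac Cs)); apply: eq_bigr => j _.
by rewrite [LHS]tofrac_falling1 tofrac_shift.
Qed.

Lemma BspowE (S : {set 'I_n}) :
  (Bspow S)%:F = \prod_(j < n) (if j \in S then Bs j else 1 : Cs)%:F :> K.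
Proof. by rewrite /Defs.Bspow big_mkcond (rmorph_prod (@FracField.tofrac Cs)). Qed.

(** The orders of vanishing are computed one coordinate at a time. The set Y is free below the
    negative support of v + u - p: the empty set gives regularity of m(s) a_u(s), and I_u together
    with I_u' gives a generator of P_N. *)
Lemma coef_factor u p (Y : {set 'I_n}) : inL' u ->
  Y \subset nsupp (v + int_vec R u - mnmC R p) -> Y :\: KN \subset suppB B ->
  exists2 c, c \in @regular0 C h &
    ms%:F * a_u u * (falling (fun j => xi j + (u j 0)%:~R) p)%:F
    = (Bspow (Y :\: KN))%:F * c.
Proof.
move=> L'u /subsetP Ysub /subsetP YB; have Lu := L'u.1.
suff /choice[c c_prop] : forall j, exists c, c \in @regular0 C h /\
    (if j \in Iset v 0 :\: KN then Bs j else 1 : Cs)%:F * gamma_ratio (xi j)%:F (u j 0)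
      * falling1 ((xi j)%:F + (u j 0)%:~R) (p j)
    = (if j \in Y :\: KN then Bs j else 1 : Cs)%:F * c.
  exists (\prod_(j < n) c j).
    by apply: rpred_prod => j _; case: (c_prop j).
  rewrite /Defs.ms a_uE falling_shiftE !BspowE -!big_split; apply: eq_bigr => j _.
  by case: (c_prop j).
move=> j.
have fall_reg : falling1 ((xi j)%:F + (u j 0)%:~R : K) (p j) \in @regular0 C h.
  apply: rpred_prod => i _; apply: rpredB; last exact: rpred_nat.
  by apply: rpredD; [exact: regular0_tofrac | exact: rpred_int].
have [jB|jB] := boolP (j \in suppB B); last first.
  rewrite (inL_supp Lu jB) gamma_ratio0 mulr1.
  have -> : (j \in Iset v 0 :\: KN) = false.
    apply/negP; rewrite in_setD => /andP[jK j0].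
    by rewrite (mem_KN_suppBC inL0 jB j0) in jK.
  have -> : (j \in Y :\: KN) = false.
    by apply/negP => /YB; rewrite (negPf jB).
  rewrite tofrac1 mul1r; eexists; split; last by rewrite mul1r.
  by move: fall_reg; rewrite (inL_supp Lu jB).
have l0 := Bs_meval0 j; have l_neq0 := Bs_neq0 jB.
have ratio z := gamma_ratio_local_unit (v j 0) l0 l_neq0 z.
rewrite -/(xi j) in ratio; rewrite !in_setD.
have lF0 : (Bs j)%:F != 0 by rewrite tofrac_eq0.
(* An index of K_N lies in both I_0 and I_u, so that its Gamma quotient is a unit and m(s) need not
   contain its form. *)
have [jK|jK] /= := boolP (j \in KN).
  rewrite tofrac1 mul1r; have [e [e_reg _]] := ratio (u j 0).
  have := mem_KN_Iset L'u jK; rewrite mem_Iset => ->.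
  have := mem_KN_Iset inL'0 jK; rewrite mem_Iset mxE => ->.
  rewrite !expr1 => /(mulIf lF0) ->.
  exists (e * falling1 ((xi j)%:F + (u j 0)%:~R) (p j)); split; last by rewrite mul1r.
  exact: rpredM.
have [e [e_reg _] ratioE] := ratio (u j 0 - (p j)%:Z).
(* A form that j contributes through I_(u-p) without j being in Y is left to the cofactor. *)
exists (e * (Bs j)%:F ^+ ((j \notin Y) && neg_int (v j 0 + (u j 0 - (p j)%:Z)%:~R))).
split; first by apply: rpredM => //; apply: rpredX; exact: regular0_tofrac.
rewrite -mulrA [gamma_ratio _ _ * _]mulrC.
rewrite (gamma_ratio_falling (shift_neq0 (v j 0) l0 l_neq0)).
have -> : (if j \in Iset v 0 then Bs j else 1 : Cs)%:F
    = (Bs j)%:F ^+ neg_int (v j 0 + 0%:~R) :> K.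
  by rewrite mem_Iset mxE; case: neg_int; rewrite ?expr1 ?expr0 ?tofrac1.
rewrite mulrC ratioE mulrCA; congr (_ * _).
case: (boolP (j \in Y)) => jY /=; last by rewrite tofrac1 mul1r.
rewrite expr0 mulr1.
have : neg_int (v j 0 + (u j 0 - (p j)%:Z)%:~R).
  by have := Ysub j jY; rewrite inE !mxE rmorphB addrA.
by move=> ->; rewrite expr1.
Qed.

(** On supp(B) both sides are Gamma quotients at the common shift u - p = u' - p'; elsewhere u and
    u' vanish, so that p and p' agree. This is the cancellation behind the toric equations. *)
Lemma toric_coef u u' p p' : inL A u -> inL A u' ->
  u - mnm_vec p = u' - mnm_vec p' ->
  a_u u * (falling (fun j => xi j + (u j 0)%:~R) p)%:F
  = a_u u' * (falling (fun j => xi j + (u' j 0)%:~R) p')%:F.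
Proof.
move=> Lu Lu' /colP eq_up; rewrite !a_uE !falling_shiftE -!big_split.
apply: eq_bigr => j _ /=.
have := eq_up j; rewrite !mxE => eq_j.
have [jB|jB] := boolP (j \in suppB B).
  have nint := shift_neq0 (v j 0) (Bs_meval0 j) (Bs_neq0 jB).
  rewrite mulrC (gamma_ratio_falling nint) [RHS]mulrC (gamma_ratio_falling nint).
  by rewrite eq_j.
have eq_p : p j = p' j.
  by move: eq_j; rewrite (inL_supp Lu jB) (inL_supp Lu' jB); lia.
by rewrite eq_p (inL_supp Lu jB) (inL_supp Lu' jB).
Qed.

End Coefficients.

(** * Solutions *)

Section Solutions.
Context (R : realType) (d n : nat) (A : 'M[int]_(d, n)).
Local Notation C := R[i].
Context (beta : 'cV[C]_d) (w : 'cV[R]_n) (v : 'cV[C]_n).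
Context (M : nat) (g : 'I_M -> 'cV[int]_n) (h : nat) (B : 'M[int]_(n, h)).
Hypothesis hhom : homogeneous_matrix A.
Hypothesis hv : fake_exponent A beta w v.
Hypothesis hg : toric_groebner_basis A w g.
Hypothesis hB : lattice_basis A B.
Local Notation Cs := {mpoly C[h]}.
Local Notation K := {fraction Cs}.
Local Notation "x %:F" := (FracField.tofrac x).
Local Notation calN := (calN A v B g).
Local Notation calNc := (calNc A v B g).
Local Notation KN := (KN A v B g).
Local Notation ms := (ms A v B g).
Local Notation inL' := (inL' A v B g).
Local Notation Bs := (@Bs R n h B).
Local Notation Bspow := (@Bspow R n h B).
Local Notation a_u := (a_u v B).

Local Notation phi u := (ms%:F * a_u u).
Local Notation Ft := (Ftilde A v B g).
Local Notation xi := (shifted_form v B).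

Lemma diffop_ideal_gen m (G : {mpoly C[m]} -> Prop) q :
  (forall p, G p -> diffop p q = 0) -> forall p, ideal_gen G p -> diffop p q = 0.
Proof.
move=> G0 p [k [c [e [eG ->]]]]; rewrite diffop_sumr big1 // => i _.
by rewrite diffopM G0 // linear0.
Qed.

(** For every r the product r p is in the ideal, so p(d) q pairs to 0 with every polynomial and
    vanishes by nondegeneracy. *)
Lemma perp_ideal_gen m (G : {mpoly C[m]} -> Prop) q : perp (ideal_gen G) q ->
  forall p, G p -> diffop p q = 0.
Proof.
move=> Gq p Gp; apply: diffop_pair_eq0 => r; rewrite -diffopM -diffop_pair_sym.
by apply: Gq; exists 1%N, (fun=> r), (fun=> p); rewrite big_ord1.
Qed.

Lemma int_vec_inj : injective (@int_vec R n).
Proof.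
move=> u u' /colP eq_u; apply/colP => j; apply: (@intr_inj C).
by have := eq_u j; rewrite !mxE.
Qed.

Lemma int_vecB u u' : int_vec R (u - u') = int_vec R u - int_vec R u' :> 'cV[C]_n.
Proof. by apply/colP => j; rewrite !mxE rmorphB. Qed.

Lemma int_vec0 : int_vec R 0 = 0 :> 'cV[C]_n.
Proof. by apply/colP => j; rewrite !mxE. Qed.

Lemma Ftilde_at q u : inL' u -> Ft q (v + int_vec R u) = log_coef B q (phi u).
Proof.
move=> L'u; rewrite /Ftilde; case: pselect => [e|[]]; last by exists u.
by case: cid => u' /= [L'u' /addrI/int_vec_inj ->].
Qed.

Lemma Ftilde_out q a : ~ (exists u, inL' u /\ a = v + int_vec R u) -> Ft q a = 0.
Proof. by move=> nLa; rewrite /Ftilde; case: pselect. Qed.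

Lemma phi_regular u : inL' u -> phi u \in @regular0 C h.
Proof.
move=> L'u; have [||c c_reg] := coef_factor hhom hv hg hB (p := 0%MM) (Y := set0) L'u.
- exact: sub0set.
- by rewrite set0D sub0set.
rewrite falling0 set0D /Defs.Bspow big_set0 tofrac1 mulr1 mul1r => ->.
exact: c_reg.
Qed.

Lemma comp_falling (a : 'cV[C]_n) m :
  falling (fun j => (a j 0)%:MP + 'X_j) m \mPo [tuple Bs j | j < n]
  = falling (fun j => (a j 0)%:MP + Bs j) m.
Proof.
rewrite /falling rmorph_prod; apply: eq_bigr => j _.
rewrite rmorph_prod; apply: eq_bigr => i _.
by rewrite rmorphB rmorphD rmorph_nat /= comp_mpolyC comp_mpolyXU -tnth_nth tnth_mktuple.
Qed.

Lemma falling_xi u m : falling (fun j => ((v + int_vec R u) j 0)%:MP + Bs j) m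
  = falling (fun j => xi j + (u j 0)%:~R) m.
Proof.
rewrite /falling; apply: eq_bigr => j _; apply: eq_bigr => i _; congr (_ - _).
by rewrite /shifted_form !mxE mpolyCD addrAC; congr (_ + _ + _); exact: rmorph_int.
Qed.

(** Differentiation in x multiplies the coefficient function by [v+Bs+u]_m inside q(d_s). A single
    polynomial r from [log_coef_PsiB] represents the coefficient before and after this
    multiplication. *)
Lemma Ftilde_deriv q u m a : inL' u -> a + mnmC R m = v + int_vec R u ->
  iter_mon (@ser_partial R n) m (Ft q) a
  = log_coef B q ((falling (fun j => xi j + (u j 0)%:~R) m)%:F * phi u).
Proof.
move=> L'u am; rewrite iter_ser_partial am Ftilde_at //.
have [r [_ rE]] := log_coef_PsiB B q (phi_regular L'u).
have := rE 1; rewrite tofrac1 mul1r diffop1l => ->.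
by rewrite rE diffop_PsiB comp_falling falling_xi.
Qed.

Lemma Ftilde_deriv_out q m a : ~ (exists u, inL' u /\ a + mnmC R m = v + int_vec R u) ->
  iter_mon (@ser_partial R n) m (Ft q) a = 0.
Proof. by move=> nLa; rewrite iter_ser_partial Ftilde_out // linear0. Qed.

Lemma neg_int_subn (c : C) (k : nat) : neg_int c -> neg_int (c - k%:R).
Proof.
move=> /asboolP[i ->]; apply/asboolP; exists (i + k)%N.
by rewrite -addSn natrD opprD.
Qed.

Lemma log_coef0l (f : K) : log_coef B 0 f = 0.
Proof.
rewrite /log_coef exp_diffop0l; apply/mpolyP => m.
by rewrite (mcoeff_map_mpoly0 _ _ (frac_eval0_0 R h)) !mcoeff0; exact: frac_eval0_0.
Qed.

(** The common exponent v + u - p = v + u' - p' lies below both v + u and v + u', so its negative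
    support contains I_u and I_u'. As I_u is in [calN] and I_u' in [calNc], a generator of P_N
    divides the coefficient. *)
Lemma boundary_term_eq0 q u u' p p' : perp (PN A v B g) q ->
  inL' u -> inL A u' -> ~ inL' u' -> u - mnm_vec p = u' - mnm_vec p' ->
  log_coef B q ((falling (fun j => xi j + (u j 0)%:~R) p)%:F * phi u) = 0.
Proof.
move=> perp_q L'u Lu' nL'u' eq_up.
pose Y := Iset v u :|: Iset v u'.
have [||c c_reg cE] := coef_factor hhom hv hg hB (p := p) (Y := Y) L'u.
- apply/subsetP => j; rewrite in_setU !mem_Iset inE !mxE => /orP[|]; first exact: neg_int_subn.
  move=> /(neg_int_subn (p' j)); have /colP/(_ j) := eq_up; rewrite !mxE => eq_j.
  have -> : v j 0 + (u j 0)%:~R - (p j)%:R = v j 0 + (u j 0 - (p j)%:Z)%:~R.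
    by rewrite rmorphB addrA.
  by rewrite eq_j rmorphB addrA.
- apply/subsetP => j; rewrite in_setD in_setU => /andP[jK jY].
  apply: contraR jK => jB; case/orP: jY => jI.
    exact: (mem_KN_suppBC g hB L'u.1 jB jI).
  exact: (mem_KN_suppBC g hB Lu' jB jI).
rewrite [X in log_coef B q X]mulrC cE log_coef_mul //.
rewrite (perp_ideal_gen perp_q) ?log_coef0l //.
exists (Iset v u), (Iset v u'); split=> //; first exact: L'u.2.
exact: (Iset_calNc hB Lu' nL'u').
Qed.

(** At a given exponent each side reads one term, and the two indices differ by m - m', an element
    of L. If both are in L', the terms agree by [toric_coef]; if only one is, its term is a boundary
    term and vanishes. *)
Lemma Ftilde_toric q m m' a : perp (PN A v B g) q ->
  A *m mnm_vec m = A *m mnm_vec m' ->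
  iter_mon (@ser_partial R n) m (Ft q) a = iter_mon (@ser_partial R n) m' (Ft q) a.
Proof.
move=> perp_q Am.
have eq_shift u u' : u - mnm_vec m = u' - mnm_vec m' ->
    a + mnmC R m = v + int_vec R u -> a + mnmC R m' = v + int_vec R u'.
  move=> eq_u eq_a; rewrite -!int_vec_mnm in eq_a *; apply: (addIr (- int_vec R (mnm_vec m'))).
  rewrite addrK -addrA -int_vecB -eq_u int_vecB addrA -eq_a addrK.
  by [].
have eq_shift' u u' : u - mnm_vec m = u' - mnm_vec m' ->
    a + mnmC R m' = v + int_vec R u' -> a + mnmC R m = v + int_vec R u.
  move=> eq_u eq_a; rewrite -!int_vec_mnm in eq_a *; apply: (addIr (- int_vec R (mnm_vec m))).
  rewrite addrK -addrA -int_vecB eq_u int_vecB addrA -eq_a addrK.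
  by [].
have [[u [L'u au]]|nLm] := pselect (exists u, inL' u /\ a + mnmC R m = v + int_vec R u).
  pose u' := u - mnm_vec m + mnm_vec m'.
  have eq_u : u - mnm_vec m = u' - mnm_vec m' by rewrite /u' addrK.
  have Lu' : inL A u'.
    by rewrite /inL mulmxDr mulmxBr L'u.1 sub0r Am addNr.
  have au' := eq_shift _ _ eq_u au.
  rewrite (Ftilde_deriv _ L'u au).
  have [L'u'|nL'u'] := pselect (inL' u').
    rewrite (Ftilde_deriv _ L'u' au'); congr log_coef.
    rewrite mulrCA [RHS]mulrCA; congr (_ * _); rewrite [LHS]mulrC [RHS]mulrC.
    exact: (toric_coef v hB L'u.1 Lu' eq_u).
  rewrite (boundary_term_eq0 perp_q L'u Lu' nL'u' eq_u) Ftilde_deriv_out //.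
  case=> u2 [L'u2]; rewrite au' => /addrI/int_vec_inj eq_u2.
  by apply: nL'u'; rewrite eq_u2.
rewrite (Ftilde_deriv_out _ nLm); apply/esym.
have [[u' [L'u' au']]|nLm'] := pselect (exists u, inL' u /\ a + mnmC R m' = v + int_vec R u).
  pose u := u' - mnm_vec m' + mnm_vec m.
  have eq_u : u' - mnm_vec m' = u - mnm_vec m by rewrite /u addrK.
  have Lu : inL A u.
    by rewrite /inL mulmxDr mulmxBr L'u'.1 sub0r Am addNr.
  rewrite (Ftilde_deriv _ L'u' au'); apply: (boundary_term_eq0 perp_q L'u' Lu _ eq_u).
  by move=> L'u; apply: nLm; exists u; split; last exact: (eq_shift' _ _ (esym eq_u) au').
by rewrite Ftilde_deriv_out.
Qed.

End Solutions.

(** * The generators of H_A(beta) acting on series *)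

Section GeneratorAction.
Context (R : realType) (d n : nat) (A : 'M[int]_(d, n)).
Local Notation C := R[i].
Local Notation Cx := {mpoly C[n]}.
Local Notation ser := ('cV[C]_n -> {mpoly C[n]}).
Implicit Types (f : ser) (a : 'cV[C]_n).
Local Notation const_act p f := (weyl_act (map_mpoly (@mpolyC n C) p) f : ser).

Lemma const_actD p q f : const_act (p + q) f = const_act p f + const_act q f.
Proof.
have -> : map_mpoly (@mpolyC n C) (p + q)
  = map_mpoly (@mpolyC n C) p + map_mpoly (@mpolyC n C) q by exact: raddfD.
rewrite [LHS]weyl_actE op_actD; last exact: ser_scaleDl.
by congr (_ + _); apply/esym/weyl_actE.
Qed.

Lemma const_actZX c m f a :
  const_act (c *: 'X_[m]) f a = c *: iter_mon (@ser_partial R n) m f a.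
Proof.
rewrite weyl_actE map_mpolyZ map_mpolyX op_actZX; last exact: ser_scaleDl.
transitivity (ser_scale (c *: 'X_[0]) (iter_mon (@ser_partial R n) m f) a).
  by congr (ser_scale _ _ a); rewrite mpolyX0 -mul_mpolyC mulr1.
by rewrite ser_scaleZX mnmC0 subr0.
Qed.

Lemma const_act0 f : const_act 0 f = 0.
Proof.
have -> : map_mpoly (@mpolyC n C) (0 : Cx) = 0 by exact: raddf0.
by rewrite weyl_actE op_act0.
Qed.

Lemma const_act_toric f :
  (forall m m', A *m mnm_vec m = A *m mnm_vec m' ->
     iter_mon (@ser_partial R n) m f = iter_mon (@ser_partial R n) m' f) ->
  forall p, toric_ideal A p -> const_act p f = 0.
Proof.
move=> eq_f p [k [c [e [eG ->]]]].
elim/big_ind: _ => [|p1 p2 H1 H2|i _]; first exact: const_act0.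
  by rewrite (const_actD p1 p2); exact: etrans (congr2 _ H1 H2) (addr0 _).
have [m [m' [Am ->]]] := eG i.
elim/mpolyind: (c i) => [|x l q _ _ IH]; first by rewrite mul0r const_act0.
rewrite mulrDl const_actD; apply: (etrans (congr2 _ _ IH) (addr0 0)).
rewrite mulrBr -!scalerAl -!mpolyXD -scaleNr const_actD.
apply/funext => a; transitivity (x *: iter_mon (@ser_partial R n) (l + m)%MM f a
  + - x *: iter_mon (@ser_partial R n) (l + m')%MM f a).
  by congr (_ + _); apply: const_actZX.
rewrite (eq_f _ (l + m')%MM); first by rewrite -scalerDl subrr scale0r.
have mnmD e1 e2 : @mnm_vec n (e1 + e2)%MM = mnm_vec e1 + mnm_vec e2.
  exact: mnm_vecD.
by rewrite !mnmD !mulmxDr Am.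
Qed.

Lemma const_act_binomial m m' f a : const_act ('X_[m] - 'X_[m']) f a
  = iter_mon (@ser_partial R n) m f a - iter_mon (@ser_partial R n) m' f a.
Proof.
rewrite -['X_[m]]scale1r -['X_[m']]scale1r -scaleNr const_actD.
rewrite -[X in X - _]scale1r -[X in _ - X]scale1r -scaleNr.
by congr (_ + _); apply: const_actZX.
Qed.

Definition euler_op (beta : 'cV[C]_d) i : weyl R n :=
  \sum_(j < n) ((A i j)%:~R * 'X_j : Cx) *: 'X_j - (beta i 0)%:MP%:MP.

Lemma euler_act beta i f a : weyl_act (euler_op beta i) f a
  = ((map_mx intr A *m a) i 0 - beta i 0) *: f a
    + \sum_(j < n) (A i j)%:~R *: (f a)^`M(j).
Proof.
have scDl := @ser_scaleDl R n.
have -> : euler_op beta i = \sum_(j < n) ((A i j)%:~R *: 'X_j : Cx) *: 'X_j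
    + ((- beta i 0) *: 'X_[0] : Cx) *: 'X_[0].
  rewrite /euler_op; apply: (f_equal2 +%R).
    apply: eq_bigr => j _; apply: (f_equal2 *:%R) => //.
    by rewrite -mul_mpolyC rmorph_int.
  by rewrite !mpolyX0 !scaleNr -!mul_mpolyC !mulr1.
rewrite weyl_actE op_actD // op_act_sum //.
transitivity ((\sum_(j < n) (A i j)%:~R *: (a j 0 *: f a + (f a)^`M(j)))
  + - beta i 0 *: f a).
  congr (_ + _); last first.
    by rewrite op_actZX // ser_scaleZX mnmC0 subr0 iter_mon0.
  rewrite fct_sumE; apply: eq_bigr => j _; rewrite op_actZX // ser_scaleZX mnmCU.
  congr (_ *: _); rewrite -[U_(j)%MM]add0m iter_monDU; last exact: ser_partialC.
  by rewrite iter_mon0 /ser_partial subrK.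
under eq_bigr do rewrite scalerDr scalerA.
rewrite big_split addrAC /=; congr (_ + _).
rewrite -scaler_suml -scalerDl; congr ((_ - _) *: _).
by rewrite mxE; apply: eq_bigr => j _; rewrite mxE.
Qed.

End GeneratorAction.

(** * Starting terms of solutions *)

Section SolutionSpace.
Context (R : realType) (d n : nat) (A : 'M[int]_(d, n)).
Local Notation C := R[i].
Context (beta : 'cV[C]_d) (w : 'cV[R]_n) (v : 'cV[C]_n).
Context (M : nat) (g : 'I_M -> 'cV[int]_n) (h : nat) (B : 'M[int]_(n, h)).
Hypothesis hhom : homogeneous_matrix A.
Hypothesis hv : fake_exponent A beta w v.
Hypothesis hg : toric_groebner_basis A w g.
Hypothesis hB : lattice_basis A B.
Local Notation Cs := {mpoly C[h]}.
Local Notation K := {fraction Cs}.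
Local Notation "x %:F" := (FracField.tofrac x).
Local Notation calN := (calN A v B g).
Local Notation calNc := (calNc A v B g).
Local Notation KN := (KN A v B g).
Local Notation ms := (ms A v B g).
Local Notation inL' := (inL' A v B g).
Local Notation Bs := (@Bs R n h B).
Local Notation Bspow := (@Bspow R n h B).
Local Notation a_u := (a_u v B).

Local Notation phi u := (ms%:F * a_u u).
Local Notation Ft := (Ftilde A v B g).
Local Notation xi := (shifted_form v B).
Local Notation PN := (PN A v B g).
Local Notation PB := (PB v B g).

Lemma int_vec_euler u i : inL A u ->
  (map_mx intr A *m (v + int_vec R u)) i 0 = beta i 0.
Proof.
move=> Lu; rewrite mulmxDr hv.1 -map_mxM [A *m u]Lu map_mx0.
by rewrite addr0.
Qed.

Lemma Bs_euler i : \sum_(j < n) (A i j)%:~R *: Bs j = 0.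
Proof.
rewrite /Defs.Bs; under eq_bigr do rewrite scaler_sumr.
rewrite exchange_big big1 // => k _ /=.
under eq_bigr do rewrite scalerA -rmorphM.
rewrite -scaler_suml -rmorph_sum /=.
have := congr1 (fun X : 'M[int]_(d, h) => X i k) hB.1; rewrite !mxE => ->.
by rewrite scale0r.
Qed.

Lemma Ftilde_euler q i a : weyl_act (euler_op A beta i) (Ft q) a = 0.
Proof.
rewrite euler_act.
have [[u [L'u ->]]|nLa] := pselect (exists u, inL' u /\ a = v + int_vec R u).
  rewrite int_vec_euler ?subrr ?scale0r ?add0r; last exact: L'u.1.
  rewrite Ftilde_at //.
  have [r [_ rE]] := log_coef_PsiB B q (phi_regular hhom hv hg hB L'u).
  have := rE 1; rewrite tofrac1 mul1r diffop1l => ->.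
  under eq_bigr do rewrite PsiB_deriv -PsiBZ -diffopZl.
  rewrite -(raddf_sum (@PsiB R n h B)) -diffop_sumr Bs_euler diffop0l.
  exact: PsiB0.
rewrite Ftilde_out // scaler0 add0r big1 // => j _.
by rewrite mderiv0 scaler0.
Qed.

Lemma Ftilde_annihilated q : perp PN q -> forall P, hyp_ideal A beta P ->
  weyl_act P (Ft q) = 0 :> ('cV[C]_n -> {mpoly C[n]}).
Proof.
move=> perp_q; apply: weyl_act_left_ideal => P [[p Ip ->]|[i ->]].
  apply: const_act_toric Ip => m m' Am; apply/funext => a.
  exact: (Ftilde_toric hhom hv hg hB _ perp_q Am).
by apply/funext => a; exact: Ftilde_euler.
Qed.

Lemma msize_Ftilde q a : (msize (Ft q a) <= msize q)%N.
Proof.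
have [[u [L'u ->]]|nLa] := pselect (exists u, inL' u /\ a = v + int_vec R u); last first.
  by rewrite Ftilde_out // msize0.
rewrite Ftilde_at //.
have [r [r_q rE]] := log_coef_PsiB B q (phi_regular hhom hv hg hB L'u).
have := rE 1; rewrite tofrac1 mul1r diffop1l => ->.
exact: leq_trans (msize_PsiB _ _) r_q.
Qed.

Lemma Ftilde_nilsson q : nilsson w (Ft q).
Proof.
have [eps eps0 epsP] := Cw_cone hg.
exists [:: v], (msize q), eps; split => // a fa; split; first exact: msize_Ftilde.
exists v; first exact: mem_head.
have [[u [L'u aE]]|nLa] := pselect (exists u, inL' u /\ a = v + int_vec R u).
  by exists u => // w'; apply: epsP; exact: inL'_Cw L'u.
by rewrite Ftilde_out // eqxx in fa.
Qed.

Lemma Re_int (z : int) : complex.Re (z%:~R : C) = z%:~R.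
Proof. by rewrite -(rmorph_int (@real_complex R)). Qed.

Lemma re_weightD u : re_weight w (v + int_vec R u) = re_weight w v + int_weight w u.
Proof.
rewrite /re_weight /int_weight -big_split; apply: eq_bigr => j _ /=.
rewrite !mxE -mulrDr -Re_int; congr (_ * _).
by case: (v j 0) (_%:~R) => [x y] [x' y'].
Qed.

Lemma Ftilde_weight q a : a != v -> Ft q a != 0 -> re_weight w v < re_weight w a.
Proof.
move=> av fa; have [[u [L'u aE]]|nLa] := pselect (exists u, inL' u /\ a = v + int_vec R u).
  rewrite aE re_weightD ltrDl; apply: (Cw_weight_gt0 hg (inL'_Cw L'u)).
  by apply: contra_neq av => u0; rewrite aE u0 int_vec0 addr0.
by rewrite Ftilde_out // eqxx in fa.
Qed.

Lemma Ftilde_start q : Ft q v = PsiB B (diffop ms q).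
Proof.
rewrite -{2}[v]addr0 -(int_vec0 R n) Ftilde_at; last exact: inL'0 hhom hv hg.
rewrite a_uE big1 => [|j _]; last by rewrite mxE gamma_ratio0.
by rewrite mulr1 log_coef_tofrac.
Qed.

Lemma Ftilde_weight_ge q : weight_ge w v (Ft q).
Proof.
move=> a fa; have [->|av] := eqVneq a v; first exact: lexx.
exact/ltW/(Ftilde_weight av fa).
Qed.

Lemma Bspow_surj (S : {set 'I_n}) : S \subset suppB B ->
  forall r, exists q, diffop (Bspow S) q = r.
Proof.
move=> /subsetP SB; rewrite /Defs.Bspow.
elim/big_ind: _ => [r|p q Hp Hq r|j jS r].
- by exists r; rewrite diffop1l.
- have [r1 <-] := Hp r; have [r2 <-] := Hq r1.
  by exists r2; rewrite diffopM.
- have [k Bjk] := suppB_entry (SB j jS).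
  by apply: (diffop_linear_form_surj (k := k)); rewrite intr_eq0.
Qed.

Hypothesis hP : forall p : Cs, PN p <-> exists2 p', PB p' & p = ms * p'.

Lemma perp_lift r :
  (forall i, diffop (Bspow (Iset v (- g i) :\: Iset v 0)) r = 0) ->
  exists2 q, perp PN q & diffop ms q = r.
Proof.
move=> PBr; have [|q msq] := @Bspow_surj (Iset v 0 :\: KN) _ r.
  apply/subsetP => j; rewrite in_setD => /andP[jK j0]; apply: contraR jK => jB.
  exact: (mem_KN_suppBC g hB (inL0 A) jB j0).
exists q => // p /hP[p' PBp' ->]; rewrite diffop_pair_sym mulrC diffopM msq.
rewrite (diffop_ideal_gen (G := fun p => exists i : 'I_M,
  p = Bspow (Iset v (- g i) :\: Iset v 0))) ?meval0 //.
by move=> _ [i ->].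
Qed.

(** At most one factor vanishes at the origin, the one with c = i. It occurs when c is a natural
    number below k, that is, when c - k is a negative integer and c is not. *)
Lemma falling1_local (c : C) (l : Cs) k : l.@[fun=> 0] = 0 ->
  exists2 e : Cs, e.@[fun=> 0] != 0 &
    falling1 (c%:MP + l) k = e * l ^+ (~~ neg_int c && neg_int (c - k%:R)).
Proof.
move=> l0; elim: k => [|k [e e0 IH]].
  by exists 1; rewrite ?meval1 ?oner_eq0 // subr0 andNb expr0 mulr1 /falling1 big_ord0.
rewrite /falling1 big_ord_recr /= -/(falling1 _ _) IH.
have -> : c - k.+1%:R = c - k%:R - 1 by rewrite -natr1 opprD addrA.
have -> : c%:MP + l - k%:R = (c - k%:R)%:MP + l.
  by rewrite mpolyCB mpolyC_nat addrAC.
rewrite neg_int_pred; have [ck|ck] := eqVneq (c - k%:R) 0.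
  exists e => //; rewrite ck neg_int0 mpolyC0 add0r andbF expr0 mulr1 orbT andbT.
  have -> : c = k%:R by apply/eqP; rewrite -subr_eq0 ck.
  by rewrite neg_int_nat.
exists (e * ((c - k%:R)%:MP + l)); last by rewrite orbF mulrAC.
by rewrite mevalM mulf_neq0 // mevalD mevalC l0 addr0.
Qed.

Lemma falling_local i : exists2 e : Cs, e.@[fun=> 0] != 0 &
  falling (fun j => xi j) (pos_part (g i))
  = e * Bspow (Iset v (- g i) :\: Iset v 0).
Proof.
have /choice[e eP] : forall j, exists e : Cs, e.@[fun=> 0] != 0 /\
    falling1 (xi j) (pos_part (g i) j)
    = e * (if j \in Iset v (- g i) :\: Iset v 0 then Bs j else 1).
  move=> j; have [e e0 eE] := falling1_local (v j 0) (pos_part (g i) j) (Bs_meval0 R B j).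
  exists e; split=> //; rewrite [LHS]eE; congr (_ * _).
  rewrite in_setD mem_Iset0 mem_Iset mxE.
  have [posE negE] := (pos_partE (g i) j, neg_partE (g i) j).
  have [gj|gj] := lerP (g i j 0) 0.
    (* Where g_j <= 0, the vector -g moves v_j upwards and cannot create a new negative integer, so
       j is not in G^(i). *)
    have -> : pos_part (g i) j = 0%N by move: posE; case: lerP => ? ?; lia.
    rewrite subr0 andNb expr0; case: ifP => // /andP[/negP nv].
    have -> : - g i j 0 = (neg_part (g i) j)%:Z by move: negE; case: lerP => ? ?; lia.
    move=> /(neg_int_subn (neg_part (g i) j)); rewrite addrK => /nv.
    by [].
  have -> : - g i j 0 = - (pos_part (g i) j)%:Z by move: posE; case: lerP => ? ?; lia.
  by rewrite rmorphN; case: (_ && _); rewrite ?expr1 ?expr0.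
exists (\prod_(j < n) e j).
  rewrite rmorph_prod; apply/prodf_neq0 => j _; exact: (eP j).1.
rewrite /Defs.Bspow [X in _ * X]big_mkcond -big_split; apply: eq_bigr => j _.
exact: (eP j).2.
Qed.

Lemma solution_start f : series_solution A beta w f -> weight_ge w v f ->
  exists2 r, f v = PsiB B r &
    forall i, diffop (Bspow (Iset v (- g i) :\: Iset v 0)) r = 0.
Proof.
move=> [_ fH] f_ge.
have [r fvE] : exists r, f v = PsiB B r.
  apply: (PsiB_surj hB) => i.
  have := fH _ (left_ideal_gen _ (or_intror (ex_intro _ i erefl))) v.
  rewrite -/(euler_op A beta i) euler_act hv.1 subrr scale0r add0r.
  exact.
(* At the exponent v - g_+ the operator d^(g_+) reads the x^v-part of f, while d^(g_-) reads the
   exponent v - g, whose weight is below that of v. *)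
exists r => // i; pose a := v - mnmC R (pos_part (g i)).
have Ig : toric_ideal A (binomial_of R (g i)) by have [_ [+ _ _ _] _] := hg.
have := fH _ (left_ideal_gen _ (or_introl (ex_intro2 _ _ _ Ig erefl))) a.
rewrite const_act_binomial !iter_ser_partial.
have -> : a + mnmC R (pos_part (g i)) = v by rewrite subrK.
have -> : f (a + mnmC R (neg_part (g i))) = 0.
  apply/eqP; apply: contraT => /f_ge.
  have -> : a + mnmC R (neg_part (g i)) = v + int_vec R (- g i).
    rewrite /a -!int_vec_mnm -addrA; congr (_ + _).
    rewrite [in RHS](pos_neg_part (g i)) opprB int_vecB addrC.
    by [].
  rewrite re_weightD lerDl leNgt => /negP[].
  rewrite -[- g i]sub0r int_weightB -(subrr 0) int_weightB subrr sub0r oppr_lt0.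
  exact: groebner_int_weight_gt0 hg i.
rewrite linear0 subr0 fvE diffop_PsiB comp_falling -(PsiB0 R B) => /(PsiB_inj hB).
have [e e0 eE] := falling_local i.
by rewrite [falling _ _]eE diffopM => /(diffop_regular_inj e0).
Qed.

(** G^(i) is nonempty, so its product of linear forms has no constant term and kills constants. *)
Lemma start_one i : diffop (Bspow (Iset v (- g i) :\: Iset v 0)) 1 = 0 :> Cs.
Proof.
have [j [k lt_k vj]] := groebner_gap hv hg i.
have jG : j \in Iset v (- g i) :\: Iset v 0.
  rewrite in_setD mem_Iset0 mem_Iset mxE vj neg_int_nat /=.
  have -> : - g i j 0 = - (pos_part (g i) j)%:Z.
    by have := pos_partE (g i) j; case: lerP => ? ?; lia.
  by rewrite rmorphN neg_int_natB.
apply/eqP; rewrite -msize_poly_eq0 -leqn0; apply: msize_diffop; last by rewrite msize1.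
by rewrite -meval0E /Defs.Bspow (bigD1 j) //= mevalM Bs_meval0 mul0r.
Qed.

End SolutionSpace.

(** * Exponents *)

Section TwistedAction.
Context (R : realType) (n : nat) (v : 'cV[R[i]]_n).
Local Notation C := R[i].
Local Notation Cx := {mpoly C[n]}.
Local Notation K := {fraction Cx}.
Local Notation "x %:F" := (FracField.tofrac x).
Local Notation delta := (@ratweyl_delta R n).
Implicit Types (f : K) (Q : ratweyl R n) (b : 'X_{1..n}).

(* d_j on C(x) x^v, a function f standing for f x^v. *)
Definition twisted_deriv (j : 'I_n) f : K :=
  delta j f + ((v j 0)%:MP)%:F / ('X_j)%:F * f.

Lemma tofracX_neq0 b : ('X_[b] : Cx)%:F != 0.
Proof. by rewrite tofrac_eq0 -msize_poly_eq0 msizeX. Qed.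

Lemma twisted_derivD j : {morph twisted_deriv j : f g / f + g}.
Proof.
move=> f g; rewrite /twisted_deriv mulrDr addrACA; congr (_ + _).
exact: (frac_deriv_is_additive (@mderivD n C j) (@mderivM n C j)).
Qed.

Lemma twisted_deriv_scale j f g :
  twisted_deriv j (f * g) = delta j f * g + f * twisted_deriv j g.
Proof.
rewrite /twisted_deriv [delta j (f * g)]frac_mderivM mulrDr -addrA.
by congr (_ + (_ + _)); rewrite mulrCA.
Qed.

Lemma twisted_derivC i j f :
  twisted_deriv i (twisted_deriv j f) = twisted_deriv j (twisted_deriv i f).
Proof.
have [->//|ne_ij] := eqVneq i j.
have delta_s k l : k != l -> delta k (((v l 0)%:MP)%:F / ('X_l)%:F) = 0.
  move=> ne_kl; rewrite [LHS]frac_mderiv_div; last first.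
    by rewrite -msize_poly_eq0 msizeX.
  rewrite mderivC mderivXU eq_sym (negPf ne_kl) mul0r mulr0 subr0.
  by rewrite tofrac0 mul0r.
have twistE k l : k != l -> twisted_deriv k (twisted_deriv l f)
    = delta k (delta l f)
      + (((v l 0)%:MP)%:F / ('X_l)%:F * delta k f
         + ((v k 0)%:MP)%:F / ('X_k)%:F * delta l f)
      + ((v k 0)%:MP)%:F / ('X_k)%:F * (((v l 0)%:MP)%:F / ('X_l)%:F) * f.
  move=> ne_kl; rewrite {1}/twisted_deriv.
  have -> : delta k (twisted_deriv l f)
      = delta k (delta l f) + ((v l 0)%:MP)%:F / ('X_l)%:F * delta k f.
    rewrite /twisted_deriv.
    rewrite [LHS](frac_deriv_is_additive (@mderivD n C k) (@mderivM n C k)).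
    congr (_ + _); rewrite [LHS]frac_mderivM -[X in X * _ + _]/(delta k _).
    by rewrite delta_s // mul0r add0r.
  by rewrite /twisted_deriv mulrDr !addrA mulrA.
rewrite twistE // twistE 1?eq_sym //.
apply: (f_equal2 +%R); last by apply: (f_equal2 *%R); first exact: mulrC.
by apply: (f_equal2 +%R); [exact: frac_mderiv_comm | exact: addrC].
Qed.

Lemma twisted_deriv_pow j b (c : C) :
  twisted_deriv j ((c%:MP)%:F / ('X_[b] : Cx)%:F)
  = (((v j 0 - (b j)%:R) * c)%:MP)%:F / ('X_[b + U_(j)] : Cx)%:F.
Proof.
have X0 b' : ('X_[b'] : Cx) != 0 by rewrite -msize_poly_eq0 msizeX.
rewrite /twisted_deriv [delta j _]frac_mderiv_div //.
rewrite mderivC mul0r sub0r mulf_div -!tofracM.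
have -> : (- (c%:MP * ('X_[b])^`M(j)))%:F / (('X_[b] : Cx) ^+ 2)%:F
    = ((- (b j)%:R * c)%:MP)%:F / ('X_[b + U_(j)] : Cx)%:F.
  apply/eqP; rewrite eqr_div ?tofracX_neq0 ?tofrac_eq0 ?expf_neq0 //.
  rewrite -!tofracM tofrac_eq mderivX; have [->|bj] := eqVneq (b j) 0%N.
    by rewrite scale0r mulr0 oppr0 mul0r oppr0 mul0r mpolyC0 mul0r.
  have Uj : (U_(j) <= b)%MM by rewrite lep1mP.
  have XX : 'X_[b - U_(j)] * 'X_[b + U_(j)] = 'X_[b] ^+ 2 :> Cx.
    by rewrite -mpolyXD [(b + U_(j))%MM]addmC addmA submK // expr2 mpolyXD.
  have mulE (S : comNzRingType) (x y z t : S) :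
      - (x * (y * z)) * t = - (y * x) * (z * t) by ring.
  by rewrite -XX -mul_mpolyC mulE mulNr mpolyCN mpolyCM.
have -> : ('X_j : Cx) * 'X_[b] = 'X_[b + U_(j)] by rewrite -mpolyXD addmC.
rewrite -mulrDl -tofracD -mpolyCM -mpolyCD; congr ((_%:MP)%:F / _).
by rewrite mulrBl mulNr addrC.
Qed.

Lemma iter_twisted_deriv b : iter_mon twisted_deriv b 1
  = ((falling (fun j => v j 0) b)%:MP)%:F / ('X_[b] : Cx)%:F.
Proof.
elim/mnm_ind: b => [|b j IH].
  by rewrite iter_mon0 falling0 mpolyC1 mpolyX0 divr1.
rewrite iter_monDU; last exact: twisted_derivC.
by rewrite IH twisted_deriv_pow fallingDU.
Qed.

Local Notation act := (op_act (fun f g : K => f * g) twisted_deriv).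

Let scDl (g : K) : {morph (fun f => f * g) : f1 f2 / f1 + f2}.
Proof. by move=> f1 f2; rewrite mulrDl. Qed.

Lemma twisted_act_mul P Q f : act (op_mul delta P Q) f = act P (act Q f).
Proof.
apply: op_act_mul.
- by move=> j; exact: (raddf0 (frac_deriv (@mderiv n C j))).
- exact: scDl.
- by move=> a g1 g2; rewrite mulrDr.
- by move=> a b' g1; rewrite mulrA.
- exact: twisted_derivD.
- exact: twisted_deriv_scale.
- exact: twisted_derivC.
Qed.

(** Here 1 stands for x^v, an eigenvector of each theta_j with eigenvalue v_j. *)
Lemma twisted_act_theta (p : Cx) : act (theta_poly p) 1 = ((p.@[fun j => v j 0])%:MP)%:F.
Proof.
rewrite /theta_poly op_act_sum //.
rewrite mevalE (rmorph_sum (@mpolyC n C)) (rmorph_sum (@FracField.tofrac Cx)).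
apply: eq_bigr => m _.
rewrite op_actZ //; first last.
- by move=> a b' g1; rewrite mulrA.
- by move=> a g1 g2; rewrite mulrDr.
rewrite [RHS](congr1 (@FracField.tofrac Cx) (mpolyCM _ _ _)) tofracM; congr (_ * _).
rewrite (iter_mon_morph (f := act^~ 1) (T' := fun j f => ('X_j)%:F * twisted_deriv j f)).
  have -> : act 1 1 = ((1%:MP : Cx)%:F : K).
    by rewrite -mpolyX0 op_actX // ?iter_mon0 ?mpolyC1 ?tofrac1 // => g1; rewrite mul1r.
  rewrite -(iter_mon_morph (f := fun c : C => (c%:MP : Cx)%:F)
    (T := fun j => *%R (v j 0))) ?iter_mon_mul ?mulr1 // => j c.
  have := twisted_deriv_pow j 0%MM c.
  rewrite mpolyX0 tofrac1 divr1 mnm0E subr0 add0m => ->.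
  by rewrite [RHS]mulrC divfK // tofracX_neq0.
move=> j Q; rewrite [LHS]twisted_act_mul op_actZX //.
by rewrite -[U_(j)%MM]add0m iter_monDU ?iter_mon0 //; exact: twisted_derivC.
Qed.

End TwistedAction.

(** * Initial forms annihilate x^v *)

Section InitialForms.
Context (R : realType) (n : nat) (w : 'cV[R]_n) (v : 'cV[R[i]]_n).
Local Notation C := R[i].
Local Notation Cx := {mpoly C[n]}.
Local Notation "x %:F" := (FracField.tofrac x).
Local Notation act := (op_act (fun f g : {fraction Cx} => f * g) (twisted_deriv v)).

Lemma re_weight_add a b : re_weight w (a + b) = re_weight w a + re_weight w b.
Proof.
rewrite /re_weight -big_split; apply: eq_bigr => j _ /=.
by rewrite !mxE -mulrDr; case: (a j 0) (b j 0) => [x y] [x' y'].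
Qed.

Lemma re_weight_mnm m : re_weight w (mnmC R m) = Defs.mweight w m.
Proof.
apply: eq_bigr => j _; rewrite mxE; congr (_ * _).
by rewrite -(rmorph_nat (@real_complex R)).
Qed.

Lemma re_weight_opp a : re_weight w (- a) = - re_weight w a.
Proof.
rewrite /re_weight -sumrN; apply: eq_bigr => j _.
by rewrite !mxE -mulrN; case: (a j 0).
Qed.

Lemma falling_const_term (a : 'cV[C]_n) m :
  (falling (fun j => (a j 0)%:MP + 'X_j) m : Cx)@_0%MM = falling (fun j => a j 0) m.
Proof.
rewrite -meval0E /falling rmorph_prod; apply: eq_bigr => j _.
rewrite rmorph_prod; apply: eq_bigr => i _ /=.
by rewrite mevalB mevalD mevalC mevalXU addr0 -mpolyC_nat mevalC.
Qed.

Lemma diffop_const1 (p : Cx) : diffop p 1 = (p@_0%MM)%:MP.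
Proof.
rewrite -{1}[p](subrK (p@_0%MM)%:MP) diffopDl diffopCl -[X in _ + X]mul_mpolyC mulr1.
rewrite -[RHS]add0r; congr (_ + _); apply/eqP; rewrite -msize_poly_eq0 -leqn0.
by apply: msize_diffop; rewrite ?msize1 // mcoeffB mcoeffC eqxx mulr1 subrr.
Qed.

Lemma mnm_upper_bound (T : eqType) (F : T -> 'X_{1..n}) (s : seq T) :
  exists N, forall t, t \in s -> (F t <= N)%MM.
Proof.
elim: s => [|t s [N IH]]; first by exists 0%MM.
exists (F t + N)%MM => t'; rewrite inE => /predU1P[->|/IH le_t'].
  exact: lem_addr.
exact: lepm_trans le_t' (lem_addl _ _).
Qed.

(* The part of lowest weight of P f is in_(-w,w)(P) x^v, so that it vanishes when
   P f = 0; the monomial x^N clears the denominators of the twisted action. *)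
Lemma weyl_init_act (P : weyl R n) (f : 'cV[C]_n -> {mpoly C[n]}) :
  f v = 1 -> (forall a, a != v -> f a != 0 -> re_weight w v < re_weight w a) ->
  weyl_act P f = 0 :> ('cV[C]_n -> {mpoly C[n]}) ->
  act (map_mpoly (@FracField.tofrac Cx) (weyl_init w P)) 1 = 0.
Proof.
move=> fv f_gt Pf.
pose wt (t : 'X_{1..n} * 'X_{1..n}) := - Defs.mweight w t.1 + Defs.mweight w t.2.
pose mx t := all (fun t' => wt t' <= wt t) (weyl_terms P).
pose c (t : 'X_{1..n} * 'X_{1..n}) := P@_t.2@_t.1.
pose V (t : 'X_{1..n} * 'X_{1..n}) := falling (fun j => v j 0) t.2.
have scDl (g : {fraction Cx}) : {morph (fun f => f * g) : f1 f2 / f1 + f2}.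
  by move=> f1 f2; rewrite mulrDl.
have [N N_ub] := mnm_upper_bound snd (weyl_terms P).
(* A term x^a d^b sends x^v to [v]_b x^(v+a-b), so S is x^(N-v) times the initial form applied to
   x^v. *)
pose S : Cx := \sum_(t <- weyl_terms P | mx t)
  (c t * V t) *: 'X_[t.1 + (N - t.2)%MM].
have S0 : S = 0.
  apply/mpolyP => mu; rewrite mcoeff0 raddf_sum /=.
  have [/hasP[t0 t0P /andP[mx0 /eqP mu0]]|no_t] :=
      boolP (has (fun t => mx t && ((t.1 + (N - t.2))%MM == mu)) (weyl_terms P)); last first.
    rewrite big_seq_cond big1 // => t /andP[tP mxt]; rewrite mcoeffZ mcoeffX.
    move/hasPn/(_ t tP): no_t; rewrite mxt /= => /negPf ->.
    by rewrite mulr0.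
  (* The coefficient of S at mu is compared with the coefficient of P f at x^(v + mu - N), which is
     0. *)
  pose a := v + mnmC R mu - mnmC R N.
  have := congr1 (fun F : 'cV[C]_n -> {mpoly C[n]} => F a) Pf.
  rewrite /weyl_act => PfE; apply/eqP; rewrite -(mpolyC_eq0 n) -[X in _ == X]PfE; apply/eqP.
  rewrite rmorph_sum /= [in LHS]big_mkcond [in LHS]big_seq [in RHS]big_seq.
  apply: eq_bigr => t tP.
  rewrite iter_ser_x iter_ser_partial mcoeffZ mcoeffX -/(c t).
  pose b := a - mnmC R t.1 + mnmC R t.2; rewrite -/b.
  have NE e : e \in weyl_terms P -> mnmC R N = mnmC R (N - e.2)%MM + mnmC R e.2.
    by move=> eP; rewrite -mnmCD submK // N_ub.
  have bE : b = v + (mnmC R mu - mnmC R (t.1 + (N - t.2))%MM).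
    by rewrite /b /a (NE t tP) mnmCD; apply/colP => j; rewrite !mxE; ring.
  (* The term t reads f at the exponent b. Its weight exceeds that of v by wt t - wt t0 <= 0, so
     only b = v can contribute, and then t is maximal like t0. *)
  have wb : re_weight w b = re_weight w v + (wt t - wt t0).
    rewrite /b /a !(re_weight_add, re_weight_opp) !re_weight_mnm -mu0 !mweightD.
    have : Defs.mweight w N = Defs.mweight w (N - t0.2)%MM + Defs.mweight w t0.2.
      by rewrite -mweightD submK // N_ub.
    rewrite /wt => ->; ring.
  have wt_t : wt t <= wt t0 by move/allP: mx0; apply.
  have [t_mu|t_mu] := eqVneq (t.1 + (N - t.2))%MM mu.
    have b_v : b = v by rewrite bE t_mu subrr addr0.
    have -> : mx t.
      apply/allP => t' t'P; apply: le_trans (allP mx0 t' t'P) _.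
      by have := wb; rewrite b_v => /eqP; rewrite -subr_eq0 opprD addrA subrr sub0r
        oppr_eq0 subr_eq0 => /eqP ->.
    by rewrite b_v fv diffop_const1 falling_const_term mulr1 -mul_mpolyC -mpolyCM.
  have -> : f b = 0.
    apply/eqP; apply: contraT => fb0.
    have b_v : b != v.
      apply: contra_neq t_mu => b_v; apply/mnmP => j.
      have /eqP := bE; rewrite b_v eq_sym -subr_eq0 addrAC subrr add0r => /eqP/colP/(_ j).
      by rewrite !mxE => /eqP; rewrite subr_eq0 eqr_nat => /eqP.
    by have := f_gt b b_v fb0; rewrite wb ltrDl subr_gt0 ltNge wt_t.
  by rewrite linear0 scaler0; case: ifP => _; rewrite ?mulr0 ?mpolyC0.
apply: (mulfI (tofracX_neq0 (n := n) R N)); rewrite mulr0 -tofrac0 -S0.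
rewrite /weyl_init (rmorph_sum (map_mpoly (@FracField.tofrac Cx))) op_act_sum //.
rewrite /S (rmorph_sum (@FracField.tofrac Cx)) mulr_sumr big_seq_cond [RHS]big_seq_cond.
apply: eq_bigr => t /andP[tP _].
transitivity (('X_[N] : Cx)%:F * act ((c t *: 'X_[t.1] : Cx)%:F *: 'X_[t.2]) 1).
  congr (_ * act _ 1); rewrite [LHS](map_mpolyZ (@FracField.tofrac Cx)).
  by congr (_ *: _); exact: (map_mpolyX (@FracField.tofrac Cx)).
rewrite op_actZX // iter_twisted_deriv -/(V t).
have XN : ('X_[N] : Cx) = 'X_[(N - t.2)%MM] * 'X_[t.2].
  by rewrite -mpolyXD submK // N_ub.
have -> : (c t * V t) *: 'X_[t.1 + (N - t.2)%MM]
    = 'X_[(N - t.2)%MM] * ((c t *: 'X_[t.1]) * (V t)%:MP) :> Cx.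
  rewrite [_ * (V t)%:MP]mulrC mul_mpolyC scalerA -scalerAr [V t * _]mulrC.
  by rewrite -mpolyXD addmC.
rewrite XN [LHS](congr1 (fun x => x * _) (tofracM _ _)) [RHS]tofracM.
rewrite -mulrA; congr (_ * _); rewrite [RHS]tofracM mulrCA; congr (_ * _).
by rewrite mulrC divfK // tofracX_neq0.
Qed.

(** For p in the indicial ideal, p(theta) is a left combination of initial forms and kills x^v; but
    p(theta) x^v = p(v) x^v. *)
Lemma exponent_of_solution (H : weyl R n -> Prop) (f : 'cV[C]_n -> {mpoly C[n]}) :
  f v = 1 -> (forall a, a != v -> f a != 0 -> re_weight w v < re_weight w a) ->
  (forall P, H P -> weyl_act P f = 0 :> ('cV[C]_n -> {mpoly C[n]})) ->
  forall p, indicial_ideal w H p -> p.@[fun j => v j 0] = 0.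
Proof.
move=> fv f_gt fH p [k [c [Q [QP thetaE]]]].
have scDl (g : {fraction Cx}) : {morph (fun f => f * g) : f1 f2 / f1 + f2}.
  by move=> f1 f2; rewrite mulrDl.
have := twisted_act_theta v p; rewrite thetaE op_act_sum // big1 => [|i _].
  by move/esym/eqP; rewrite tofrac_eq0 mpolyC_eq0 => /eqP.
rewrite twisted_act_mul; have [P [k' [c' [P' [HP ->]]]] ->] := QP i.
have -> : act (map_mpoly (@FracField.tofrac Cx)
    (\sum_(i0 < k') (c' i0)%:MP *: weyl_init w (P' i0))) 1 = 0.
  rewrite (rmorph_sum (map_mpoly (@FracField.tofrac Cx))) op_act_sum // big1 // => l _.
  rewrite [X in act X _](map_mpolyZ (@FracField.tofrac Cx)) op_actZ //; first last.
  - by move=> a b g1; rewrite mulrA.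
  - by move=> a g1 g2; rewrite mulrDr.
  by rewrite (weyl_init_act fv f_gt (fH _ (HP l))) mulr0.
have twist0 j : twisted_deriv v j 0 = 0.
  by apply: (addrI (twisted_deriv v j 0)); rewrite -twisted_derivD !addr0.
rewrite /op_act big1 // => b _.
by rewrite (iter_mon_ind (P := fun x => x = 0)) ?mulr0 // => j y ->.
Qed.

End InitialForms.

Theorem theorem4p4 (R : realType) (d n : nat) (A : 'M[int]_(d, n))
  (hrank : \rank (map_mx intr A : 'M[rat]_(d, n)) = d)
  (hhom : homogeneous_matrix A)
  (beta : 'cV[R[i]]_d) (w : 'cV[R]_n) (hw : generic_weight A beta w)
  (v : 'cV[R[i]]_n) (hv : fake_exponent A beta w v)
  (M : nat) (g : 'I_M -> 'cV[int]_n) (hg : toric_groebner_basis A w g)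
  (h : nat) (B : 'M[int]_(n, h)) (hB : lattice_basis A B)
  (hP : forall p : {mpoly R[i][h]},
      PN A v B g p <->
      exists2 p', PB v B g p' & p = ms A v B g * p') :
  [/\ exponent A beta w v,
      spans_solutions_with_exponent A beta w v
        (fun f => exists2 q, perp (PN A v B g) q & f = Ftilde A v B g q)
    & forall q, perp (PN A v B g) q ->
        starting_term w v (Ftilde A v B g q)
          (PsiB B (diffop (ms A v B g) q))].
Proof.
have solves q : perp (PN A v B g) q -> forall P, hyp_ideal A beta P ->
    weyl_act P (Ftilde A v B g q) = 0 :> ('cV[R[i]]_n -> {mpoly R[i][n]}).
  exact: Ftilde_annihilated hhom hv hg hB _.
split.
- have [q perp_q msq] := perp_lift hB hP (start_one B hv hg).
  apply: (exponent_of_solution _ _ (solves q perp_q)).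
    by rewrite (Ftilde_start B hhom hv hg) msq PsiB1.
  exact: (Ftilde_weight hg).
- split=> [_ [q perp_q ->]|f f_sol f_ge].
    split; last exact: (Ftilde_weight_ge hg).
    split=> [|P HP a]; first exact: (Ftilde_nilsson hhom hv hg hB).
    by rewrite (solves q perp_q P HP).
  have [r fvE PBr] := solution_start hv hg hB f_sol f_ge.
  have [q perp_q msq] := perp_lift hB hP PBr.
  exists (Ftilde A v B g q); last by rewrite (Ftilde_start B hhom hv hg) msq fvE.
  exists 1%N, (fun=> 1), (fun=> Ftilde A v B g q).
  by split=> [_|a]; [exists q | rewrite big_ord1 scale1r].
- move=> q perp_q; split; first exact: (Ftilde_start B hhom hv hg).
  exact: (Ftilde_weight hg).
Qed.
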